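(* Let $\Omega\subset\mathbb C^n$ be a bounded domain and let $1<p<\infty$. Then $K_p(\cdot)\in C^{1,1/2}(\Omega)$. Moreover, for any $1\le j\le 2n$ and any $z\in\Omega$, $$\frac{\partial K_p}{\partial x_j}(z)=p\,\mathrm{Re}\left(\frac{\partial K_p(\cdot,z)}{\partial x_j}\bigg|_{z}\right),$$ where $(x_1,\dots,x_{2n})$ are the real coordinates in $\mathbb R^{2n}=\mathbb C^n$ and the right-hand side is the derivative of the function $w\mapsto K_p(w,z)$ evaluated at $w=z$.
   Context: All integrals are with respect to Lebesgue measure. $\mathcal O(\Omega)$ is the set of holomorphic functions on $\Omega$, and $A^p(\Omega)=\{f\in\mathcal O(\Omega):\|f\|_p^p:=\int_\Omega|f|^p<\infty\}$. For $z\in\Omega$ put $m_p(z):=\inf\{\|f\|_p: f\in A^p(\Omega),\ f(z)=1\}$. For $1\le p<\infty$ this infimum is attained by exactly one function, denoted $m_p(\cdot,z)$. The $p$-Bergman kernel is $K_p(z):=m_p(z)^{-p}$, and the off-diagonal $p$-Bergman kernel is $K_p(w,z):=m_p(w,z)K_p(z)$ (holomorphic in $w$). $C^{1,1/2}(\Omega)$ is understood in the interior sense: $C^1$ functions on $\Omega$ whose first order partial derivatives are Hölder continuous of exponent $1/2$ on every relatively compact subdomain of $\Omega$. *)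

(* Defs.v *)
From HB Require Import structures.
From mathcomp Require Import all_boot all_order all_algebra.
From mathcomp Require Import all_classical all_reals all_analysis.
From mathcomp Require Import complex.

Set Implicit Arguments.
Unset Strict Implicit.
Unset Printing Implicit Defensive.

Import Order.TTheory GRing.Theory Num.Theory.
Import numFieldNormedType.Exports.

Local Open Scope classical_set_scope.
Local Open Scope ring_scope.
Local Open Scope complex_scope.

(* The usual topology and norm of the numeric field R[i], so that continuity,
   [differentiable], [bounded_set], ... over R[i] are the library's. *)
HB.instance Definition _ (R : rcfType) := NormedModule.copy R[i] (R[i])^o.

Section LebesgueTuple.
Context (R : realType).
Local Notation RB := (measurableTypeR R).
Local Open Scope ereal_scope.

Definition tuple_consp m (x : RB * m.-tuple RB) : m.+1.-tuple RB :=
  [tuple of x.1 :: x.2].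

Definition tuple_unconsp m (t : m.+1.-tuple RB) : RB * m.-tuple RB :=
  (tnth t ord0, [tuple of behead t]).

Lemma tuple_unconspK m : cancel (@tuple_unconsp m) (@tuple_consp m).
Proof. by move=> t; rewrite /tuple_consp /= -[in LHS]/(thead t) -tuple_eta. Qed.

Lemma tuple_conspK m : cancel (@tuple_consp m) (@tuple_unconsp m).
Proof.
by move=> [x t]; congr pair; rewrite /= ?tnth0//; apply/val_inj.
Qed.

Lemma measurable_tuple_consp m : measurable_fun [set: _] (@tuple_consp m).
Proof. exact: measurable_cons. Qed.

Lemma measurable_tuple_unconsp m : measurable_fun [set: _] (@tuple_unconsp m).
Proof.
by apply/measurable_fun_pairP; split; [exact: measurable_tnth|
  exact: measurable_behead].
Qed.

(* Lebesgue measure on the Borel sets of R^m, as the m-fold product of the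
   one-dimensional Lebesgue measure. *)
Fixpoint lebesgue_tuple (m : nat) : set (m.-tuple RB) -> \bar R :=
  match m with
  | 0%N => dirac [tuple]
  | m'.+1 =>
      pushforward (@lebesgue_measure R \x @lebesgue_tuple m') (@tuple_consp m')
  end.

Section Step.
Variables (m : nat) (mu : {sigma_finite_measure set (m.-tuple RB) -> \bar R}).
Let leb1 : {sigma_finite_measure set RB -> \bar R} := @lebesgue_measure R.

Definition lebesgue_tuple_step : set (m.+1.-tuple RB) -> \bar R :=
  pushforward (leb1 \x mu) (@tuple_consp m).

HB.instance Definition _ := Measure.copy lebesgue_tuple_step
  (measure_function_pushforward__canonical__measure_function_Measure
    (leb1 \x mu) (@measurable_tuple_consp m)).

Let lebesgue_tuple_step_sigma_finite : sigma_finite [set: _] lebesgue_tuple_step.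
Proof.
have /sigma_finiteP[F [FT ndF Foo]] := sigma_finiteT leb1.
have /sigma_finiteP[G [GT ndG Goo]] := sigma_finiteT mu.
exists (fun k => @tuple_unconsp m @^-1` (F k `*` G k)).
  rewrite -preimage_bigcup (_ : \bigcup_k (F k `*` G k) = setT) ?preimage_setT//.
  apply/seteqP; split => // -[x y] _.
  have [k _ Fkx] : (\bigcup_k F k) x by rewrite -FT.
  have [l _ Gly] : (\bigcup_k G k) y by rewrite -GT.
  exists (maxn k l) => //; split => /=.
  - by move: x Fkx; exact/subsetPset/ndF/leq_maxl.
  - by move: y Gly; exact/subsetPset/ndG/leq_maxr.
move=> k; have [mF Fk] := Foo k; have [mG Gk] := Goo k; split.
  rewrite -[X in measurable X]setTI; apply: measurable_tuple_unconsp => //.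
  exact: measurableX.
rewrite /lebesgue_tuple_step /pushforward -comp_preimage.
rewrite (_ : _ \o _ = id); last first.
  by apply/funext => x /=; exact: tuple_conspK.
rewrite preimage_id (product_measure1E leb1 mu)//.
by rewrite lte_mul_pinfty// ge0_fin_numE.
Qed.

HB.instance Definition _ := Measure_isSigmaFinite.Build _ _ _
  lebesgue_tuple_step lebesgue_tuple_step_sigma_finite.
End Step.

Lemma lebesgue_tupleP m :
  exists mu : {sigma_finite_measure set (m.-tuple RB) -> \bar R},
    @lebesgue_tuple m = mu.
Proof.
elim: m => [|m [mu mE]]; first by exists (@dirac _ _ [tuple] R).
by exists (lebesgue_tuple_step mu); rewrite /= mE.
Qed.

Section Instances.
Variable m : nat.

Let lebesgue_tuple0 : @lebesgue_tuple m set0 = 0.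
Proof. by have [mu ->] := lebesgue_tupleP m; exact: measure0. Qed.

Let lebesgue_tuple_ge0 A : 0 <= @lebesgue_tuple m A.
Proof. by have [mu ->] := lebesgue_tupleP m; exact: measure_ge0. Qed.

Let lebesgue_tuple_sigma_additive : semi_sigma_additive (@lebesgue_tuple m).
Proof.
by have [mu ->] := lebesgue_tupleP m; exact: measure_semi_sigma_additive.
Qed.

HB.instance Definition _ := isMeasure.Build _ _ _ (@lebesgue_tuple m)
  lebesgue_tuple0 lebesgue_tuple_ge0 lebesgue_tuple_sigma_additive.

Let lebesgue_tuple_sigma_finite : sigma_finite [set: _] (@lebesgue_tuple m).
Proof. by have [mu ->] := lebesgue_tupleP m; exact: sigma_finiteT. Qed.

HB.instance Definition _ := Measure_isSigmaFinite.Build _ _ _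
  (@lebesgue_tuple m) lebesgue_tuple_sigma_finite.
End Instances.

Lemma lebesgue_tuple_box m (A : 'I_m -> set RB) :
  (forall i, measurable (A i)) ->
  lebesgue_tuple [set t : m.-tuple RB | forall i, A i (tnth t i)] =
  \prod_(i < m) @lebesgue_measure R (A i).
Proof.
elim: m A => [A _|m IH A mA]; first by rewrite big_ord0 /= diracE mem_set//; case.
rewrite big_ord_recl /= /pushforward -IH//.
set B := [set t : m.-tuple RB | forall i, A (lift ord0 i) (tnth t i)].
have mB : measurable B.
  rewrite (_ : B = \bigcap_(i in [set: 'I_m])
      ((@tnth m RB ^~ i) @^-1` A (lift ord0 i))); last first.
    by apply/seteqP; split => t /= tA i => [_|]; exact: tA.
  apply: fin_bigcap_measurable => // i _.
  by rewrite -[X in measurable X]setTI; exact: measurable_tnth.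
rewrite (_ : _ @^-1` _ = A ord0 `*` B).
  exact: (product_measure1E (@lebesgue_measure R) (@lebesgue_tuple m)).
apply/seteqP; split => -[x t] /=.
  move=> H; split; first by have := H ord0; rewrite tnth0.
  by move=> i; have := H (lift ord0 i); rewrite tnthS.
move=> [Ax At] i; case: (unliftP ord0 i) => [j ->|->]; last by rewrite tnth0.
by rewrite tnthS; exact: At.
Qed.

End LebesgueTuple.

Section ComplexSpace.
Context (R : realType) (n : nat).
Implicit Types (Omega D : set 'rV[R[i]]_n) (z w : 'rV[R[i]]_n) (j : 'I_(n + n)).

(* The identification R^2n = C^n: the coordinates x_0, ..., x_(n-1) are the real
   parts and x_n, ..., x_(2n-1) the imaginary parts of z_0, ..., z_(n-1). *)
Definition complex_of_coords (x : 'I_(n + n) -> R) : 'rV[R[i]]_n :=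
  \row_k (x (lshift n k) +i* x (rshift n k)).

Definition real_coords z : 'rV[R]_(n + n) :=
  row_mx (map_mx (@complex.Re R) z) (map_mx (@complex.Im R) z).

Lemma real_coordsK z : complex_of_coords (real_coords z ord0) = z.
Proof.
apply/rowP => k; rewrite mxE row_mxEl row_mxEr !mxE.
by case: (z ord0 k).
Qed.

Lemma complex_of_coordsK (x : 'rV[R]_(n + n)) :
  real_coords (complex_of_coords (x ord0)) = x.
Proof.
apply/rowP => j; case: (split_ordP j) => k ->.
  by rewrite row_mxEl !mxE.
by rewrite row_mxEr !mxE.
Qed.

Definition domain Omega := [/\ Omega !=set0, open Omega & connected Omega].

Definition euclidean_dist z w : R :=
  Num.sqrt (\sum_k Normc.normc (z ord0 k - w ord0 k) ^+ 2).

Definition holomorphic Omega (f : 'rV[R[i]]_n -> R[i]) :=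
  forall z, Omega z -> differentiable f z.

Definition pderivable j (u : 'rV[R[i]]_n -> R) z :=
  derivable (fun x : 'rV[R]_(n + n) => u (complex_of_coords (x ord0)))
    (real_coords z) (delta_mx ord0 j).

Definition pderiv j (u : 'rV[R[i]]_n -> R) z : R :=
  'D_(delta_mx ord0 j)
    (fun x : 'rV[R]_(n + n) => u (complex_of_coords (x ord0))) (real_coords z).

Definition pderivC j (f : 'rV[R[i]]_n -> R[i]) z : R[i] :=
  pderiv j (fun w => complex.Re (f w)) z +i*
  pderiv j (fun w => complex.Im (f w)) z.

(* C^{1,alpha}(Omega) in the interior sense. *)
Definition C1_holder (alpha : R) Omega (u : 'rV[R[i]]_n -> R) :=
  [/\ forall j z, Omega z -> pderivable j u z,
      forall j z, Omega z -> {for z, continuous (pderiv j u)}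
    & forall D, domain D -> compact (closure D) -> closure D `<=` Omega ->
      forall j, exists C : R, forall z w, D z -> D w ->
        `|pderiv j u z - pderiv j u w| <= C * euclidean_dist z w `^ alpha].

End ComplexSpace.

Section Bergman.
Context (R : realType) (n : nat) (p : R) (Omega : set 'rV[R[i]]_n).
Implicit Types (f : 'rV[R[i]]_n -> R[i]) (z w : 'rV[R[i]]_n).

Definition integral_normp f : \bar R :=
  \int[@lebesgue_tuple R (n + n)]_(x in
      [set x | Omega (complex_of_coords (tnth x))])
    (Normc.normc (f (complex_of_coords (tnth x))) `^ p)%:E.

Definition Lp_norm f : R := fine (integral_normp f) `^ p^-1.

(* Elements of A^p(Omega), each represented by its extension by 0 to C^n, so
   that equality of the representatives is equality on Omega. *)
Definition bergman_space f :=
  [/\ holomorphic Omega f, forall z, ~ Omega z -> f z = 0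
    & (integral_normp f < +oo)%E].

Definition bergman_admissible z f := bergman_space f /\ f z = 1.

Definition bergman_min z : R := inf [set Lp_norm f | f in bergman_admissible z].

Definition bergman_minimizer z : 'rV[R[i]]_n -> R[i] :=
  xget (fun=> 0)
    [set f | bergman_admissible z f /\ Lp_norm f = bergman_min z].

Definition bergman_kernel z : R := bergman_min z `^ (- p).

Definition bergman_kernel_off w z : R[i] :=
  bergman_minimizer z w * (bergman_kernel z)%:C.

End Bergman.

(* Main.v *)
From HB Require Import structures.
Require Import Defs.
From mathcomp Require Import all_boot all_order all_algebra.
From mathcomp Require Import all_classical all_reals all_analysis.
From mathcomp Require Import measurable_realfun complex ring lra.

Set Implicit Arguments.
Unset Strict Implicit.
Unset Printing Implicit Defensive.

Import Order.TTheory GRing.Theory Num.Theory.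
Import numFieldNormedType.Exports.

Local Open Scope classical_set_scope.
Local Open Scope ring_scope.

(** Write m(z) for the least integral of |f|^p over Omega among the f in A^p
    with f(z) = 1, so that the kernel is K = 1/m, and g_z for the minimizer.

    If f is in A^p then f / f(w) competes for m(w), whence
    K(w) >= K(z) |g_z(w)|^p ([point_le]). Bernoulli's inequality and a second
    order Taylor bound for g_z turn this into
      K(z + h) - K(z) >= p K(z) Re (dg_z(z) h) - O(|h|^2)    ([kernel_lower]),
    and exchanging the two points gives the corresponding upper bound with the
    differential of g_(z+h) at z + h ([kernel_upper]). Both assertions of the
    theorem therefore follow once z |-> dg_z(z) is shown to be locally
    1/2-Hoelder ([bgrad_holder], [kernel_gradient]).

    To see this, let w = z + h. By Lipschitz continuity of m the midpoint of
    g_z and g_w, which is almost admissible at z, loses only O(|h|) in the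
    integral of the p-th power ([pint_midp_energy]). Near z both functions are
    close to 1, where |.|^p is quadratically convex for every p > 1
    ([defect_near1]); so the integral of |g_z - g_w|^2 over a fixed cube around
    z is O(|h|) ([integral_defect_le]). The mean value inequality converts this
    into a uniform bound O(|h|^(1/2)) ([minimizers_close]), and Cauchy's
    estimate into a bound for the differentials.

    Minimizers exist by the same mechanism: midpoints of almost minimizers
    cannot go below the minimum, so uniform convexity with exponent max(2, p)
    ([defect_uniform]) and the mean value inequality make minimizing sequences
    locally uniformly Cauchy ([minimizing_cauchy]), and Fatou's lemma applies
    to the limit ([minimizer_exists]).

    The function theory rests on Goursat's theorem for closed real forms on
    squares ([goursat]). Squares around a singular point have equal
    circulations ([circ0_third]), which yields a lower bound for the
    circulation of psi(z)/z in terms of psi(0) ([residue_Re]). Estimating that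
    circulation by a maximum gives Cauchy's estimate ([cauchy_estimate]) and
    the Taylor bounds; estimating it by an integral and integrating over the
    size of the square gives the mean value inequality on squares
    ([area_bound]), then on cubes one complex coordinate at a time
    ([submean_box]). The constants are far from sharp; what matters is that
    they do not depend on the function. *)

(** * Goursat's theorem for closed forms on squares *)

Section Circulation.
Context {R : realType}.
Local Notation mu := (@lebesgue_measure R).
Implicit Types (P Q : R -> R -> R) (g : R -> R) (a b c h k x y : R).

Definition intv a b g : R := \int[mu]_(x in `[a, b]) g x.

Lemma integrable_cc a b g : {within `[a, b], continuous g} ->
  mu.-integrable `[a, b] (EFin \o g).
Proof. by move=> cg; apply: continuous_compact_integrable => //; exact: segment_compact. Qed.

(** Comparison with a constant is how side integrals are estimated in Goursat's
    theorem and in the residue bound. *)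
Lemma intv_near_cst a b g k M : a <= b -> {within `[a, b], continuous g} ->
  (forall x, a <= x <= b -> `|g x - k| <= M) ->
  `|intv a b g - k * (b - a)| <= M * (b - a).
Proof.
move=> ab cg gM.
have cst_int r : intv a b (fun=> r) = r * (b - a).
  rewrite /intv Rintegral_cst//; congr (_ * _).
  by rewrite /= lebesgue_measure_itv/= lte_fin; case: ltgtP ab => // -> _; rewrite subrr.
have ccst r : {within `[a, b], continuous (fun=> r : R)}.
  by apply: continuous_subspaceT => x; exact: cvg_cst.
rewrite -!cst_int /intv -RintegralB//=; [|exact: integrable_cc..].
have cgk : {within `[a, b], continuous (fun x => g x - k)}.
  by move=> x; apply: continuousB; [exact: cg|exact: ccst].
apply: le_trans (le_normr_Rintegral _ _) _ => //; first exact: integrable_cc.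
apply: le_Rintegral => //; last exact: integrable_cc.
by apply: integrable_cc => x; apply: cvg_norm; exact: cgk.
Qed.

Lemma intv_chasles a b c g : a <= b -> b <= c -> {within `[a, c], continuous g} ->
  intv a c g = intv a b g + intv b c g.
Proof.
move=> ab bc /integrable_cc ig; rewrite /intv.
have := @Rintegral_itvB R g (BLeft a) (BRight c) b ig.
rewrite !bnd_simp => /(_ ab bc) H.
rewrite -(@Rintegral_itv_obnd_cbnd _ b); last first.
  by apply: integrableS ig => //; apply: subset_itvr; rewrite bnd_simp.
by rewrite -H addrC subrK.
Qed.

Lemma within_sub a b c d g : c <= a -> b <= d ->
  {within `[c, d], continuous g} -> {within `[a, b], continuous g}.
Proof.
move=> ca bd; apply: continuous_subspaceW => x /=; rewrite !in_itv/=; lra.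
Qed.

Lemma intvB a b f g : {within `[a, b], continuous f} ->
  {within `[a, b], continuous g} ->
  intv a b (fun x => f x - g x) = intv a b f - intv a b g.
Proof. by move=> cf cg; rewrite /intv RintegralB//; exact: integrable_cc. Qed.

(** The circulation of the form P dx + Q dy along the boundary of the square
    with lower left corner (a, c) and side h. *)
Definition circ P Q a c h :=
  intv a (a + h) (fun x => P x c - P x (c + h)) +
  intv c (c + h) (fun y => Q (a + h) y - Q a y).

(** Continuity along horizontal and vertical lines is all that the side
    integrals need in order to be split and added. *)
Definition line_continuous P Q a c h :=
  (forall y, c <= y <= c + h -> {within `[a, a + h], continuous P^~ y}) /\
  (forall x, a <= x <= a + h -> {within `[c, c + h], continuous Q x}).

Lemma line_continuous_sub P Q a c h a' c' h' :
  a <= a' -> c <= c' -> a' + h' <= a + h -> c' + h' <= c + h ->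
  line_continuous P Q a c h -> line_continuous P Q a' c' h'.
Proof.
move=> ? ? ? ? [cP cQ]; split => [y hy|x hx].
  by apply: (within_sub _ _ (cP y _)) => //; lra.
by apply: (within_sub _ _ (cQ x _)) => //; lra.
Qed.

Lemma circ_quarter P Q a c k : 0 <= k -> line_continuous P Q a c (k + k) ->
  circ P Q a c (k + k) = circ P Q a c k + circ P Q (a + k) c k +
    circ P Q a (c + k) k + circ P Q (a + k) (c + k) k.
Proof.
move=> k0 [cP cQ]; rewrite /circ.
have cP' y x1 x2 : c <= y <= c + (k + k) -> a <= x1 -> x2 <= a + (k + k) ->
    {within `[x1, x2], continuous P^~ y}.
  by move=> hy ? ?; apply: (within_sub _ _ (cP y hy)); lra.
have cQ' x y1 y2 : a <= x <= a + (k + k) -> c <= y1 -> y2 <= c + (k + k) ->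
    {within `[y1, y2], continuous Q x}.
  by move=> hx ? ?; apply: (within_sub _ _ (cQ x hx)); lra.
rewrite !addrA in cP' cQ' *.
rewrite !intvB; try (by [apply: cP'; clear -k0; lra | apply: cQ'; clear -k0; lra]).
rewrite (@intv_chasles a (a + k) (a + k + k)) ?(@intv_chasles a (a + k) (a + k + k) (P^~ (c + k + k)));
  try (by [clear -k0; lra | apply: cP'; clear -k0; lra]).
rewrite (@intv_chasles c (c + k) (c + k + k)) ?(@intv_chasles c (c + k) (c + k + k) (Q a));
  try (by [clear -k0; lra | apply: cQ'; clear -k0; lra]).
Qed.

(** Differentiability of P and Q at one point together with dP/dy = dQ/dx there
    (the common value is p2). For the real and imaginary parts of a complex
    differentiable function these are the Cauchy-Riemann equations. *)
Definition closed_at P Q x0 y0 := exists p1 p2 q2 : R,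
  forall e, 0 < e -> exists2 d, 0 < d & forall x y,
    `|x - x0| <= d -> `|y - y0| <= d ->
    `|P x y - P x0 y0 - p1 * (x - x0) - p2 * (y - y0)| <= e * (`|x - x0| + `|y - y0|) /\
    `|Q x y - Q x0 y0 - p2 * (x - x0) - q2 * (y - y0)| <= e * (`|x - x0| + `|y - y0|).

(** The affine part of P dx + Q dy has circulation zero, because the form is
    closed at the point; what remains is the first order remainder, which is
    O(e h) on each side. *)
Lemma circ_small P Q x0 y0 : closed_at P Q x0 y0 ->
  forall e, 0 < e -> exists2 d, 0 < d & forall a c h, 0 <= h <= d ->
   a <= x0 <= a + h -> c <= y0 <= c + h -> line_continuous P Q a c h ->
   `|circ P Q a c h| <= e * h ^+ 2.
Proof.
move=> [p1 [p2 [q2 H]]] e e0.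
have [d d0 {}H] := H (e / 8) ltac:(lra).
exists d => // a c h hd ha hc [cP cQ].
have E1 : `|intv a (a + h) (fun x => P x c - P x (c + h)) - (- p2 * h) * (a + h - a)| <=
   (e / 2 * h) * (a + h - a).
  apply: intv_near_cst; first lra.
    by move=> x; apply: continuousB; apply: cP; lra.
  move=> x hx.
  have [+ _] := H x c ltac:(rewrite ler_norml; clear -ha hd hx; lra) ltac:(rewrite ler_norml; clear -hc hd; lra).
  have [+ _] := H x (c + h) ltac:(rewrite ler_norml; clear -ha hd hx; lra) ltac:(rewrite ler_norml; clear -hc hd; lra).
  have : `|x - x0| <= h by rewrite ler_norml; lra.
  have : `|c - y0| <= h by rewrite ler_norml; lra.
  have : `|c + h - y0| <= h by rewrite ler_norml; lra.
  move: (`|x - x0|) (`|c - y0|) (`|c + h - y0|) => u v w wh vh uh.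
  rewrite !ler_norml => A B.
  have : e / 8 * (u + v) <= e / 8 * (2 * h) by rewrite ler_wpM2l ?divr_ge0 ?(ltW e0)//; clear -uh vh; lra.
  have : e / 8 * (u + w) <= e / 8 * (2 * h) by rewrite ler_wpM2l ?divr_ge0 ?(ltW e0)//; clear -uh wh; lra.
  by clear -A B; lra.
have E2 : `|intv c (c + h) (fun y => Q (a + h) y - Q a y) - (p2 * h) * (c + h - c)| <=
   (e / 2 * h) * (c + h - c).
  apply: intv_near_cst; first lra.
    by move=> x; apply: continuousB; apply: cQ; lra.
  move=> y hy.
  have [_ +] := H a y ltac:(rewrite ler_norml; clear -ha hd; lra) ltac:(rewrite ler_norml; clear -hc hd hy; lra).
  have [_ +] := H (a + h) y ltac:(rewrite ler_norml; clear -ha hd; lra) ltac:(rewrite ler_norml; clear -hc hd hy; lra).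
  have : `|y - y0| <= h by rewrite ler_norml; lra.
  have : `|a - x0| <= h by rewrite ler_norml; lra.
  have : `|a + h - x0| <= h by rewrite ler_norml; lra.
  move: (`|y - y0|) (`|a - x0|) (`|a + h - x0|) => u v w wh vh uh.
  rewrite !ler_norml => A B.
  have : e / 8 * (v + u) <= e / 8 * (2 * h) by rewrite ler_wpM2l ?divr_ge0 ?(ltW e0)//; clear -vh uh; lra.
  have : e / 8 * (w + u) <= e / 8 * (2 * h) by rewrite ler_wpM2l ?divr_ge0 ?(ltW e0)//; clear -wh uh; lra.
  by clear -A B; lra.
rewrite /circ; move: E1 E2; rewrite !ler_norml; move: (intv _ _ _) (intv _ _ _) => u v.
have -> : (a + h - a) = h by ring.
have -> : (c + h - c) = h by ring.
rewrite expr2; lra.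
Qed.

(** The circulation is additive over the four quarters, so one of them carries
    at least a fourth of it. *)
Lemma circ_pigeonhole P Q a c h : 0 <= h -> line_continuous P Q a c h ->
  exists2 ac : R * R,
    (ac.1 = a \/ ac.1 = a + h / 2) /\ (ac.2 = c \/ ac.2 = c + h / 2) &
    `|circ P Q a c h| <= 4 * `|circ P Q ac.1 ac.2 (h / 2)|.
Proof.
move=> h0 lc; have E := @circ_quarter P Q a c (h / 2).
rewrite -splitr in E; have {}E := E ltac:(lra) lc.
move: E; set u1 := circ _ _ a c (h / 2); set u2 := circ _ _ (a + h/2) c _;
set u3 := circ _ _ a (c + h / 2) _; set u4 := circ _ _ (a + h/2) (c + h / 2) _ => E.
have N : `|circ P Q a c h| <= `|u1| + `|u2| + `|u3| + `|u4|.
  by rewrite E; do 2![apply: le_trans (ler_normD _ _) _; rewrite lerD2r]; exact: ler_normD.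
have [H1|H1] := leP (`|circ P Q a c h|) (4 * `|u1|); first by exists (a, c) => //=; auto.
have [H2|H2] := leP (`|circ P Q a c h|) (4 * `|u2|); first by exists (a + h / 2, c) => //=; auto.
have [H3|H3] := leP (`|circ P Q a c h|) (4 * `|u3|); first by exists (a, c + h / 2) => //=; auto.
have [H4|H4] := leP (`|circ P Q a c h|) (4 * `|u4|); first by exists (a + h / 2, c + h / 2) => //=; auto.
clear -N H1 H2 H3 H4; lra.
Qed.

(** Differentiability at a point gives continuity of the two partial maps,
    hence integrable sides. *)
Lemma closed_at_cont P Q x0 y0 : closed_at P Q x0 y0 ->
  {for x0, continuous (P^~ y0)} /\ {for y0, continuous (Q x0)}.
Proof.
move=> [p1 [p2 [q2 H]]].
have key (f : R -> R) (t0 s : R) :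
    (exists2 d, 0 < d & forall t, `|t - t0| <= d -> `|f t - f t0 - s * (t - t0)| <= 1 * `|t - t0|) ->
    {for t0, continuous (f : R -> R)}.
  move=> [d d0 {}H]; apply/cvgrPdist_le => /= e e0.
  have c0 : 0 < 1 + `|s| by rewrite ltr_wpDr.
  near=> t.
  have td : `|t - t0| <= d.
    by rewrite distrC; near: t; apply: cvgr_dist_le => //; exact: cvg_id.
  have te : `|t - t0| <= e / (1 + `|s|).
    rewrite distrC; near: t; apply: cvgr_dist_le; first exact: cvg_id.
    by rewrite divr_gt0.
  rewrite distrC.
  have -> : f t - f t0 = (f t - f t0 - s * (t - t0)) + s * (t - t0) by ring.
  apply: le_trans (ler_normD _ _) _.
  have := H t td; rewrite mul1r => /lerD/(_ (lexx `|s * (t - t0)|)) /le_trans; apply.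
  rewrite normrM -[X in X + _]mul1r -mulrDl mulrC -ler_pdivlMr//.
have [d d0 {}H] := H 1 ltr01; split.
  apply: (key _ _ p1); exists d => // t td.
  have [+ _] := H t y0 td ltac:(rewrite subrr normr0; lra).
  by rewrite subrr normr0 mulr0 subr0 addr0.
apply: (key _ _ q2); exists d => // t td.
have [_ +] := H x0 t ltac:(rewrite subrr normr0; lra) td.
by rewrite subrr normr0 mulr0 subr0 add0r.
Unshelve. all: by end_near. Qed.

Lemma closed_at_line_continuous P Q a c h :
  (forall x y, a <= x <= a + h -> c <= y <= c + h -> closed_at P Q x y) ->
  line_continuous P Q a c h.
Proof.
move=> H; split => [y hy|x hx].
  apply: continuous_in_subspaceT => x; rewrite inE/= in_itv/= => hx.
  exact: (closed_at_cont (H x y hx hy)).1.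
apply: continuous_in_subspaceT => y; rewrite inE/= in_itv/= => hy.
exact: (closed_at_cont (H x y hx hy)).2.
Qed.

(** Bisection: nested squares that each carry at least a fourth of the previous
    circulation shrink to a point. There the circulation is o(h^2), while the
    selected squares keep at least 4^-n of the initial one and have area 4^-n
    h^2. *)
Lemma goursat P Q a c h : 0 < h ->
  (forall x y, a <= x <= a + h -> c <= y <= c + h -> closed_at P Q x y) ->
  circ P Q a c h = 0.
Proof.
move=> h0 cl.
have lc := closed_at_line_continuous cl.
pose good (s : R * R) k := [/\ a <= s.1, c <= s.2, s.1 + k <= a + h & s.2 + k <= c + h].
have stepP (s : R * R) (k : R) : exists s' : R * R,
   0 < k -> good s k -> [/\ good s' (k / 2), s.1 <= s'.1 /\ s.2 <= s'.2,
     s'.1 + k / 2 <= s.1 + k, s'.2 + k / 2 <= s.2 + k &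
     `|circ P Q s.1 s.2 k| <= 4 * `|circ P Q s'.1 s'.2 (k / 2)|].
  have [k0|] := ltP 0 k; last by move=> ?; exists s => ?; lra.
  have [[g1 g2 g3 g4]|ng] := pselect (good s k); last by exists s.
  have [//|s' [e1 e2] H] := @circ_pigeonhole P Q s.1 s.2 k (ltW k0).
    exact: (line_continuous_sub _ _ _ _ lc).
  have B1 : s.1 <= s'.1 <= s.1 + k / 2 by case: e1 => ->; lra.
  have B2 : s.2 <= s'.2 <= s.2 + k / 2 by case: e2 => ->; lra.
  by exists s' => _ _; split => //; try split; clear -B1 B2 g1 g2 g3 g4 k0; lra.
have [step {}stepP] : exists step : R * R -> R -> R * R, forall s k,
   0 < k -> good s k -> [/\ good (step s k) (k / 2), s.1 <= (step s k).1 /\ s.2 <= (step s k).2,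
     (step s k).1 + k / 2 <= s.1 + k, (step s k).2 + k / 2 <= s.2 + k &
     `|circ P Q s.1 s.2 k| <= 4 * `|circ P Q (step s k).1 (step s k).2 (k / 2)|].
  have := choice (fun sk : (R * R) * R => stepP sk.1 sk.2).
  by move=> [f fP]; exists (fun s k => f (s, k)) => s k; exact: (fP (s, k)).
pose hn n := h / 2 ^+ n.
have hn0 n : 0 < hn n by rewrite /hn divr_gt0// exprn_gt0.
have hnS n : hn n.+1 = hn n / 2 by rewrite /hn exprSr invfM mulrA.
pose sq := fix sq n := match n with 0 => (a, c) | n'.+1 => step (sq n') (hn n') end.
have gsq n : good (sq n) (hn n).
  elim: n => [|n IH]; first by rewrite /hn expr0 divr1; split => //=; lra.
  by have [+ _ _ _ _] := stepP _ _ (hn0 n) IH; rewrite hnS.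
have sqS n := stepP _ _ (hn0 n) (gsq n).
have big n : `|circ P Q a c h| <= 4 ^+ n * `|circ P Q (sq n).1 (sq n).2 (hn n)|.
  elim: n => [|n IH]; first by rewrite expr0 mul1r /= /hn expr0 divr1.
  apply: le_trans IH _; rewrite exprSr -mulrA ler_wpM2l ?exprn_ge0// hnS.
  by have [_ _ _ _] := sqS n.
have mono m n : (m <= n)%N -> [/\ (sq m).1 <= (sq n).1, (sq m).2 <= (sq n).2,
    (sq n).1 + hn n <= (sq m).1 + hn m & (sq n).2 + hn n <= (sq m).2 + hn m].
  elim: n => [|n IH]; first by rewrite leqn0 => /eqP->.
  rewrite leq_eqVlt => /predU1P[->//|/IH[i1 i2 i3 i4]].
  have [_ [s1 s2]] := sqS n; rewrite -hnS /= => s3 s4 _.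
  by split; [exact: le_trans i1 s1|exact: le_trans i2 s2|exact: le_trans s3 i3|exact: le_trans s4 i4].
have cross m n : (sq m).1 <= (sq n).1 + hn n /\ (sq m).2 <= (sq n).2 + hn n.
  have := hn0 m; have := hn0 n.
  by have [/mono[]|/ltnW /mono[]] := leqP m n; clear; lra.
(* the nested squares meet in the point (sup X, sup Y) *)
pose X := [set (sq n).1 | n in [set: nat]].
pose Y := [set (sq n).2 | n in [set: nat]].
have lX n : (sq n).1 <= sup X <= (sq n).1 + hn n.
  apply/andP; split.
    apply: sup_upper_bound; last by exists n.
    split; first by exists (sq 0).1; exists 0%N.
    by exists ((sq 0).1 + hn 0) => _ [m _ <-]; have [] := cross m 0%N.
  apply: ge_sup; first by exists (sq 0).1; exists 0%N.
  by move=> _ [m _ <-]; have [] := cross m n.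
have lY n : (sq n).2 <= sup Y <= (sq n).2 + hn n.
  apply/andP; split.
    apply: sup_upper_bound; last by exists n.
    split; first by exists (sq 0).2; exists 0%N.
    by exists ((sq 0).2 + hn 0) => _ [m _ <-]; have [] := cross m 0%N.
  apply: ge_sup; first by exists (sq 0).2; exists 0%N.
  by move=> _ [m _ <-]; have [] := cross m n.
have clxy : closed_at P Q (sup X) (sup Y).
  have := lX 0%N; have := lY 0%N; rewrite /hn /= expr0 divr1 => ? ?.
  exact: cl.
apply/eqP; rewrite -normr_le0; apply/ler_addgt0Pr => e e0; rewrite add0r.
have h20 : 0 < h ^+ 2 by rewrite exprn_gt0.
have [d d0 sm] := circ_small clxy (divr_gt0 e0 h20).
have [n hnd] : exists n, hn n <= d.
  exists (Num.bound (h / d)).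
  have := @upper_nthrootP _ (h / d) _ (leqnn _); rewrite ltr_pdivrMr// => /ltW.
  by rewrite /hn ler_pdivrMr ?exprn_gt0// mulrC.
apply: le_trans (big n) _.
have [g1 g2 g3 g4] := gsq n.
have := sm (sq n).1 (sq n).2 (hn n).
move=> /(_ ltac:(rewrite hnd ltW//)) /(_ (lX n) (lY n)).
move=> /(_ (line_continuous_sub g1 g2 g3 g4 lc)) S.
apply: (@le_trans _ _ (4 ^+ n * (e / h ^+ 2 * hn n ^+ 2))); first by rewrite ler_wpM2l ?exprn_ge0.
rewrite /hn exprMn exprVn -exprM mulnC exprM.
have -> : (2 : R) ^+ 2 = 4 by ring.
have n4 : (4 : R) ^+ n != 0 by rewrite expf_neq0.
by rewrite le_eqVlt; apply/orP; left; apply/eqP; field; rewrite n4 gt_eqF.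
Qed.

End Circulation.

(** * Circulation around a singular point *)

Section Residue.
Context {R : realType}.
Implicit Types (P Q : R -> R -> R) (h k x y : R).

(** The circulation around the boundary of the square [-h, h]^2. *)
Definition circ0 P Q h :=
  intv (- h) h (fun x => P x (- h) - P x h) +
  intv (- h) h (fun y => Q h y - Q (- h) y).

Lemma closed_at_intvP P Q x1 x2 y :
  (forall x, x1 <= x <= x2 -> closed_at P Q x y) -> {within `[x1, x2], continuous P^~ y}.
Proof.
move=> H; apply: continuous_in_subspaceT => x; rewrite inE/= in_itv/= => hx.
exact: (closed_at_cont (H x hx)).1.
Qed.

Lemma closed_at_intvQ P Q x y1 y2 :
  (forall y, y1 <= y <= y2 -> closed_at P Q x y) -> {within `[y1, y2], continuous (Q x)}.
Proof.
move=> H; apply: continuous_in_subspaceT => y; rewrite inE/= in_itv/= => hy.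
exact: (closed_at_cont (H y hy)).2.
Qed.

(** The region between the squares of half sides 3k and k is tiled by eight
    squares of side 2k that avoid the origin. Goursat's theorem kills each of
    them and the inner sides cancel. The ratio 3 is what makes the tiles
    squares. *)
Lemma circ0_third P Q k : 0 < k ->
  (forall x y, `|x| <= 3 * k -> `|y| <= 3 * k -> (x != 0) || (y != 0) -> closed_at P Q x y) ->
  circ0 P Q (3 * k) = circ0 P Q k.
Proof.
move=> k0 cl.
have ne0 x y : k <= x \/ x <= - k \/ k <= y \/ y <= - k -> (x != 0) || (y != 0).
  have [->|//] := eqVneq x 0; have [->|//] := eqVneq y 0; lra.
have cl' x y : - (3 * k) <= x <= 3 * k -> - (3 * k) <= y <= 3 * k ->
   k <= x \/ x <= - k \/ k <= y \/ y <= - k -> closed_at P Q x y.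
  by move=> ? ? ?; apply: cl; [rewrite ler_norml; lra|rewrite ler_norml; lra|exact: ne0].
have [IP IPE] : exists IP, forall a b y, intv a b (P^~ y) = IP a b y by eexists.
have [IQ IQE] : exists IQ, forall a b x, intv a b (Q x) = IQ a b x by eexists.
have cell a c : - (3 * k) <= a <= k -> - (3 * k) <= c <= k ->
   (k <= a \/ a <= - (3 * k)) \/ (k <= c \/ c <= - (3 * k)) ->
   IP a (a + 2 * k) c - IP a (a + 2 * k) (c + 2 * k) +
   (IQ c (c + 2 * k) (a + 2 * k) - IQ c (c + 2 * k) a) = 0.
  move=> ha hc hac.
  have H x y : a <= x <= a + 2 * k -> c <= y <= c + 2 * k -> closed_at P Q x y.
    by move=> hx hy; apply: cl'; clear -k0 ha hc hac hx hy; lra.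
  have [cP cQ] := closed_at_line_continuous H.
  rewrite -!IPE -!IQE -(@goursat _ P Q a c (2 * k))//; last lra.
  by rewrite /circ !intvB//; [apply: cQ; lra..|apply: cP; lra|apply: cP; lra].
have chP y : y = - (3 * k) \/ y = 3 * k \/ y = k \/ y = - k ->
  IP (- (3 * k)) (- k) y + IP (- k) k y + IP k (3 * k) y = IP (- (3 * k)) (3 * k) y.
  move=> hy.
  have C : {within `[- (3 * k), 3 * k], continuous P^~ y}.
    by apply: (@closed_at_intvP _ Q) => x hx; apply: cl' => //; lra.
  have C' : {within `[- k, 3 * k], continuous P^~ y} by apply: (within_sub _ _ C); lra.
  have [l1 l2 l3 l4] : [/\ - (3 * k) <= - k, - k <= k, k <= 3 * k & - k <= 3 * k] by split; lra.
  by rewrite -!IPE [RHS](@intv_chasles _ _ (- k))// [in RHS](@intv_chasles _ (- k) k (3 * k))// addrA.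
have chQ x : x = - (3 * k) \/ x = 3 * k \/ x = k \/ x = - k ->
  IQ (- (3 * k)) (- k) x + IQ (- k) k x + IQ k (3 * k) x = IQ (- (3 * k)) (3 * k) x.
  move=> hx.
  have C : {within `[- (3 * k), 3 * k], continuous (Q x)}.
    by apply: (@closed_at_intvQ P) => y hy; apply: cl' => //; lra.
  have C' : {within `[- k, 3 * k], continuous (Q x)} by apply: (within_sub _ _ C); lra.
  have [l1 l2 l3 l4] : [/\ - (3 * k) <= - k, - k <= k, k <= 3 * k & - k <= 3 * k] by split; lra.
  by rewrite -!IQE [RHS](@intv_chasles _ _ (- k))// [in RHS](@intv_chasles _ (- k) k (3 * k))// addrA.
have C1 : - (3 * k) + 2 * k = - k by ring.
have C2 : - k + 2 * k = k by ring.
have C3 : k + 2 * k = 3 * k by ring.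
have c1 := cell (- (3 * k)) (- (3 * k)) ltac:(clear -k0; lra) ltac:(clear -k0; lra) ltac:(clear -k0; lra).
have c2 := cell (- k) (- (3 * k)) ltac:(clear -k0; lra) ltac:(clear -k0; lra) ltac:(clear -k0; lra).
have c3 := cell k (- (3 * k)) ltac:(clear -k0; lra) ltac:(clear -k0; lra) ltac:(clear -k0; lra).
have c4 := cell (- (3 * k)) (- k) ltac:(clear -k0; lra) ltac:(clear -k0; lra) ltac:(clear -k0; lra).
have c5 := cell k (- k) ltac:(clear -k0; lra) ltac:(clear -k0; lra) ltac:(clear -k0; lra).
have c6 := cell (- (3 * k)) k ltac:(clear -k0; lra) ltac:(clear -k0; lra) ltac:(clear -k0; lra).
have c7 := cell (- k) k ltac:(clear -k0; lra) ltac:(clear -k0; lra) ltac:(clear -k0; lra).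
have c8 := cell k k ltac:(clear -k0; lra) ltac:(clear -k0; lra) ltac:(clear -k0; lra).
rewrite C1 ?C2 ?C3 in c1; rewrite C1 C2 in c2; rewrite C1 C3 in c3; rewrite C1 C2 in c4.
rewrite C2 C3 in c5; rewrite C1 C3 in c6; rewrite C2 C3 in c7; rewrite C3 in c8.
have p1 := chP (- (3 * k)) ltac:(auto); have p2 := chP (3 * k) ltac:(auto).
have p3 := chP k ltac:(auto); have p4 := chP (- k) ltac:(auto).
have q1 := chQ (- (3 * k)) ltac:(auto); have q2 := chQ (3 * k) ltac:(auto).
have q3 := chQ k ltac:(auto); have q4 := chQ (- k) ltac:(auto).
rewrite /circ0 !intvB.
  rewrite !IPE !IQE.
  clear -c1 c2 c3 c4 c5 c6 c7 c8 p1 p2 p3 p4 q1 q2 q3 q4; lra.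
all: clear c1 c2 c3 c4 c5 c6 c7 c8 p1 p2 p3 p4 q1 q2 q3 q4.
all: by [apply: (@closed_at_intvP _ Q) => x hx; apply: cl'; clear -k0 hx; lra |
  apply: (@closed_at_intvQ P) => x hx; apply: cl'; clear -k0 hx; lra].
Qed.

End Residue.

Section ResidueBound.
Context {R : realType}.
Implicit Types (P Q : R -> R -> R) (h k x y : R).

Lemma circ0_iter P Q h n : 0 < h ->
  (forall x y, `|x| <= h -> `|y| <= h -> (x != 0) || (y != 0) -> closed_at P Q x y) ->
  circ0 P Q h = circ0 P Q (h / 3 ^+ n).
Proof.
move=> h0 cl; elim: n => [|n IH]; first by rewrite expr0 divr1.
have hn0 : 0 < h / 3 ^+ n.+1 by rewrite divr_gt0// exprn_gt0.
rewrite -(@circ0_third R P Q (h / 3 ^+ n.+1))//.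
  by rewrite IH; congr circ0; rewrite exprS; field; rewrite expf_neq0.
have E : 3 * (h / 3 ^+ n.+1) <= h.
  have -> : 3 * (h / 3 ^+ n.+1) = h / 3 ^+ n by rewrite exprS; field; rewrite expf_neq0.
  rewrite ler_pdivrMr ?exprn_gt0//.
  by rewrite ler_peMr ?(ltW h0)// exprn_ege1//; lra.
by move=> x y hx hy; apply: cl; lra.
Qed.

(** By the previous lemmas the circulation can be computed on an arbitrarily
    small square, where the form is compared with kappa times the angular form.
    Two opposite sides of the square of half side k together have the angular
    density 2k/(t^2 + k^2), which lies between 1/k and 2/k, so the constant
    3/(2k) approximates it within 1/(2k); this crude bracket replaces the exact
    value 2 pi |kappa| by the lower bound 4 |kappa|. *)
Lemma circ0_residue P Q h kappa : 0 < h ->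
  (forall x y, `|x| <= h -> `|y| <= h -> (x != 0) || (y != 0) -> closed_at P Q x y) ->
  (forall e, 0 < e -> exists2 d, 0 < d & forall k t, 0 < k <= d -> `|t| <= k ->
     `|P t (- k) - P t k - kappa * (2 * k / (t ^+ 2 + k ^+ 2))| <= e / k /\
     `|Q k t - Q (- k) t - kappa * (2 * k / (t ^+ 2 + k ^+ 2))| <= e / k) ->
  4 * `|kappa| <= `|circ0 P Q h|.
Proof.
move=> h0 cl H; apply/ler_addgt0Pr => e e0.
have [d d0 {}H] := H (e / 4) ltac:(lra).
have [n hnd] : exists n, h / 3 ^+ n <= d.
  exists (Num.bound (h / d)).
  have := @upper_nthrootP _ (h / d) _ (leqnn _); rewrite ltr_pdivrMr// => /ltW hd.
  rewrite ler_pdivrMr ?exprn_gt0// mulrC; apply: le_trans hd _.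
  by rewrite ler_pM2r// lerXn2r ?nnegrE ?ler0n// ler_nat.
rewrite (circ0_iter n)//; set k := h / 3 ^+ n in hnd *.
have k0 : 0 < k by rewrite divr_gt0// exprn_gt0.
have kh : k <= h.
  rewrite ler_pdivrMr ?exprn_gt0// ler_peMr ?(ltW h0)// exprn_ege1//; lra.
clearbody k.
have cl' x y : - k <= x <= k -> - k <= y <= k ->
   k <= x \/ x <= - k \/ k <= y \/ y <= - k -> closed_at P Q x y.
  move=> ? ? ?; apply: cl; [rewrite ler_norml; lra|rewrite ler_norml; lra|].
  have [?|//] := eqVneq x 0; have [?|//] := eqVneq y 0; lra.
have key (g : R -> R) : {within `[- k, k], continuous g} ->
   (forall t, `|t| <= k -> `|g t - kappa * (2 * k / (t ^+ 2 + k ^+ 2))| <= e / 4 / k) ->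
   `|intv (- k) k g - 3 * kappa| <= `|kappa| + e / 2.
  move=> cg gH.
  (* 3 / (2k) is the midpoint of the range [1/k, 2/k] of 2k / (t^2 + k^2) *)
  have := @intv_near_cst _ (- k) k g (3 / 2 * kappa / k) (`|kappa| / 2 / k + e / 4 / k).
  have -> : k - - k = k * 2 by ring.
  have -> : 3 / 2 * kappa / k * (k * 2) = 3 * kappa by field; rewrite gt_eqF.
  have -> : (`|kappa| / 2 / k + e / 4 / k) * (k * 2) = `|kappa| + e / 2 by field; rewrite gt_eqF.
  apply => //; first lra.
  move=> t ht; have tk : `|t| <= k by rewrite ler_norml; lra.
  have -> : g t - 3 / 2 * kappa / k = (kappa * (2 * k / (t ^+ 2 + k ^+ 2)) - 3 / 2 * kappa / k) +
     (g t - kappa * (2 * k / (t ^+ 2 + k ^+ 2))) by ring.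
  apply: le_trans (ler_normD _ _) _; apply: lerD; last exact: gH.
  have -> : kappa * (2 * k / (t ^+ 2 + k ^+ 2)) - 3 / 2 * kappa / k =
    kappa * ((2 * k / (t ^+ 2 + k ^+ 2)) - 3 / 2 / k) by ring.
  rewrite normrM -!mulrA ler_wpM2l// ler_norml.
  have t2 : t ^+ 2 <= k ^+ 2.
    by rewrite -[t ^+ 2]real_normK ?num_real// lerXn2r ?nnegrE// ltW.
  have t20 : 0 <= t ^+ 2 by exact: sqr_ge0.
  have k20 : 0 < k ^+ 2 by rewrite exprn_gt0.
  have E1 : k / k ^+ 2 = k^-1 by rewrite expr2 invfM mulrA divff ?mul1r// gt_eqF.
  have E2 : k / (t ^+ 2 + k ^+ 2) <= k^-1.
    by rewrite -E1 ler_pM2l// lef_pV2 ?posrE; clear -k20 t20; lra.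
  have E3 : k^-1 / 2 <= k / (t ^+ 2 + k ^+ 2).
    by rewrite -E1 -mulrA -invfM ler_pM2l// lef_pV2 ?posrE; clear -k20 t20 t2; lra.
  move: E2 E3; move: (k / _) (k^-1) => u v; lra.
have K1 := key (fun x => P x (- k) - P x k); have K2 := key (fun y => Q k y - Q (- k) y).
have {}K1 : `|intv (- k) k (fun x => P x (- k) - P x k) - 3 * kappa| <= `|kappa| + e / 2.
  apply: K1 => [x|t tk].
    by apply: continuousB; apply: (@closed_at_intvP _ _ Q) => v hv; apply: cl'; clear -k0 hv; lra.
  by have [|] := H k t _ tk; rewrite ?k0.
have {}K2 : `|intv (- k) k (fun y => Q k y - Q (- k) y) - 3 * kappa| <= `|kappa| + e / 2.
  apply: K2 => [x|t tk].
    by apply: continuousB; apply: (@closed_at_intvQ _ P) => v hv; apply: cl'; clear -k0 hv; lra.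
  by have [|] := H k t _ tk; rewrite ?k0.
rewrite /circ0; move: K1 K2; move: (intv _ _ _) (intv _ _ _) => v u; clear -e0.
rewrite !ler_norml => U V.
have : `|6 * kappa| - `|u + v| <= `|6 * kappa - (u + v)| by exact: lerB_dist.
have -> : `|6 * kappa| = 6 * `|kappa| by rewrite normrM ger0_norm.
have : `|6 * kappa - (u + v)| <= 2 * `|kappa| + e by rewrite ler_norml; lra.
lra.
Qed.

(** Four sides of length 2h; the hypothesis bounds the form on the boundary
    only. *)
Lemma circ0_le P Q h M : 0 < h ->
  (forall x y, `|x| <= h -> `|y| <= h -> (x != 0) || (y != 0) -> closed_at P Q x y) ->
  (forall x y, `|x| <= h -> `|y| <= h -> h <= `|x| \/ h <= `|y| -> `|P x y| <= M /\ `|Q x y| <= M) ->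
  `|circ0 P Q h| <= 8 * h * M.
Proof.
move=> h0 cl PQM.
have nh : `|- h| = h by rewrite normrN gtr0_norm.
have nh' : `|h| = h by rewrite gtr0_norm.
have h00 : h != 0 by rewrite gt_eqF.
have cl' x y : - h <= x <= h -> - h <= y <= h ->
   h <= x \/ x <= - h \/ h <= y \/ y <= - h -> closed_at P Q x y.
  move=> ? ? ?; apply: cl; [rewrite ler_norml; lra|rewrite ler_norml; lra|].
  have [?|//] := eqVneq x 0; have [?|//] := eqVneq y 0; lra.
have E1 := @intv_near_cst _ (- h) h (fun x => P x (- h) - P x h) 0 (2 * M).
have E2 := @intv_near_cst _ (- h) h (fun y => Q h y - Q (- h) y) 0 (2 * M).
rewrite mul0r subr0 in E1; rewrite mul0r subr0 in E2.
have {}E1 : `|intv (- h) h (fun x => P x (- h) - P x h)| <= 2 * M * (h - - h).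
  apply: E1 => [|x|x hx]; first lra.
    by apply: continuousB; apply: (@closed_at_intvP _ _ Q) => v hv; apply: cl'; clear -h0 hv; lra.
  rewrite subr0; apply: le_trans (ler_normB _ _) _.
  have xh : `|x| <= h by rewrite ler_norml; lra.
  have [+ _] := PQM x h xh ltac:(rewrite nh'; clear -h0; lra) ltac:(rewrite nh'; clear -h0; lra).
  have [+ _] := PQM x (- h) xh ltac:(rewrite nh; clear -h0; lra) ltac:(rewrite nh; clear -h0; lra).
  lra.
have {}E2 : `|intv (- h) h (fun y => Q h y - Q (- h) y)| <= 2 * M * (h - - h).
  apply: E2 => [|x|x hx]; first lra.
    by apply: continuousB; apply: (@closed_at_intvQ _ P) => v hv; apply: cl'; clear -h0 hv; lra.
  rewrite subr0; apply: le_trans (ler_normB _ _) _.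
  have xh : `|x| <= h by rewrite ler_norml; lra.
  have [_ +] := PQM h x ltac:(rewrite nh'; clear -h0; lra) xh ltac:(rewrite nh'; clear -h0; lra).
  have [_ +] := PQM (- h) x ltac:(rewrite nh; clear -h0; lra) xh ltac:(rewrite nh; clear -h0; lra).
  lra.
apply: le_trans (ler_normD _ _) _; apply: le_trans (lerD E1 E2) _; lra.
Qed.

End ResidueBound.

(** * Complex differentiability and the residue bound *)

Section ComplexNorm.
Context {R : realType}.
Local Open Scope complex_scope.
Implicit Types (z w : R[i]).
Import Normc.

Lemma normcr z : `|z| = (normc z)%:C. Proof. by []. Qed.

Lemma ge0_normc z : 0 <= normc z.
Proof. by case: z => a b; exact: sqrtr_ge0. Qed.

Lemma normcD z w : normc (z + w) <= normc z + normc w.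
Proof. exact: le_normcD. Qed.

Lemma normc_opp z : normc (- z) = normc z. Proof. exact: normcN. Qed.

Lemma normcB z w : normc (z - w) <= normc z + normc w.
Proof. by rewrite -(normc_opp w); exact: normcD. Qed.

Lemma distcC z w : normc (z - w) = normc (w - z).
Proof. by rewrite -normc_opp opprB. Qed.

Lemma normc_Re z : `|complex.Re z| <= normc z.
Proof.
case: z => a b /=; rewrite -sqrtr_sqr ler_wsqrtr// lerDl; exact: sqr_ge0.
Qed.

Lemma normc_Im z : `|complex.Im z| <= normc z.
Proof.
case: z => a b /=; rewrite -sqrtr_sqr ler_wsqrtr// lerDr; exact: sqr_ge0.
Qed.

Lemma normc_le z : normc z <= `|complex.Re z| + `|complex.Im z|.
Proof.
case: z => a b /=; rewrite -[leRHS]ger0_norm ?addr_ge0// -sqrtr_sqr ler_wsqrtr//.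
by rewrite sqrrD !real_normK ?num_real// lerD2r lerDl mulrn_wge0// mulr_ge0.
Qed.

Lemma normc_eq0 z : (normc z == 0) = (z == 0).
Proof. by apply/eqP/eqP => [/eq0_normc//|->]; rewrite normc0. Qed.

Lemma normc_gt0 z : (0 < normc z) = (z != 0).
Proof. by rewrite lt_neqAle ge0_normc andbT eq_sym normc_eq0. Qed.

Lemma normc_real (a : R) : normc a%:C = `|a|.
Proof. by rewrite /= expr0n addr0 sqrtr_sqr. Qed.

Lemma nbhsCP z (S : set R[i]) : nbhs z S <->
  exists2 d : R, 0 < d & forall w, normc (w - z) <= d -> S w.
Proof.
split.
  move=> /nbhs_ballP[e /= e0 H].
  have eE : e = (complex.Re e)%:C by rewrite RRe_real// gtr0_real.
  have r0 : 0 < complex.Re e by rewrite -ltcR -eE.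
  exists (complex.Re e / 2) => [|w zw]; first by rewrite divr_gt0.
  apply: H; rewrite /ball/= normcr distcC eE ltcR; apply: le_lt_trans zw _; lra.
move=> [d d0 H]; apply/nbhs_ballP; exists d%:C; first by rewrite /= ltcR.
by move=> w; rewrite /ball/= normcr ltcR distcC => /ltW/H.
Qed.

(** Complex differentiability with derivative l in quantified form: restriction
    to lines and passage to real and imaginary parts are immediate from it. *)
Definition cdiff (f : R[i] -> R[i]) a l := forall e, 0 < e ->
  exists2 d : R, 0 < d & forall w, normc (w - a) <= d ->
    normc (f w - f a - l * (w - a)) <= e * normc (w - a).

Lemma is_deriveC f a l : is_derive a (1 : R[i]) f l <-> cdiff f a l.
Proof.
split=> [[df dfl] e e0|H].
  have /eqaddoP /(_ e%:C) := derivable_nbhs df.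
  rewrite ltcR => /(_ e0) /nbhsCP[d d0 {}H]; exists d => // w wa.
  have := H (w - a); rewrite subr0 => /(_ wa).
  rewrite !fctE /= dfl [_%:A]mulr1 subrK opprD addrA !normcr.
  by rewrite -rmorphM/= lecR [(w - a) *: l]mulrC.
suff cv : (fun h : R[i] => h^-1 *: ((f \o shift a) (h *: (1 : R[i])) - f a)) @ 0^' --> l.
  by split; [exact: cvgP cv | exact: cvg_lim cv].
apply/cvgrPdist_le => /= e e0.
have eE : e = (complex.Re e)%:C by rewrite RRe_real// gtr0_real.
have r0 : 0 < complex.Re e by rewrite -ltcR -eE.
have [d d0 {}H] := H _ r0.
rewrite near_withinE; apply/nbhsCP; exists d => // h; rewrite subr0 => hd h0.
rewrite normcr eE lecR [h%:A]mulr1.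
have nh : 0 < normc h by rewrite normc_gt0.
have := H (h + a); rewrite addrK => /(_ hd).
move=> K; rewrite -(ler_pM2l nh) [leRHS]mulrC; apply: le_trans K.
rewrite -normcM -normc_opp le_eqVlt; apply/orP; left; apply/eqP; congr normc.
have -> : h^-1 *: (f (h + a) - f a) = h^-1 * (f (h + a) - f a) by [].
by field.
Qed.

(** The real part of g(z) dz / i is Im g dx + Re g dy, and the Cauchy-Riemann
    equations say that this form is closed. *)
Lemma cdiff_closed (g : R[i] -> R[i]) x y l : cdiff g (x +i* y) l ->
  closed_at (fun x y => complex.Im (g (x +i* y))) (fun x y => complex.Re (g (x +i* y))) x y.
Proof.
move=> H; exists (complex.Im l), (complex.Re l), (- complex.Im l) => e e0.
have [d d0 {}H] := H e e0.
exists (d / 2) => [|a b ha hb]; first by rewrite divr_gt0.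
have wE : (a +i* b) - (x +i* y) = (a - x) +i* (b - y) by [].
have wl : normc ((a +i* b) - (x +i* y)) <= `|a - x| + `|b - y|.
  by rewrite wE; exact: normc_le.
have := H (a +i* b) ltac:(lra).
set D := normc (_ - _ - _) => HD.
have {}HD : D <= e * (`|a - x| + `|b - y|) by apply: le_trans HD _; rewrite ler_pM2l.
split; apply: le_trans HD.
  rewrite /D wE; apply: le_trans (normc_Im _).
  rewrite le_eqVlt; apply/orP; left; apply/eqP; congr (`|_|).
  by case: (g _) (g _) l {H D wl} => [? ?] [? ?] [? ?] /=; ring.
rewrite /D wE; apply: le_trans (normc_Re _).
rewrite le_eqVlt; apply/orP; left; apply/eqP; congr (`|_|).
by case: (g _) (g _) l {H D wl} => [? ?] [? ?] [? ?] /=; ring.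
Qed.

Lemma complex_neq0 x y : (x +i* y != 0 :> R[i]) = (x != 0) || (y != 0).
Proof. by rewrite eq_complex /= negb_and. Qed.

(** Residue bound: g = psi(z)/z is holomorphic away from the origin and
    asymptotic to L/z, and the form Im g dx + Re g dy is then asymptotic to Re
    L times the angular form. *)
Lemma residue_Re (psi : R[i] -> R[i]) (L : R[i]) h : 0 < h ->
  (forall z, z != 0 -> `|complex.Re z| <= h -> `|complex.Im z| <= h -> derivable psi z 1) ->
  (forall e, 0 < e -> exists2 d, 0 < d & forall z, z != 0 -> normc z <= d -> normc (psi z - L) <= e) ->
  let g := fun z => psi z / z in
  (forall x y, `|x| <= h -> `|y| <= h -> (x != 0) || (y != 0) ->
    closed_at (fun x y => complex.Im (g (x +i* y))) (fun x y => complex.Re (g (x +i* y))) x y) /\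
  4 * `|complex.Re L| <= `|circ0 (fun x y => complex.Im (g (x +i* y))) (fun x y => complex.Re (g (x +i* y))) h|.
Proof.
move=> h0 dpsi psiL g.
have cl x y : `|x| <= h -> `|y| <= h -> (x != 0) || (y != 0) ->
    closed_at (fun x y => complex.Im (g (x +i* y))) (fun x y => complex.Re (g (x +i* y))) x y.
  move=> hx hy xy0; have z0 : x +i* y != 0 by rewrite complex_neq0.
  apply: (@cdiff_closed g _ _ ('D_1 g (x +i* y))); apply/is_deriveC; apply: DeriveDef => //.
  apply: derivableM; first exact: dpsi.
  by apply: derivableV => //; exact: derivable_id.
split=> //; apply: circ0_residue => // e e0.
have [d d0 {}psiL] := psiL (e / 2) ltac:(lra).
exists (d / 2) => [|k t /andP[k0 kd] tk]; first by rewrite divr_gt0.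
have kk : `|k| = k by rewrite gtr0_norm.
have tk2 : t ^+ 2 + k ^+ 2 != 0.
  by rewrite gt_eqF// ltr_wpDl ?sqr_ge0// exprn_gt0.
have key x y : `|x| <= k -> `|y| <= k -> k <= `|x| \/ k <= `|y| ->
    normc (g (x +i* y) - L / (x +i* y)) <= e / 2 / k.
  move=> hx hy hxy.
  have kz : k <= normc (x +i* y).
    by have := normc_Re (x +i* y); have := normc_Im (x +i* y); rewrite /=; lra.
  have z0 : x +i* y != 0 by rewrite -normc_gt0; lra.
  have zd : normc (x +i* y) <= d by apply: le_trans (normc_le _) _; rewrite /=; lra.
  rewrite /g -mulrBl normcM normcV; apply: ler_pM => //.
  - exact: ge0_normc.
  - by rewrite invr_ge0 ge0_normc.
  - exact: psiL.
  - by rewrite lef_pV2 ?posrE//; exact: lt_le_trans kz.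
have model (a b x y : R) : (a +i* b) / (x +i* y) =
   ((a * x + b * y) / (x ^+ 2 + y ^+ 2)) +i* ((b * x - a * y) / (x ^+ 2 + y ^+ 2)).
  by apply/eqP; rewrite eq_complex/=; apply/andP; split; apply/eqP; ring.
have nk : `|- k| = k by rewrite normrN.
case: L key {psiL} => a b key /=; split.
  have := key t (- k) tk ltac:(clear -kk nk; lra) ltac:(clear -kk nk; lra).
  have := key t k tk ltac:(clear -kk nk; lra) ltac:(clear -kk nk; lra).
  move=> /(le_trans (normc_Im _)) + /(le_trans (normc_Im _)).
  rewrite !model; case: (g _) => ? u; case: (g _) => ? v /=.
  rewrite sqrrN => U V.
  have -> : v - u - a * (2 * k / (t ^+ 2 + k ^+ 2)) =
     (v - (b * t - a * - k) / (t ^+ 2 + k ^+ 2)) - (u - (b * t - a * k) / (t ^+ 2 + k ^+ 2)).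
    by field.
  apply: le_trans (ler_normB _ _) _; apply: le_trans (lerD V U) _; lra.
have := key k t ltac:(clear -kk nk; lra) tk ltac:(clear -kk nk; lra).
have := key (- k) t ltac:(clear -kk nk; lra) tk ltac:(clear -kk nk; lra).
move=> /(le_trans (normc_Re _)) + /(le_trans (normc_Re _)).
rewrite !model; case: (g _) => u ?; case: (g _) => v ? /=.
rewrite sqrrN [k ^+ 2 + _]addrC => U V.
have -> : v - u - a * (2 * k / (t ^+ 2 + k ^+ 2)) =
     (v - (a * k + b * t) / (t ^+ 2 + k ^+ 2)) - (u - (a * - k + b * t) / (t ^+ 2 + k ^+ 2)).
  by field.
apply: le_trans (ler_normB _ _) _; apply: le_trans (lerD V U) _; lra.
Qed.

End ComplexNorm.

(** * Cauchy estimates and Taylor bounds in one variable *)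

Section CauchyEstimates.
Context {R : realType}.
Local Open Scope complex_scope.
Implicit Types (phi psi : R[i] -> R[i]) (z w : R[i]) (h M : R).
Import Normc.

(** Closed squares centred at the origin play the role of discs. *)
Definition csquare h z := `|complex.Re z| <= h /\ `|complex.Im z| <= h.

Lemma normc_i : normc ('i : R[i]) = 1.
Proof. by rewrite /= expr0n expr1n add0r sqrtr1. Qed.

(** A maximum principle with a constant: the residue bound is a lower bound for
    the circulation of psi(z)/z, and the size of psi on the boundary an upper
    bound. *)
Lemma limit_Re_le psi (L : R[i]) h M : 0 < h ->
  (forall z, z != 0 -> csquare h z -> derivable psi z 1) ->
  (forall e, 0 < e -> exists2 d, 0 < d & forall z, z != 0 -> normc z <= d -> normc (psi z - L) <= e) ->
  (forall z, z != 0 -> csquare h z -> h <= normc z -> normc (psi z) <= M) ->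
  `|complex.Re L| <= 2 * M.
Proof.
move=> h0 dpsi psiL psiM.
have dpsi' z : z != 0 -> `|complex.Re z| <= h -> `|complex.Im z| <= h -> derivable psi z 1.
  by move=> z0 u v; exact: dpsi.
have [cl] := residue_Re h0 dpsi' psiL.
have key x y : `|x| <= h -> `|y| <= h -> h <= `|x| \/ h <= `|y| ->
    normc (psi (x +i* y) / (x +i* y)) <= M / h.
  move=> hx hy hxy.
  have kz : h <= normc (x +i* y).
    by have := normc_Re (x +i* y); have := normc_Im (x +i* y); rewrite /=; lra.
  have z0 : x +i* y != 0 by rewrite -normc_gt0; lra.
  rewrite normcM normcV; apply: ler_pM => //.
  - exact: ge0_normc.
  - by rewrite invr_ge0 ge0_normc.
  - exact: psiM.
  - by rewrite lef_pV2 ?posrE//; exact: lt_le_trans kz.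
move=> residue; suff : 4 * `|complex.Re L| <= 8 * M by lra.
have -> : 8 * M = 8 * h * (M / h) by field; rewrite gt_eqF.
apply: le_trans residue _; apply: circ0_le => // x y hx hy hxy.
split; apply: le_trans (key x y hx hy hxy); first exact: normc_Im.
exact: normc_Re.
Qed.

Lemma Re_mulNi z : complex.Re (- 'i * z) = complex.Im z.
Proof. by case: z => a b /=; ring. Qed.

(** The imaginary part is the real part after multiplication by -i. *)
Lemma limit_le psi (L : R[i]) h M : 0 < h ->
  (forall z, z != 0 -> csquare h z -> derivable psi z 1) ->
  (forall e, 0 < e -> exists2 d, 0 < d & forall z, z != 0 -> normc z <= d -> normc (psi z - L) <= e) ->
  (forall z, z != 0 -> csquare h z -> h <= normc z -> normc (psi z) <= M) ->
  normc L <= 4 * M.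
Proof.
move=> h0 dpsi psiL psiM.
have E1 := limit_Re_le h0 dpsi psiL psiM.
have E2 : `|complex.Re (- 'i * L)| <= 2 * M.
  apply: (@limit_Re_le (fun z => - 'i * psi z) (- 'i * L) h M h0) => [z z0 zh|e e0|z z0 zh hz].
  - by apply: (@derivableM _ _ (fun=> - 'i)); [exact: derivable_cst|exact: dpsi].
  - have [d d0 H] := psiL e e0; exists d => // z z0 zd.
    by rewrite -mulrBr normcM normc_opp normc_i mul1r H.
  - by rewrite normcM normc_opp normc_i mul1r psiM.
rewrite Re_mulNi in E2; apply: le_trans (normc_le _) _; lra.
Qed.

(** Cauchy's estimate: the difference quotient (phi(z) - phi(0))/z extends to
    the origin with value phi'(0), and its limit there is bounded by its values
    on the boundary. *)
Lemma cauchy_estimate0 phi l h M : 0 < h ->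
  (forall z, csquare h z -> derivable phi z 1) -> cdiff phi 0 l ->
  (forall z, csquare h z -> normc (phi z) <= M) ->
  normc l <= 8 * M / h.
Proof.
move=> h0 dphi dl phiM.
have s0 : csquare h 0 by split; rewrite /= normr0 ltW.
suff : normc l <= 4 * (2 * M / h) by rewrite !mulrA -natrM.
apply: (@limit_le (fun z => (phi z - phi 0) / z) l h) => //.
- move=> z z0 zh; apply: derivableM.
    by apply: derivableB; [exact: dphi|exact: derivable_cst].
  by apply: derivableV => //; exact: derivable_id.
- move=> e e0; have [d d0 H] := dl e e0; exists d => // z z0 zd.
  have := H z; rewrite subr0 => /(_ zd).
  have -> : (phi z - phi 0) / z - l = (phi z - phi 0 - l * z) / z by field.
  by rewrite normcM normcV ler_pdivrMr ?normc_gt0.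
- move=> z z0 zh hz; rewrite normcM normcV; apply: ler_pM.
  + exact: ge0_normc.
  + by rewrite invr_ge0 ge0_normc.
  + apply: le_trans (normcB _ _) _; have := phiM z zh; have := phiM 0 s0; lra.
  + by rewrite lef_pV2 ?posrE// normc_gt0.
Qed.

Lemma cdiff_shift phi a b l : cdiff phi (a + b) l -> cdiff (fun z => phi (a + z)) b l.
Proof.
move=> H e e0; have [d d0 {}H] := H e e0; exists d => // z zd.
have := H (a + z); have -> : a + z - (a + b) = z - b by ring.
exact.
Qed.

Lemma cdiffB phi psi a l k : cdiff phi a l -> cdiff psi a k -> cdiff (fun z => phi z - psi z) a (l - k).
Proof. by move=> /is_deriveC H /is_deriveC K; apply/is_deriveC; exact: is_deriveB. Qed.

Lemma cdiff_derivable phi a l : cdiff phi a l -> derivable phi a 1.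
Proof. by move=> /is_deriveC[]. Qed.

Lemma cauchy_estimate phi a l h M : 0 < h ->
  (forall z, csquare h (z - a) -> exists k, cdiff phi z k) -> cdiff phi a l ->
  (forall z, csquare h (z - a) -> normc (phi z) <= M) ->
  normc l <= 8 * M / h.
Proof.
move=> h0 dphi dl phiM; apply: (@cauchy_estimate0 (fun z => phi (a + z))) => //.
- move=> z zh; have [|k /cdiff_shift/cdiff_derivable//] := dphi (a + z).
  by rewrite addrAC subrr add0r.
- by apply: cdiff_shift; rewrite addr0.
- by move=> z zh; apply: phiM; rewrite addrAC subrr add0r.
Qed.

Lemma is_deriveRP (f : R -> R) (a l : R) :
  (forall e, 0 < e -> exists2 d, 0 < d & forall w : R, `|w - a| <= d ->
    `|f w - f a - l * (w - a)| <= e * `|w - a|) -> is_derive a (1 : R) f l.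
Proof.
move=> H.
suff cv : (fun h : R => h^-1 *: ((f \o shift a) (h *: (1 : R)) - f a)) @ 0^' --> l.
  by split; [exact: cvgP cv | exact: cvg_lim cv].
apply/cvgrPdist_le => /= e e0.
have [d d0 {}H] := H _ e0.
near=> h.
have h0 : h != 0 by near: h; exact: nbhs_dnbhs_neq.
have hd : `|h| <= d.
  rewrite -[h]subr0 distrC; near: h; apply: cvgr_dist_le => //.
  exact: nbhs_dnbhs.
have nh : 0 < `|h| by rewrite normr_gt0.
have := H (h + a); rewrite addrK => /(_ hd) K.
rewrite -(ler_pM2l nh) [leRHS]mulrC; apply: le_trans K.
rewrite -normrM -normrN le_eqVlt; apply/orP; left; apply/eqP; congr (`|_|).
have -> : h%:A = h by rewrite [_%:A]mulr1.
have -> : h^-1 *: (f (h + a) - f a) = h^-1 * (f (h + a) - f a) by [].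
by field.
Unshelve. all: by end_near. Qed.

Lemma real_complexB (a b : R) : a%:C - b%:C = (a - b)%:C :> R[i].
Proof. by rewrite rmorphB. Qed.

(** The mean value theorem along the real axis; general directions are reached
    below by composing with an affine map. *)
Lemma mvt_Re phi (l : R -> R[i]) (t B : R) : 0 <= t ->
  (forall s, 0 <= s <= t -> cdiff phi s%:C (l s)) ->
  (forall s, 0 <= s <= t -> normc (l s) <= B) ->
  `|complex.Re (phi t%:C - phi 0)| <= B * t.
Proof.
move=> t0 dphi lB.
have D s : 0 <= s <= t -> is_derive s (1 : R) (fun s => complex.Re (phi s%:C)) (complex.Re (l s)).
  move=> st; apply: is_deriveRP => e e0; have [d d0 H] := dphi s st e e0.
  exists d => // w wd.
  have := H w%:C; rewrite real_complexB normc_real => /(_ wd).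
  apply: le_trans; apply: le_trans (normc_Re _).
  rewrite le_eqVlt; apply/orP; left; apply/eqP; congr (`|_|).
  by case: (phi _) (phi _) (l s) => [? ?] [? ?] [? ?] /=; ring.
have [|x|c] := @MVT_segment R (fun s => complex.Re (phi s%:C)) (fun s => complex.Re (l s)) 0 t t0.
- by move=> x; rewrite in_itv/= => /andP[x0 xt]; apply: D; rewrite !ltW.
- have : {within `[0, t], continuous (fun s => complex.Re (phi s%:C))}.
    apply: derivable_within_continuous => y; rewrite in_itv/= => yt.
    by have [] := D y yt.
  exact.
rewrite in_itv/= => ct.
have -> : complex.Re (phi t%:C - phi 0) = complex.Re (phi t%:C) - complex.Re (phi 0%:C).
  by case: (phi _) (phi _) => [? ?] [? ?].
move=> ->; rewrite subr0 normrM (ger0_norm t0) ler_wpM2r//.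
by apply: le_trans (normc_Re _) _; exact: lB.
Qed.

Lemma mvt_C phi (l : R -> R[i]) (t B : R) : 0 <= t ->
  (forall s, 0 <= s <= t -> cdiff phi s%:C (l s)) ->
  (forall s, 0 <= s <= t -> normc (l s) <= B) ->
  normc (phi t%:C - phi 0) <= 2 * (B * t).
Proof.
move=> t0 dphi lB.
have E1 := mvt_Re t0 dphi lB.
have E2 : `|complex.Re (- 'i * phi t%:C - - 'i * phi 0)| <= B * t.
  apply: (@mvt_Re (fun z => - 'i * phi z) (fun s => - 'i * l s)) => // s st.
    move=> e e0; have [d d0 H] := dphi s st e e0; exists d => // w wd.
    by rewrite -mulrA -!mulrBr normcM normc_opp normc_i mul1r; exact: H.
  by rewrite normcM normc_opp normc_i mul1r lB.
rewrite -mulrBr Re_mulNi in E2; apply: le_trans (normc_le _) _; lra.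
Qed.

Lemma csquareD h k z w : csquare h z -> csquare k w -> csquare (h + k) (z + w).
Proof.
case: z w => a b [c d] /= [h1 h2] [k1 k2]; split => /=;
  apply: le_trans (ler_normD _ _) _; exact: lerD.
Qed.

Lemma csquare_real h (s : R) : 0 <= s <= h -> csquare h s%:C.
Proof. by move=> sh; split; rewrite /= ?normr0 ?ger0_norm; lra. Qed.

Lemma csquare_le h k z : h <= k -> csquare h z -> csquare k z.
Proof. by move=> hk [? ?]; split; lra. Qed.

(** The mean value theorem with the derivative bounded by Cauchy's estimate on
    squares of half side h around the points of the segment. *)
Lemma lipschitz_bound phi a h M t : 0 < h -> 0 <= t <= h ->
  (forall z, csquare (2 * h) (z - a) -> exists k, cdiff phi z k) ->
  (forall z, csquare (2 * h) (z - a) -> normc (phi z) <= M) ->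
  normc (phi (a + t%:C) - phi a) <= 16 * M / h * t.
Proof.
move=> h0 /andP[t0 th] dphi phiM.
have sub s z : 0 <= s <= t -> csquare h (z - (a + s%:C)) -> csquare (2 * h) (z - a).
  move=> st zs; have -> : z - a = z - (a + s%:C) + s%:C by ring.
  have -> : 2 * h = h + h by ring.
  by apply: csquareD => //; apply: csquare_real; lra.
have [l lP] : exists l : R -> R[i], forall s, 0 <= s <= t -> cdiff phi (a + s%:C) (l s).
  suff /choice[l' l'P] : forall s, exists k, 0 <= s <= t -> cdiff phi (a + s%:C) k by exists l'.
  move=> s; have [st|nst] := pselect (0 <= s <= t); last by exists 0.
  have [|k kP] := dphi (a + s%:C); last by exists k.
  apply: (sub s) => //; rewrite subrr; split; rewrite /= normr0; lra.
have := @mvt_C (fun z => phi (a + z)) l t (8 * M / h) t0.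
rewrite addr0 => H; apply: le_trans (H _ _) _.
- by move=> s st; apply: cdiff_shift; exact: lP.
- move=> s st; apply: (cauchy_estimate h0 _ (lP s st)) => z zs.
    exact: dphi (sub s z st zs).
  exact: phiM (sub s z st zs).
- by rewrite !mulrA -natrM.
Qed.

(** Cauchy's estimate applied to z |-> phi(z + s) - phi(z), which is O(s) by
    the previous lemma, shows that the derivative is Lipschitz; integrating
    this along the segment gives the second order bound. *)
Lemma taylor_bound phi a l h M t : 0 < h -> 0 <= t <= h ->
  (forall z, csquare (3 * h) (z - a) -> exists k, cdiff phi z k) -> cdiff phi a l ->
  (forall z, csquare (3 * h) (z - a) -> normc (phi z) <= M) ->
  normc (phi (a + t%:C) - phi a - l * t%:C) <= 256 * M / h ^+ 2 * t ^+ 2.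
Proof.
move=> h0 /andP[t0 th] dphi dl phiM.
have sub s z : 0 <= s <= t -> csquare h (z - (a + s%:C)) -> csquare (3 * h) (z - a).
  move=> st zs; have -> : z - a = z - (a + s%:C) + s%:C by ring.
  have -> : 3 * h = h + (2 * h) by ring.
  by apply: csquareD => //; apply: csquare_real; lra.
have [l' lP] : exists l' : R -> R[i], forall s, 0 <= s <= t -> cdiff phi (a + s%:C) (l' s).
  suff /choice[l' l'P] : forall s, exists k, 0 <= s <= t -> cdiff phi (a + s%:C) k by exists l'.
  move=> s; have [st|nst] := pselect (0 <= s <= t); last by exists 0.
  have [|k kP] := dphi (a + s%:C); last by exists k.
  apply: (sub s) => //; rewrite subrr; split; rewrite /= normr0; lra.
have E s : 0 <= s <= t -> normc (l' s - l) <= 8 * (16 * M / h * s) / h.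
  move=> st.
  apply: (@cauchy_estimate (fun z => phi (z + s%:C) - phi z) a) => //.
  - move=> z za.
    have [|k1 k1P] := dphi (z + s%:C).
      have -> : z + s%:C - a = z - a + s%:C by ring.
      have -> : 3 * h = h + (2 * h) by ring.
      by apply: csquareD => //; apply: csquare_real; lra.
    have [|k2 k2P] := dphi z; first by apply: csquare_le za; lra.
    exists (k1 - k2); apply: cdiffB => //.
    have : cdiff (fun z => phi (s%:C + z)) z k1 by apply: cdiff_shift; rewrite addrC.
    by under eq_fun do rewrite addrC.
  - apply: cdiffB => //.
    have : cdiff (fun z => phi (s%:C + z)) a (l' s) by apply: cdiff_shift; rewrite addrC; exact: lP.
    by under eq_fun do rewrite addrC.
  - move=> z za.
    have sub' w : csquare (2 * h) (w - z) -> csquare (3 * h) (w - a).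
      move=> wz; have -> : w - a = (w - z) + (z - a) by ring.
      have -> : 3 * h = 2 * h + h by ring.
      exact: csquareD.
    apply: lipschitz_bound => //; first lra.
      by move=> w /sub' /dphi.
    by move=> w /sub' /phiM.
have M0 : 0 <= M.
  apply: le_trans (ge0_normc (phi a)) (phiM _ _); rewrite subrr; split; rewrite /= normr0; lra.
have := @mvt_C (fun z => phi (a + z) - l * z) (fun s => l' s - l) t (8 * (16 * M / h * t) / h) t0.
rewrite addr0 mulr0 subr0 => H.
have -> : phi (a + t%:C) - phi a - l * t%:C = phi (a + t%:C) - l * t%:C - phi a by ring.
apply: le_trans (H _ _) _.
- move=> s st; apply: cdiffB; first by apply: cdiff_shift; exact: lP.
  move=> e e0; exists 1 => // w _; rewrite mulrBr subrr normc0 mulr_ge0 ?ge0_normc// ltW//.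
- move=> s st; apply: le_trans (E s st) _.
  rewrite ler_wpM2r ?invr_ge0 ?(ltW h0)// ler_wpM2l// ler_wpM2l//; last by case/andP: st.
  by rewrite divr_ge0 ?mulr_ge0 ?(ltW h0).
- by rewrite le_eqVlt; apply/orP; left; apply/eqP; field; rewrite gt_eqF.
Qed.

End CauchyEstimates.

(** * Tonelli's theorem on rectangles *)

Section SetTonelli.
Context {d1 d2} {T1 : measurableType d1} {T2 : measurableType d2} {R : realType}.
Variables (m1 : {sigma_finite_measure set T1 -> \bar R}) (m2 : {sigma_finite_measure set T2 -> \bar R}).
Local Open Scope ereal_scope.

Section one.
Variables (f : T1 * T2 -> \bar R) (A : set T1) (B : set T2).
Hypotheses (mA : measurable A) (mB : measurable B) (mf : measurable_fun setT f)
  (f0 : forall z, 0 <= f z).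

Let g := f \_ (A `*` B).
Let mg : measurable_fun setT g.
Proof.
by apply/(measurable_restrictT _ _).1; [exact: measurableX|exact: measurable_funTS].
Qed.
Let g0 z : 0 <= g z.
Proof. by apply: erestrict_ge0. Qed.

Let restr1 x : \int[m2]_y g (x, y) = ((fun x => \int[m2]_(y in B) f (x, y)) \_ A) x.
Proof.
rewrite [RHS]patchE; case: ifPn => xA.
  rewrite [RHS]integral_mkcond; apply: eq_integral => y _.
  by rewrite /g !patchE in_setX /= xA.
by rewrite integral0_eq// => y _; rewrite /g patchE in_setX /= (negbTE xA).
Qed.

Let restr2 y : \int[m1]_x g (x, y) = ((fun y => \int[m1]_(x in A) f (x, y)) \_ B) y.
Proof.
rewrite [RHS]patchE; case: ifPn => yB.
  rewrite [RHS]integral_mkcond; apply: eq_integral => x _.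
  by rewrite /g !patchE in_setX /= yB andbT.
by rewrite integral0_eq// => x _; rewrite /g patchE in_setX /= (negbTE yB) andbF.
Qed.

Lemma tonelli_prod : \int[m1 \x m2]_(z in A `*` B) f z =
  \int[m1]_(x in A) \int[m2]_(y in B) f (x, y).
Proof.
rewrite integral_mkcond (fubini_tonelli1 _ mg g0) [RHS]integral_mkcond.
by apply: eq_integral => x _; exact: restr1.
Qed.

Lemma tonelli_swap : \int[m1]_(x in A) \int[m2]_(y in B) f (x, y) =
  \int[m2]_(y in B) \int[m1]_(x in A) f (x, y).
Proof.
rewrite -tonelli_prod integral_mkcond (fubini_tonelli2 _ mg g0) [RHS]integral_mkcond.
by apply: eq_integral => y _; exact: restr2.
Qed.

End one.

Lemma measurable_int2 (f : T1 * T2 -> \bar R) (B : set T2) : measurable B ->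
  measurable_fun setT f -> (forall z, 0 <= f z) ->
  measurable_fun setT (fun x => \int[m2]_(y in B) f (x, y)).
Proof.
move=> mB mf f0.
have -> : (fun x => \int[m2]_(y in B) f (x, y)) = fubini_F m2 (f \_ (setT `*` B)).
  apply/funext => x; rewrite /fubini_F [LHS]integral_mkcond; apply: eq_integral => y _.
  by rewrite !patchE in_setX /= in_setT.
apply: measurable_fun_fubini_tonelli_F; last by move=> z; exact: erestrict_ge0.
by apply/(measurable_restrictT _ _).1; [exact: measurableX|exact: measurable_funTS].
Qed.

End SetTonelli.

(** * The area inequality in one variable *)

Section Area.
Context {R : realType}.
Local Open Scope complex_scope.
Implicit Types (phi : R[i] -> R[i]).
Import Normc.
Local Notation mu := (@lebesgue_measure R).
Local Notation RB := (measurableTypeR R).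

Lemma cdiff_continuous_at (phi : R[i] -> R[i]) (gam : R -> R[i]) (t0 : R) (l : R[i]) :
  (forall t, normc (gam t - gam t0) = `|t - t0|) -> cdiff phi (gam t0) l ->
  {for t0, continuous (fun t => normc (phi (gam t)))}.
Proof.
move=> gamE dphi; have [d d0 H] := dphi 1 ltr01.
apply/cvgrPdist_le => /= e e0.
have c0 : 0 < 1 + normc l by rewrite ltr_wpDr// ge0_normc.
near=> t.
have td : `|t - t0| <= d by rewrite distrC; near: t; apply: cvgr_dist_le => //; exact: cvg_id.
have te : `|t - t0| <= e / (1 + normc l).
  by rewrite distrC; near: t; apply: cvgr_dist_le; [exact: cvg_id|rewrite divr_gt0].
have := H (gam t); rewrite gamE => /(_ td) {}H.
have tri (a b : R[i]) : `|normc a - normc b| <= normc (a - b).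
  have := normcD (a - b) b; have := normcD (b - a) a; rewrite !subrK distcC ler_norml; lra.
apply: le_trans (tri _ _) _; rewrite distcC.
have -> : phi (gam t) - phi (gam t0) = (phi (gam t) - phi (gam t0) - l * (gam t - gam t0)) +
   l * (gam t - gam t0) by ring.
apply: le_trans (normcD _ _) _; rewrite normcM gamE.
have : `|t - t0| * (1 + normc l) <= e by rewrite -ler_pdivlMr.
lra.
Unshelve. all: by end_near. Qed.

Lemma EFin_intv (a b : R) (g : R -> R) : {within `[a, b], continuous g} ->
  ((intv a b g)%:E = \int[mu]_(x in `[a, b]) (g x)%:E)%E.
Proof.
move=> cg; rewrite /intv /Rintegral fineK//; apply: integrable_fin_num => //.
exact: integrable_cc.
Qed.

Lemma intv_le (a b : R) (g k : R -> R) : {within `[a, b], continuous g} ->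
  {within `[a, b], continuous k} -> (forall t, a <= t <= b -> `|g t| <= k t) ->
  `|intv a b g| <= intv a b k.
Proof.
move=> cg ck gk; apply: le_trans (le_normr_Rintegral _ _) _ => //; first exact: integrable_cc.
apply: le_Rintegral => //; last exact: integrable_cc.
by apply: integrable_cc => x; apply: cvg_norm; exact: cg.
Qed.

Lemma intvZ (a b c : R) (k : R -> R) : {within `[a, b], continuous k} ->
  intv a b (fun t => c * k t) = c * intv a b k.
Proof. by move=> ck; rewrite /intv RintegralZl//; exact: integrable_cc. Qed.

Lemma cdiff_limit (phi : R[i] -> R[i]) a l : cdiff phi a l -> forall e, 0 < e ->
  exists2 d, 0 < d & forall z, normc (z - a) <= d -> normc (phi z - phi a) <= e.
Proof.
move=> dphi e e0; have [d d0 H] := dphi 1 ltr01.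
have c0 : 0 < 1 + normc l by rewrite ltr_wpDr// ge0_normc.
exists (Num.min d (e / (1 + normc l))) => [|z].
  by rewrite lt_min d0 divr_gt0.
rewrite le_min => /andP[/H {}H ze].
have -> : phi z - phi a = (phi z - phi a - l * (z - a)) + l * (z - a) by ring.
apply: le_trans (normcD _ _) _; rewrite normcM.
have : normc (z - a) * (1 + normc l) <= e by rewrite -ler_pdivlMr.
lra.
Qed.

(** The residue bound for phi(z)/z without passing to the maximum: the value at
    the centre is bounded by the integral of |phi| over the boundary of the
    square of half side h. *)
Lemma circ_line_bound (phi : R[i] -> R[i]) (h : R) : 0 < h ->
  (forall z, csquare h z -> exists l, cdiff phi z l) ->
  let F x y := normc (phi (x +i* y)) in
  4 * `|complex.Re (phi 0)| * h <=
    intv (- h) h (fun t => F t (- h) + F t h) + intv (- h) h (fun t => F h t + F (- h) t) /\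
  [/\ {within `[- h, h], continuous (fun t => F t (- h))}, {within `[- h, h], continuous (fun t => F t h)},
    {within `[- h, h], continuous (fun t => F h t)} & {within `[- h, h], continuous (fun t => F (- h) t)}].
Proof.
move=> h0 dphi F.
have dphi' z : z != 0 -> `|complex.Re z| <= h -> `|complex.Im z| <= h -> derivable phi z 1.
  by move=> _ u v; have [|l /cdiff_derivable//] := dphi z.
have hh : `|h| = h by rewrite gtr0_norm.
have nhh : `|- h| = h by rewrite normrN.
have cx y : `|y| <= h -> {within `[- h, h], continuous (F^~ y)}.
  move=> hy; apply: continuous_in_subspaceT => x; rewrite inE/= in_itv/= => hx.
  have [|l] := dphi (x +i* y); first by split => //=; rewrite ler_norml.
  apply: (@cdiff_continuous_at phi (fun t => t +i* y)) => t.
  have -> : t +i* y - x +i* y = (t - x)%:C by apply/eqP; rewrite eq_complex /= subrr !eqxx.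
  by rewrite normc_real.
have cy x : `|x| <= h -> {within `[- h, h], continuous (F x)}.
  move=> hx; apply: continuous_in_subspaceT => y; rewrite inE/= in_itv/= => hy.
  have [|l] := dphi (x +i* y); first by split => //=; rewrite ler_norml.
  apply: (@cdiff_continuous_at phi (fun t => x +i* t)) => t.
  have -> : x +i* t - x +i* y = 'i * (t - y)%:C by apply/eqP; rewrite eq_complex /=; apply/andP; split; apply/eqP; ring.
  by rewrite normcM normc_i mul1r normc_real.
split; last by split; [apply: cx|apply: cx|apply: cy|apply: cy]; lra.
have [l0 dl0] := dphi 0 ltac:(split; rewrite /= normr0; lra).
have lim0 : forall e, 0 < e -> exists2 d, 0 < d & forall z, z != 0 -> normc z <= d -> normc (phi z - phi 0) <= e.
  move=> e e0; have [d d0 H] := cdiff_limit dl0 e0; exists d => // z _ zd.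
  by apply: H; rewrite subr0.
have [] := residue_Re h0 dphi' lim0.
set P := fun x y => complex.Im _; set Q := fun x y => complex.Re _ => cl res.
have B x y : `|x| <= h -> `|y| <= h -> h <= `|x| \/ h <= `|y| -> normc (phi (x +i* y) / (x +i* y)) <= h^-1 * F x y.
  move=> hx hy hxy.
  have kz : h <= normc (x +i* y).
    by have := normc_Re (x +i* y); have := normc_Im (x +i* y); rewrite /=; lra.
  rewrite normcM normcV mulrC ler_wpM2r ?ge0_normc// lef_pV2 ?posrE//; lra.
have PB x y hx hy hxy : `|P x y| <= h^-1 * F x y := le_trans (normc_Im _) (B x y hx hy hxy).
have QB x y hx hy hxy : `|Q x y| <= h^-1 * F x y := le_trans (normc_Re _) (B x y hx hy hxy).
have cP y : `|y| = h -> {within `[- h, h], continuous (P^~ y)}.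
  move=> yh; apply: (@closed_at_intvP _ P Q) => x hx; apply: cl; [by rewrite ler_norml|by rewrite yh|].
  by apply/orP; right; rewrite -normr_eq0 yh gt_eqF.
have cQ x : `|x| = h -> {within `[- h, h], continuous (Q x)}.
  move=> xh; apply: (@closed_at_intvQ _ P Q) => y hy; apply: cl; [by rewrite xh|by rewrite ler_norml|].
  by rewrite -[x == 0]normr_eq0 xh gt_eqF.
have E1 : `|intv (- h) h (fun x => P x (- h) - P x h)| <= h^-1 * intv (- h) h (fun t => F t (- h) + F t h).
  have cc : {within `[- h, h], continuous (fun t => F t (- h) + F t h)}.
    by move=> t; apply: cvgD; [apply: (cx (- h)); rewrite nhh|apply: (cx h); rewrite hh].
  rewrite -intvZ//; apply: intv_le.
  - by move=> t; apply: cvgB; [apply: (cP (- h))|apply: (cP h)].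
  - by move=> t; apply: cvgM; [exact: cvg_cst|exact: cc].
  - move=> t ht; have th : `|t| <= h by rewrite ler_norml.
    rewrite mulrDr; apply: le_trans (ler_normB _ _) _; apply: lerD; apply: PB => //; rewrite ?nhh ?hh; auto.
have E2 : `|intv (- h) h (fun y => Q h y - Q (- h) y)| <= h^-1 * intv (- h) h (fun t => F h t + F (- h) t).
  have cc : {within `[- h, h], continuous (fun t => F h t + F (- h) t)}.
    by move=> t; apply: cvgD; [apply: (cy h); rewrite hh|apply: (cy (- h)); rewrite nhh].
  rewrite -intvZ//; apply: intv_le.
  - by move=> t; apply: cvgB; [apply: (cQ h)|apply: (cQ (- h))].
  - by move=> t; apply: cvgM; [exact: cvg_cst|exact: cc].
  - move=> t ht; have th : `|t| <= h by rewrite ler_norml.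
    rewrite mulrDr; apply: le_trans (ler_normB _ _) _; apply: lerD; apply: QB => //; rewrite ?nhh ?hh; auto.
have := le_trans res (le_trans (ler_normD _ _) (lerD E1 E2)).
by rewrite -mulrDr mulrC ler_pdivlMl// mulrC [h * _]mulrC.
Qed.

Local Open Scope ereal_scope.

(** Reflection invariance of Lebesgue measure; it brings the sides at -h back
    to h. *)
Lemma integral_reflect (f : R -> \bar R) (a b : R) : measurable_fun setT f ->
  (forall x, 0 <= f x) ->
  \int[mu]_(x in `[a, b]) f (- x)%R = \int[mu]_(x in `[(- b)%R, (- a)%R]) f x.
Proof.
move=> mf f0; have -> : `[a, b]%classic = (-%R : _ -> RB) @^-1` `[(- b)%R, (- a)%R].
  by rewrite opp_preimage_itvbndbnd !opprK.
rewrite -(@ge0_integral_pushforward _ _ _ _ _ (-%R : RB -> RB))//=; last exact: measurable_funTS.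
by apply: eq_measure_integral => //= A mA AS; exact/lebesgue_measureN.
Qed.

End Area.

Section IntegralD.
Context d (T : measurableType d) (R : realType) (mu : {measure set T -> \bar R}).
Local Open Scope ereal_scope.

Lemma ge0_integralDT (D : set T) (f g : T -> \bar R) : measurable D ->
  measurable_fun setT f -> measurable_fun setT g ->
  (forall x, 0 <= f x) -> (forall x, 0 <= g x) ->
  \int[mu]_(x in D) (f x + g x) = \int[mu]_(x in D) f x + \int[mu]_(x in D) g x.
Proof. by move=> mD mf mg f0 g0; rewrite ge0_integralD//; exact: measurable_funTS. Qed.

End IntegralD.

Section Area.
Context {R : realType}.
Local Open Scope complex_scope.
Implicit Types (phi : R[i] -> R[i]).
Import Normc.
Local Notation mu := (@lebesgue_measure R).
Local Notation RB := (measurableTypeR R).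
Local Open Scope ereal_scope.

Lemma intvD (a b : R) (f g : R -> R) : {within `[a, b], continuous f} ->
  {within `[a, b], continuous g} ->
  intv a b (fun x => f x + g x)%R = (intv a b f + intv a b g)%R.
Proof. by move=> cf cg; rewrite /intv RintegralD//; exact: integrable_cc. Qed.

(** Integrating the previous boundary inequality over s/2 <= h <= s bounds
    |phi(0)| by the integral of |phi| over the square. The integrand is given
    through an extension G of |phi| that is measurable on the whole plane, so
    that Tonelli's theorem applies. *)
Lemma area_Re_bound (phi : R[i] -> R[i]) (s : R) (G : RB * RB -> \bar R) : (0 < s)%R ->
  (forall z, csquare s z -> exists l, cdiff phi z l) ->
  measurable_fun setT G -> (forall z, 0 <= G z) ->
  (forall x y, (`|x| <= s)%R -> (`|y| <= s)%R -> G (x, y) = (normc (phi (x +i* y)))%:E) ->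
  (`|complex.Re (phi 0)| * s ^+ 2)%:E <=
    4%:E * \int[mu]_(x in `[(- s)%R, s]) \int[mu]_(y in `[(- s)%R, s]) G (x, y).
Proof.
move=> s0 dphi mG G0 GE.
pose S : set R := `[(- s)%R, s]%classic.
have mS : measurable S by exact: measurable_itv.
have sub1 : `[(s / 2)%R, s]%classic `<=` S by move=> x; rewrite /S /= !in_itv/=; lra.
have sub2 : `[(- s)%R, (- (s / 2))%R]%classic `<=` S by move=> x; rewrite /S /= !in_itv/=; lra.
have T1 K : measurable_fun setT K -> (forall x, 0 <= K x) ->
    \int[mu]_(h in `[(s / 2)%R, s]) K h <= \int[mu]_(h in S) K h.
  by move=> mK K0; apply: ge0_subset_integral => //; exact: measurable_funTS.
have T2 K : measurable_fun setT K -> (forall x, 0 <= K x) ->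
    \int[mu]_(h in `[(s / 2)%R, s]) K (- h)%R <= \int[mu]_(h in S) K h.
  by move=> mK K0; rewrite integral_reflect//; apply: ge0_subset_integral => //; exact: measurable_funTS.
set I := \int[mu]_(x in _) _.
pose K1 x := \int[mu]_(y in S) G (x, y).
pose K2 y := \int[mu]_(x in S) G (x, y).
have mK1 : measurable_fun setT K1.
  exact: (@measurable_int2 _ _ RB RB R mu G S mS mG G0).
have mG' : measurable_fun setT (fun z : RB * RB => G (z.2, z.1)).
  by apply: measurableT_comp mG _; exact: measurable_swap.
have mK2 : measurable_fun setT K2.
  exact: (@measurable_int2 _ _ RB RB R mu (fun z => G (z.2, z.1)) S mS mG' (fun z => G0 _)).
have K10 x : 0 <= K1 x by exact: integral_ge0.
have K20 x : 0 <= K2 x by exact: integral_ge0.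
have IK2 : I = \int[mu]_(y in S) K2 y by exact: tonelli_swap.
pose J h := K2 (- h)%R + K2 h + (K1 h + K1 (- h)%R).
have J0 h : 0 <= J h by apply: adde_ge0; exact: adde_ge0.
have mKN K : measurable_fun setT K -> measurable_fun setT (fun h : R => K (- h)%R : \bar R).
  by move=> mK; apply: measurableT_comp mK _; exact: oppr_measurable.
have mK1N := mKN _ mK1; have mK2N := mKN _ mK2.
have mJ1 : measurable_fun setT (fun h : R => K2 (- h)%R + K2 h) by exact: emeasurable_funD.
have mJ2 : measurable_fun setT (fun h : R => K1 h + K1 (- h)%R) by exact: emeasurable_funD.
have mJ : measurable_fun setT J by exact: emeasurable_funD.
have line h : (s / 2 <= h <= s)%R -> (4 * `|complex.Re (phi 0)| * (s / 2))%:E <= J h.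
  move=> hs; have h0 : (0 < h)%R by lra.
  have dphi' z : csquare h z -> exists l, cdiff phi z l.
    by move=> zh; apply: dphi; apply: csquare_le zh; lra.
  have [L [c1 c2 c3 c4]] := circ_line_bound h0 dphi'.
  apply: (@le_trans _ _ (4 * `|complex.Re (phi 0)| * h)%:E).
    by rewrite lee_fin ler_wpM2l//; clear -hs; lra.
  have sub : `[(- h)%R, h]%classic `<=` S.
    by move=> x; rewrite /S /= !in_itv/=; lra.
  have hh x : (x \in `[(- h)%R, h] -> `|x| <= s)%R by rewrite in_itv/= ler_norml; lra.
  have hs' : (`|h| <= s)%R by rewrite ler_norml; lra.
  have nhs' : (`|- h| <= s)%R by rewrite normrN.
  have E2 y : (`|y| <= s)%R -> {within `[(- h)%R, h], continuous (fun t => normc (phi (t +i* y)))} ->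
      (intv (- h) h (fun t => normc (phi (t +i* y))))%:E <= K2 y.
    move=> ys cy; rewrite EFin_intv//.
    rewrite (eq_integral (fun t => G (t, y))); last first.
      by move=> t; rewrite inE /= => /hh ts; rewrite GE.
    apply: ge0_subset_integral => //; apply: measurable_funTS.
    exact: measurableT_comp mG (pair2_measurable y).
  have E1 x : (`|x| <= s)%R -> {within `[(- h)%R, h], continuous (fun t => normc (phi (x +i* t)))} ->
      (intv (- h) h (fun t => normc (phi (x +i* t))))%:E <= K1 x.
    move=> xs cx; rewrite EFin_intv//.
    rewrite (eq_integral (fun t => G (x, t))); last first.
      by move=> t; rewrite inE /= => /hh ts; rewrite GE.
    apply: ge0_subset_integral => //; apply: measurable_funTS.
    exact: measurableT_comp mG (pair1_measurable x).
  have {}L := L; rewrite -lee_fin in L; apply: (le_trans L).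
  rewrite !intvD// !EFinD /J; apply: leeD; apply: leeD.
  - exact: E2. - exact: E2. - exact: E1. - exact: E1.
(* (4 |Re phi(0)| s/2) integrated over an interval of length s/2 *)
have half : (`|complex.Re (phi 0)| * s ^+ 2)%:E <= \int[mu]_(h in `[(s / 2)%R, s]) J h.
  have -> : (`|complex.Re (phi 0)| * s ^+ 2)%:E = \int[mu]_(h in `[(s / 2)%R, s]) (4 * `|complex.Re (phi 0)| * (s / 2))%:E.
    rewrite integral_cst; last exact: measurable_itv.
    rewrite [X in (_ * X)%E]lebesgue_measure_itv /= lte_fin ifT; last by clear -s0; lra.
    by rewrite -EFinD -EFinM; congr (_%:E); field.
  apply: ge0_le_integral => //.
  - by move=> h _; rewrite lee_fin !mulr_ge0// ltW.
  - exact: measurable_funTS.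
apply: (le_trans half).
have mSh : measurable `[(s / 2)%R, s] by exact: measurable_itv.
have K1N0 (h : R) : 0 <= K1 (- h)%R by exact: K10.
have K2N0 (h : R) : 0 <= K2 (- h)%R by exact: K20.
have J10 (h : R) : 0 <= K2 (- h)%R + K2 h by exact: adde_ge0.
have J20 (h : R) : 0 <= K1 h + K1 (- h)%R by exact: adde_ge0.
rewrite /J (ge0_integralDT mu mSh mJ1 mJ2 J10 J20).
rewrite (ge0_integralDT mu mSh mK2N mK2 K2N0 K20) (ge0_integralDT mu mSh mK1 mK1N K10 K1N0).
apply: (@le_trans _ _ ((I + I) + (I + I))).
  have t1 := T2 _ mK2 K20; have t2 := T1 _ mK2 K20; rewrite -IK2 in t1 t2.
  exact: (leeD (leeD t1 t2) (leeD (T1 _ mK1 K10) (T2 _ mK1 K10))).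
have I0 : 0 <= I by apply: integral_ge0 => ? _; exact: K10.
clearbody I; clear -I0.
case: I I0 => [x||] // _; last by rewrite gt0_muley// lte_fin.
by rewrite -!EFinD -EFinM lee_fin; lra.
Qed.

(** The imaginary part is treated through -i phi. *)
Lemma area_bound (phi : R[i] -> R[i]) (s : R) (G : RB * RB -> \bar R) : (0 < s)%R ->
  (forall z, csquare s z -> exists l, cdiff phi z l) ->
  measurable_fun setT G -> (forall z, 0 <= G z) ->
  (forall x y, (`|x| <= s)%R -> (`|y| <= s)%R -> G (x, y) = (normc (phi (x +i* y)))%:E) ->
  (normc (phi 0) * s ^+ 2)%:E <=
    8%:E * \int[mu]_(x in `[(- s)%R, s]) \int[mu]_(y in `[(- s)%R, s]) G (x, y).
Proof.
move=> s0 dphi mG G0 GE.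
have E1 := area_Re_bound s0 dphi mG G0 GE.
have E2 : (`|complex.Re (- 'i * phi 0)| * s ^+ 2)%:E <=
    4%:E * \int[mu]_(x in `[(- s)%R, s]) \int[mu]_(y in `[(- s)%R, s]) G (x, y).
  apply: (@area_Re_bound (fun z => - 'i * phi z)%R) => //.
    move=> z /dphi[l dl]; exists (- 'i * l)%R => e e0; have [d d0 H] := dl e e0; exists d => // w wd.
    by rewrite -mulrA -!mulrBr normcM normc_opp normc_i mul1r; exact: H.
  by move=> x y xs ys; rewrite GE// normcM normc_opp normc_i mul1r.
rewrite Re_mulNi in E2.
have I0 : 0 <= \int[mu]_(x in `[(- s)%R, s]) \int[mu]_(y in `[(- s)%R, s]) G (x, y).
  by apply: integral_ge0 => ? _; exact: integral_ge0.
have E12 := leeD E1 E2; apply: (@le_trans _ _ ((`|complex.Re (phi 0)| * s ^+ 2)%:E + (`|complex.Im (phi 0)| * s ^+ 2)%:E)).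
  by rewrite -EFinD lee_fin -mulrDl ler_wpM2r ?sqr_ge0// normc_le.
apply: (le_trans E12); move: (\int[mu]_(x in _) _) I0 => [x||] // _; last by rewrite !gt0_muley// lte_fin.
by rewrite -!EFinM -EFinD lee_fin; lra.
Qed.

End Area.

(** * Averaging over boxes one coordinate at a time *)

Section TupleBox.
Context {R : realType}.
Local Notation RB := (measurableTypeR R).
Local Notation leb := (@lebesgue_measure R).
Local Open Scope ereal_scope.

Definition upd m (t : m.-tuple RB) (j : 'I_m) (s : R) : m.-tuple RB :=
  [tuple (if i == j then s else tnth t i) | i < m].

Definition box m (a : 'I_m -> set RB) : set (m.-tuple RB) :=
  [set t | forall i, a i (tnth t i)].

Lemma tnth_upd m (t : m.-tuple RB) j s i :
  tnth (upd t j s) i = if i == j then s else tnth t i.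
Proof. by rewrite /upd tnth_mktuple. Qed.

Lemma measurable_mktuple d (T : measurableType d) m (f : 'I_m -> T -> RB) :
  (forall i, measurable_fun setT (f i)) ->
  measurable_fun setT (fun x => [tuple f i x | i < m] : m.-tuple RB).
Proof.
move=> mf; apply/measurable_fun_tnthP => i.
rewrite (_ : _ \o _ = f i)//; apply/funext => x /=; exact: tnth_mktuple.
Qed.

Lemma measurable_upd m (j : 'I_m) :
  measurable_fun setT (fun z : m.-tuple RB * RB => upd z.1 j z.2).
Proof.
apply: measurable_mktuple => i; case: (i == j); first exact: measurable_snd.
by apply: measurableT_comp (measurable_tnth i) _; exact: measurable_fst.
Qed.

Lemma measurable_box m (a : 'I_m -> set RB) : (forall i, measurable (a i)) -> measurable (box a).
Proof.
move=> ma; rewrite (_ : box a = \bigcap_(i in [set: 'I_m]) ((@tnth m RB ^~ i) @^-1` a i)).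
  apply: fin_bigcap_measurable => // i _.
  by rewrite -[X in measurable X]setTI; exact: measurable_tnth.
by apply/seteqP; split => t /= tA i => [_|]; exact: tA.
Qed.

Lemma box_cons m (a : 'I_m.+1 -> set RB) :
  @tuple_consp R m @^-1` box a = a ord0 `*` box (fun i => a (lift ord0 i)).
Proof.
apply/seteqP; split => -[x t] /=.
  move=> H; split; first by have := H ord0; rewrite tnth0.
  by move=> i; have := H (lift ord0 i); rewrite tnthS.
move=> [Ax At] i; case: (unliftP ord0 i) => [j ->|->]; last by rewrite tnth0.
by rewrite tnthS; exact: At.
Qed.

Lemma integral_boxS m (a : 'I_m.+1 -> set RB) (F : m.+1.-tuple RB -> \bar R) :
  (forall i, measurable (a i)) -> measurable_fun setT F -> (forall t, 0 <= F t) ->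
  \int[@lebesgue_tuple R m.+1]_(t in box a) F t =
  \int[leb]_(x in a ord0) \int[@lebesgue_tuple R m]_(t in box (fun i => a (lift ord0 i)))
     F (tuple_consp (x, t)).
Proof.
move=> ma mF F0.
have mb := measurable_box ma.
have mb' : measurable (box (fun i => a (lift ord0 i))) by apply: measurable_box.
have mFc : measurable_fun setT (fun z => F (@tuple_consp R m z)).
  by apply: measurableT_comp mF _; exact: measurable_tuple_consp.
rewrite -(@tonelli_prod _ _ _ _ _ leb (@lebesgue_tuple R m) (fun z => F (tuple_consp z)) _ _ (ma ord0) mb' mFc (fun=> F0 _)).
rewrite -box_cons.
rewrite -(@ge0_integral_pushforward _ _ _ _ _ _ (@measurable_tuple_consp R m) _ _ F mb).
- by apply: eq_measure_integral => [|mphi A mA]; first exact: measurable_tuple_consp.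
- exact: measurable_funTS.
- by move=> t _.
Qed.

Lemma upd_cons0 m x (t : m.-tuple RB) s : upd (tuple_consp (x, t)) ord0 s = tuple_consp (s, t).
Proof.
apply: eq_from_tnth => i; rewrite tnth_upd; case: (unliftP ord0 i) => [j ->|->] /=.
  by rewrite /tuple_consp /= !tnthS.
by rewrite /tuple_consp /= !tnth0.
Qed.

Lemma upd_consS m x (t : m.-tuple RB) j s :
  upd (tuple_consp (x, t)) (lift ord0 j) s = tuple_consp (x, upd t j s).
Proof.
apply: eq_from_tnth => i; rewrite tnth_upd; case: (unliftP ord0 i) => [k ->|->] /=.
  by rewrite /tuple_consp /= !tnthS tnth_upd (inj_eq lift_inj).
by rewrite /tuple_consp /= !tnth0.
Qed.

(** Averaging in one coordinate does not change the integral over a box, up to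
    the length of that side. This is Tonelli's theorem in a form where no
    coordinate has to be moved to the front. *)
Lemma integral_box_upd m (a : 'I_m -> set RB) (j : 'I_m) (F : m.-tuple RB -> \bar R) :
  (forall i, measurable (a i)) -> measurable_fun setT F -> (forall t, 0 <= F t) ->
  \int[@lebesgue_tuple R m]_(t in box a) \int[leb]_(s in a j) F (upd t j s) =
  leb (a j) * \int[@lebesgue_tuple R m]_(t in box a) F t.
Proof.
elim: m a j F => [a []//|m IH] a j F ma mF F0.
have mFu : measurable_fun setT (fun z : m.+1.-tuple RB * RB => F (upd z.1 j z.2)).
  by apply: measurableT_comp mF _; exact: measurable_upd.
have mH : measurable_fun setT (fun t => \int[leb]_(s in a j) F (upd t j s)).
  exact: (@measurable_int2 _ _ (m.+1.-tuple RB) RB R leb (fun z => F (upd z.1 j z.2)) (a j) (ma j) mFu (fun=> F0 _)).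
have mb' : measurable (box (fun i => a (lift ord0 i))) by apply: measurable_box.
have mFc : measurable_fun setT (fun z => F (@tuple_consp R m z)).
  by apply: measurableT_comp mF _; exact: measurable_tuple_consp.
rewrite !integral_boxS//; last by move=> t; exact: integral_ge0.
case: (unliftP ord0 j) mFu mH => [k ->|->] mFu mH.
  rewrite -ge0_integralZl//; first last.
  - by move=> x _; exact: integral_ge0.
  - by apply: measurable_funTS; exact: (measurable_int2 _ _ mFc).
  apply: eq_integral => x _; under eq_integral do under eq_integral do rewrite upd_consS.
  rewrite (IH (fun i => a (lift ord0 i)) k (fun t => F (tuple_consp (x, t))))//.
  by apply: measurableT_comp mFc _; exact: pair1_measurable.
under eq_integral do under eq_integral do under eq_integral do rewrite upd_cons0.
rewrite integral_cst// muleC; congr (_ * _).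
by rewrite (@tonelli_swap _ _ _ _ _ leb (@lebesgue_tuple R m) (fun z => F (tuple_consp z))).
Qed.

End TupleBox.

(** * Differentials on complex normed spaces *)

Section ComplexNormedModule.
Context {R : realType} {V : normedModType R[i]}.
Local Open Scope complex_scope.
Implicit Types (u v : V) (z : R[i]).
Import Normc.

(** The norm of a normed space over the complex numbers takes values in the
    complex numbers; this is the same number as a real. *)
Definition nrm (v : V) : R := complex.Re `|v|.

Lemma nrmE v : `|v| = (nrm v)%:C.
Proof. by rewrite /nrm RRe_real// normr_real. Qed.

Lemma nrm_ge0 v : 0 <= nrm v.
Proof. by have := normr_ge0 v; rewrite lecE => /andP[]. Qed.

Lemma nrmD u v : nrm (u + v) <= nrm u + nrm v.
Proof. by rewrite -lecR rmorphD /= -!nrmE; exact: ler_normD. Qed.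

Lemma nrmN v : nrm (- v) = nrm v.
Proof. by rewrite /nrm normrN. Qed.

Lemma nrm_distC u v : nrm (u - v) = nrm (v - u).
Proof. by rewrite -nrmN opprB. Qed.

Lemma nrmZ z v : nrm (z *: v) = normc z * nrm v.
Proof. by apply: complexI; rewrite rmorphM /= -!nrmE normrZ. Qed.

Lemma nrm0 : nrm 0 = 0.
Proof. by rewrite /nrm normr0. Qed.

Lemma nrm_eq0 v : nrm v = 0 -> v = 0.
Proof. by move=> v0; apply/eqP; rewrite -normr_eq0 nrmE v0. Qed.

Lemma nbhs_nrmP v (S : set V) : nbhs v S <->
  exists2 d : R, 0 < d & forall w, nrm (w - v) <= d -> S w.
Proof.
split.
  move=> /nbhs_normP[e /= e0 H].
  have eE : e = (complex.Re e)%:C by rewrite RRe_real// gtr0_real.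
  have r0 : 0 < complex.Re e by rewrite -ltcR -eE.
  exists (complex.Re e / 2) => [|w zw]; first by rewrite divr_gt0.
  apply: H; rewrite /= nrmE nrm_distC eE ltcR; apply: le_lt_trans zw _; lra.
move=> [d d0 H]; apply/nbhs_normP; exists d%:C; first by rewrite /= ltcR.
by move=> w; rewrite /= nrmE ltcR nrm_distC => /ltW/H.
Qed.

Lemma open_nrmP (S : set V) v : open S -> S v ->
  exists2 d : R, 0 < d & forall w, nrm (w - v) <= d -> S w.
Proof. by move=> oS Sv; apply/nbhs_nrmP; exact: open_nbhs_nbhs. Qed.

Lemma differentiable_nrm (f : V -> R[i]) v : differentiable f v ->
  forall e, 0 < e -> exists2 d : R, 0 < d & forall h, nrm h <= d ->
    normc (f (v + h) - f v - 'd f v h) <= e * nrm h.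
Proof.
move=> /diff_locally df e e0; have /eqaddoP /(_ e%:C) := df.
rewrite ltcR => /(_ e0) /nbhs_nrmP[d d0 {}H]; exists d => // h hd.
have := H h; rewrite subr0 => /(_ hd).
rewrite !fctE /= [_ + v]addrC opprD addrA nrmE normcr.
by rewrite -rmorphM/= lecR.
Qed.

(** A sufficient criterion for differentiability with a prescribed
    differential: a bounded linear map is continuous, and uniqueness of the
    differential identifies it. *)
Lemma nrm_differentiable (f : V -> R[i]) v (L : {linear V -> R[i]}) C :
  (forall h, normc (L h) <= C * nrm h) ->
  (forall e, 0 < e -> exists2 d : R, 0 < d & forall h, nrm h <= d ->
    normc (f (v + h) - f v - L h) <= e * nrm h) ->
  differentiable f v /\ 'd f v = L :> (V -> R[i]).
Proof.
move=> LC H.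
have cL : continuous L.
  move=> x; apply/cvgrPdist_le => /= e e0; have eE : e = (complex.Re e)%:C by rewrite RRe_real// gtr0_real.
  have r0 : 0 < complex.Re e by rewrite -ltcR -eE.
  have c0 : 0 < 1 + `|C| by rewrite ltr_pwDl.
  apply/nbhs_nrmP; exists (complex.Re e / (1 + `|C|)) => [|w wx]; first by rewrite divr_gt0.
  rewrite -raddfB normcr eE lecR; apply: le_trans (LC _) _; rewrite nrm_distC.
  have := nrm_ge0 (w - x); have : C <= 1 + `|C| by have := ler_norm C; lra.
  move=> /ler_wpM2r h /h {}h; apply: le_trans h _.
  by rewrite mulrC -ler_pdivlMr.
have E : f \o shift v = cst (f v) + L +o_ 0 id.
  apply/eqaddoP => /= e e0; have eE : e = (complex.Re e)%:C by rewrite RRe_real// gtr0_real.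
  have r0 : 0 < complex.Re e by rewrite -ltcR -eE.
  have [d d0 {}H] := H _ r0.
  apply/nbhs_nrmP; exists d => // h; rewrite subr0 => hd.
  rewrite !fctE /= [_ + v]addrC opprD addrA nrmE normcr eE.
  by rewrite -rmorphM/= lecR; exact: H.
have dE := diff_unique cL E.
split; last exact: dE.
by apply/diff_locallyP; rewrite dE; split; [exact: cL|exact: E].
Qed.

(** Restriction to a complex line, which reduces several variables to one. *)
Lemma cdiff_line (f : V -> R[i]) v h z : differentiable f (v + z *: h) ->
  cdiff (fun w => f (v + w *: h)) z ('d f (v + z *: h) h).
Proof.
move=> df e e0.
have c0 : 0 < 1 + nrm h by rewrite ltr_wpDr// nrm_ge0.
have [d d0 H] := differentiable_nrm df (divr_gt0 e0 c0).
exists (d / (1 + nrm h)) => [|w wz]; first by rewrite divr_gt0.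
have wh : normc (w - z) * nrm h <= normc (w - z) * (1 + nrm h).
  by rewrite ler_wpM2l ?ge0_normc//; lra.
have := H ((w - z) *: h); rewrite nrmZ.
have -> : v + z *: h + (w - z) *: h = v + w *: h by rewrite -addrA -scalerDl subrKC.
rewrite linearZ /= => K.
have -> : 'd f (v + z *: h) h * (w - z) = (w - z) *: 'd f (v + z *: h) h by rewrite mulrC.
apply: le_trans (K _) _.
  by apply: le_trans wh _; rewrite -ler_pdivlMr.
by rewrite mulrAC ler_pdivrMr// -mulrA ler_wpM2l// ltW.
Qed.

End ComplexNormedModule.

Section RowNorm.
Context {R : realType} {n : nat}.
Local Open Scope complex_scope.
Implicit Types (v : 'rV[R[i]]_n).
Import Normc.

Lemma nrm_rV_ge v k : normc (v ord0 k) <= nrm v.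
Proof.
rewrite -lecR -nrmE -normcr {2}/Num.norm /= mx_normE -[leLHS]nngE num_le.
exact: (le_bigmax _ (fun i => `|v i.1 i.2|%:nng) (ord0, k)).
Qed.

Lemma nrm_rV_le v c : 0 <= c -> (forall k, normc (v ord0 k) <= c) -> nrm v <= c.
Proof.
move=> c0 vc; have [->//|v0] := eqVneq (nrm v) 0.
have : mx_norm v != 0.
  by apply: contra v0 => /eqP /mx_norm_eq0 ->; rewrite nrm0.
move=> /mx_norm_neq0[[i j] /=]; rewrite (ord1 i) -[mx_norm v]/(`|v|) nrmE normcr => /complexI ->.
exact: vc.
Qed.

End RowNorm.

(** * Measurability in real coordinates *)

Section Coordinates.
Context {R : realType} {n : nat}.
Local Open Scope complex_scope.
Local Notation RB := (measurableTypeR R).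
Implicit Types (O : set 'rV[R[i]]_n) (f : 'rV[R[i]]_n -> R[i]) (t : (n + n).-tuple RB).
Import Normc.

Definition cpt t : 'rV[R[i]]_n := complex_of_coords (tnth t).

Lemma cptE t k : cpt t ord0 k = tnth t (lshift n k) +i* tnth t (rshift n k).
Proof. by rewrite mxE. Qed.

Lemma nrm_cptB t t' e : 0 <= e -> (forall i, `|tnth t i - tnth t' i| <= e) ->
  nrm (cpt t - cpt t') <= 2 * e.
Proof.
move=> e0 H; apply: nrm_rV_le => [|k]; first by rewrite mulr_ge0.
rewrite !mxE; apply: le_trans (normc_le _) _ => /=.
have := H (lshift n k); have := H (rshift n k); lra.
Qed.

(** An open set is the countable union of the boxes with rational centre and
    side 2/(k+1) that it contains. *)
Lemma measurable_cpt_open O : open O -> measurable (cpt @^-1` O).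
Proof.
move=> oO.
pose B (q : (n + n).-tuple rat * nat) : set ((n + n).-tuple RB) :=
  box (fun i => `](ratr (tnth q.1 i) - q.2.+1%:R^-1), (ratr (tnth q.1 i) + q.2.+1%:R^-1)[%classic : set RB).
have mB q : measurable (B q) by apply: measurable_box => i; exact: measurable_itv.
(* the boxes are enumerated by natural numbers, the indices that are not codes
   contributing the empty set *)
pose S (k : nat) : set ((n + n).-tuple RB) :=
  if unpickle k is Some q then (if asbool (B q `<=` cpt @^-1` O) then B q else set0) else set0.
rewrite (_ : cpt @^-1` O = \bigcup_k S k).
  by apply: bigcup_measurable => k _; rewrite /S; case: (unpickle k) => // q; case: ifP.
apply/seteqP; split=> [t Ot|t [k _]]; last first.
  by rewrite /S; case: (unpickle k) => // q; case: ifP => // /asboolP; apply.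
have [d d0 H] := open_nrmP oO Ot.
have [k kd] : exists k : nat, k.+1%:R^-1 <= d / 4.
  exists (Num.bound (4 / d)); rewrite -[d / 4]invrK lef_pV2 ?posrE ?invr_gt0 ?divr_gt0//.
  rewrite invf_div; apply: ltW; apply: lt_trans (archi_boundP _) _; first by rewrite divr_ge0// ltW.
  by rewrite ltr_nat.
have [e eE] : exists e : R, k.+1%:R^-1 = e by eexists.
have e0 : 0 < e by rewrite -eE invr_gt0.
rewrite eE in kd.
have [q qP] : exists q : 'I_(n + n) -> rat, forall i,
    tnth t i - e < ratr (q i) < tnth t i + e.
  suff /choice[q qP] : forall i, exists q : rat,
      tnth t i - e < ratr q < tnth t i + e by exists q.
  move=> i.
  have [|r] := @rat_in_itvoo R (tnth t i - e) (tnth t i + e).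
    by rewrite ltrBlDr -addrA ltrDl addr_gt0.
  by rewrite in_itv /= => ?; exists r.
pose Q : (n + n).-tuple rat * nat := ([tuple q i | i < n + n], k).
have Bt : B Q t by move=> i; rewrite /= in_itv/= tnth_mktuple eE; have := qP i; lra.
have BO : B Q `<=` cpt @^-1` O.
  move=> t' Bt'; apply: H.
  apply: le_trans (@nrm_cptB t' t (2 * e) _ _) _; [lra| |lra] => i.
  have := Bt' i; rewrite /= in_itv/= tnth_mktuple eE; have := qP i; rewrite ler_norml; lra.
exists (pickle Q) => //; rewrite /S pickleK; case: ifPn => // /asboolP; by [].
Qed.

Lemma holomorphic_continuous O f : open O -> holomorphic O f ->
  forall z, O z -> forall e, 0 < e -> exists2 d, 0 < d & forall w, nrm (w - z) <= d -> normc (f w - f z) <= e.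
Proof.
move=> oO hf z Oz e e0.
have /differentiable_continuous/cvgrPdist_le /(_ e%:C) := hf z Oz.
rewrite ltcR => /(_ e0) /nbhs_nrmP[d d0 H]; exists d => // w /H.
by rewrite normcr lecR distcC.
Qed.

Lemma open_normc_gt O f a : open O -> holomorphic O f -> (forall z, ~ O z -> f z = 0) ->
  0 <= a -> open [set z | a < normc (f z)].
Proof.
move=> oO hf f0 a0; rewrite openE => z /= az.
have Oz : O z by apply: contrapT => /f0 fz; move: az; rewrite fz normc0 ltNge a0.
have e0 : 0 < (normc (f z) - a) / 2 by lra.
have [d d0 H] := holomorphic_continuous oO hf Oz e0.
apply/nbhs_nrmP; exists d => // w /H; rewrite distcC => fw /=.
have := normcD (f z - f w) (f w); rewrite subrK; lra.
Qed.

(** The extension of |f| by zero is lower semicontinuous, since f is continuous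
    on the open set and zero outside. *)
Lemma measurable_normc O f : open O -> holomorphic O f -> (forall z, ~ O z -> f z = 0) ->
  measurable_fun setT (fun t => normc (f (cpt t))).
Proof.
move=> oO hf f0 mT; apply: (measurability _ (RGenOInfty.measurableE R)) => //.
move=> _ [_ [a ->] <-]; rewrite setTI.
have [a0|a0] := leP 0 a.
  rewrite (_ : _ @^-1` _ = cpt @^-1` [set z | a < normc (f z)]).
    by apply: measurable_cpt_open; exact: (open_normc_gt oO).
  by apply/seteqP; split => t; rewrite /= in_itv/= andbT.
rewrite (_ : _ @^-1` _ = setT)//; apply/seteqP; split => // t _ /=.
by rewrite in_itv/= andbT (lt_le_trans a0)// ge0_normc.
Qed.

End Coordinates.

Section Translate.
Context {R : realType}.
Local Notation RB := (measurableTypeR R).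
Local Notation mu := (@lebesgue_measure R).
Local Open Scope ereal_scope.

Lemma measurable_translate (c : R) : measurable_fun setT (fun x : RB => (c + x)%R : RB).
Proof. by apply: measurable_funD. Qed.

Lemma lebesgue_translate (c : R) (A : set R) : measurable A ->
  pushforward mu (fun x : RB => (c + x)%R : RB) A = mu A.
Proof.
move=> mA.
pose m := measure_function_pushforward__canonical__measure_function_Measure mu (measurable_translate c).
apply/esym/(@lebesgue_measure_unique _ m) => //= _ [[a b]] _ <-.
rewrite /pushforward.
have -> : (fun x : R => (c + x)%R) @^-1` `]a, b] = `](a - c)%R, (b - c)%R]%classic.
  by apply/seteqP; split => x; rewrite /= !in_itv/=; lra.
rewrite !lebesgue_measure_itv/= !lte_fin ltrD2r; case: ifP => // _.
by rewrite -!EFinD; congr (_%:E); ring.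
Qed.

Lemma integral_translate (f : R -> \bar R) (c a b : R) : measurable_fun setT f ->
  (forall x, 0 <= f x) ->
  \int[mu]_(x in `[a, b]) f (c + x)%R = \int[mu]_(x in `[(c + a)%R, (c + b)%R]) f x.
Proof.
move=> mf f0; have -> : `[a, b]%classic = (fun x : RB => (c + x)%R : RB) @^-1` `[(c + a)%R, (c + b)%R].
  by apply/seteqP; split => x; rewrite /= !in_itv/= !lerD2l.
rewrite -(@ge0_integral_pushforward _ _ _ _ _ (fun x : RB => (c + x)%R : RB) (measurable_translate c))//=; last exact: measurable_funTS.
apply: eq_measure_integral => [|mphi A mA _]; first exact: measurable_translate.
exact: lebesgue_translate.
Qed.

End Translate.

(** * The mean value inequality in several variables *)

Section Submean.
Context {R : realType} {n : nat}.
Local Open Scope complex_scope.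
Local Notation RB := (measurableTypeR R).
Local Notation leb := (@lebesgue_measure R).
Local Notation lebT := (@lebesgue_tuple R (n + n)).
Implicit Types (t : (n + n).-tuple RB) (c : 'I_(n + n) -> R).
Import Normc.

Definition cidx (i : 'I_(n + n)) : 'I_n := match fintype.split i with inl k => k | inr k => k end.

Lemma cidx_l k : cidx (lshift n k) = k.
Proof. by rewrite /cidx; case: split_ordP => k' /esym; [move=> /lshift_inj->|move/eqP; rewrite eq_rlshift]. Qed.

Lemma cidx_r k : cidx (rshift n k) = k.
Proof. by rewrite /cidx; case: split_ordP => k' /esym; [move/eqP; rewrite eq_lrshift|move=> /rshift_inj->]. Qed.

(** Freezing the first K complex coordinates at c interpolates between a
    variable point of the box and its centre. *)
Definition freeze c (K : nat) t : (n + n).-tuple RB :=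
  [tuple (if (cidx i < K)%N then c i else tnth t i) | i < n + n].

Lemma tnth_freeze c K t i : tnth (freeze c K t) i = if (cidx i < K)%N then c i else tnth t i.
Proof. exact: tnth_mktuple. Qed.

Lemma freeze0 c t : freeze c 0 t = t.
Proof. by apply: eq_from_tnth => i; rewrite tnth_freeze ltn0. Qed.

Lemma measurable_freeze c K : measurable_fun setT (freeze c K).
Proof.
apply: measurable_mktuple => i; case: (cidx i < K)%N; first exact: measurable_cst.
exact: measurable_tnth.
Qed.

(** Letting the real and the imaginary part of the k-th coordinate run moves
    the point in a complex line through the configuration with that coordinate
    frozen. *)
Lemma freeze_updE c (k : 'I_n) t (x y : R) :
  cpt (freeze c k (upd (upd t (lshift n k) x) (rshift n k) y)) =
  cpt (freeze c k.+1 t) +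
   ((x - c (lshift n k)) +i* (y - c (rshift n k))) *: delta_mx ord0 k.
Proof.
apply/rowP => m; rewrite !mxE !tnth_freeze !tnth_upd cidx_l cidx_r eqxx /=.
rewrite eq_lrshift eq_rlshift (inj_eq (@lshift_inj _ _)) (inj_eq (@rshift_inj _ _)).
have [->|mk] := eqVneq m k.
  rewrite ltnn ltnSn mulr1; apply/eqP; rewrite eq_complex /=; apply/andP; split; apply/eqP; ring.
rewrite mulr0 addr0 ltnS [(m <= k)%N]leq_eqVlt.
by rewrite (_ : (m == k :> nat) = false)//; apply/negbTE.
Qed.

Lemma cpt_freeze_all (z : 'rV[R[i]]_n) t : cpt (freeze (fun i => real_coords z ord0 i) n t) = z.
Proof.
rewrite -[RHS]real_coordsK /cpt; congr complex_of_coords; apply/funext => i.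
by rewrite tnth_freeze ltn_ord.
Qed.

Section fixed.
Variables (Omega : set 'rV[R[i]]_n) (f : 'rV[R[i]]_n -> R[i]) (c : 'I_(n + n) -> R) (s : R).
Hypotheses (oO : open Omega) (hf : holomorphic Omega f) (f0 : forall z, ~ Omega z -> f z = 0)
  (s0 : 0 < s).
Let a i : set RB := `[c i - s, c i + s]%classic.
Hypothesis aO : forall t, box a t -> Omega (cpt t).
Let F t : \bar R := (normc (f (cpt t)))%:E.
Local Open Scope ereal_scope.

Let mF : measurable_fun setT F.
Proof. by apply/measurable_EFinP; exact: (measurable_normc oO). Qed.

Let F0 t : 0 <= F t.
Proof. by rewrite lee_fin ge0_normc. Qed.

Let ma i : measurable (a i). Proof. exact: measurable_itv. Qed.

(** The area inequality on the complex line through the k-th coordinate. *)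
Lemma submean_step t (k : 'I_n) : box a t ->
  (s ^+ 2)%:E * F (freeze c k.+1 t) <=
  8%:E * \int[leb]_(x in a (lshift n k)) \int[leb]_(y in a (rshift n k))
    F (freeze c k (upd (upd t (lshift n k) x) (rshift n k) y)).
Proof.
move=> ta; set l := lshift n k; set r := rshift n k.
pose T (z : RB * RB) := freeze c k (upd (upd t l z.1) r z.2).
have m1 : measurable_fun setT (fun x : RB => upd t l x).
  exact: (measurableT_comp (@measurable_upd R _ l) (pair1_measurable t)).
have m2 : measurable_fun setT (fun z : RB * RB => (upd t l z.1, z.2)).
  apply/measurable_fun_pairP; split; last exact: measurable_snd.
  exact: (measurableT_comp m1 measurable_fst).
have m3 := measurableT_comp (@measurable_upd R _ r) m2.
have mT : measurable_fun setT T := measurableT_comp (measurable_freeze c k) m3.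
pose H (z : RB * RB) := F (T z).
have mH : measurable_fun setT H by apply: measurableT_comp mF mT.
have tr (g : RB) : measurable_fun setT (fun x : RB => (g + x)%R : RB) by exact: measurable_translate.
pose G (z : RB * RB) := H ((c l + z.1)%R, (c r + z.2)%R).
have mG : measurable_fun setT G.
  apply: measurableT_comp mH _; apply/measurable_fun_pairP; split.
    exact: measurableT_comp (tr (c l)) measurable_fst.
  exact: measurableT_comp (tr (c r)) measurable_snd.
pose phi (z : R[i]) := f (cpt (freeze c k.+1 t) + z *: delta_mx ord0 k).
have ptE x y : cpt (T ((c l + x)%R, (c r + y)%R)) = (cpt (freeze c k.+1 t) + (x +i* y) *: delta_mx ord0 k)%R.
  have E (u v : R) : (u + v - u = v)%R by ring.
  by rewrite /T /= freeze_updE !E.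
have inO x y : (`|x| <= s)%R -> (`|y| <= s)%R -> Omega (cpt (T ((c l + x)%R, (c r + y)%R))).
  move=> xs ys; apply: aO => i; rewrite tnth_freeze !tnth_upd /=.
  have aP j (u : R) : (`|u| <= s)%R -> a j (c j + u)%R.
    by move=> us; rewrite /a /= in_itv/= lerD2l lerD2l -ler_norml.
  case: ifP => _; first by have := aP i 0%R; rewrite addr0 normr0; apply; exact: ltW.
  have [->|ir] := eqVneq i r; first exact: aP.
  have [->|il] := eqVneq i l; first exact: aP.
  exact: ta.
have := @area_bound R phi s G s0.
move=> /(_ _ mG (fun=> F0 _) _).
have -> : (normc (phi 0%R) * s ^+ 2)%:E = (s ^+ 2)%:E * F (freeze c k.+1 t).
  by rewrite /phi scale0r addr0 -EFinM mulrC.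
have -> : \int[leb]_(x in `[(- s)%R, s]) \int[leb]_(y in `[(- s)%R, s]) G (x, y) =
   \int[leb]_(x in a l) \int[leb]_(y in a r) F (freeze c k (upd (upd t l x) r y)).
  rewrite -(@integral_translate _ (fun x => \int[leb]_(y in a r) H (x, y)) (c l) (- s) s).
  - apply: eq_integral => x _.
    have mHx : measurable_fun setT (fun y : RB => H ((c l + x)%R, y)).
      exact: (measurableT_comp mH (pair1_measurable _)).
    exact: (@integral_translate _ (fun y => H ((c l + x)%R, y)) (c r) (- s) s mHx (fun=> F0 _)).
  - exact: (@measurable_int2 _ _ RB RB R leb H (a r) (ma r) mH (fun=> F0 _)).
  - by move=> x; apply: integral_ge0 => y _; exact: F0.
apply.
- case=> x y [/= xs ys].
  have := inO x y xs ys; rewrite ptE => /hf /cdiff_line H'.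
  by eexists; exact: H'.
- by move=> x y xs ys; rewrite /G /H /F ptE.
Qed.

Let measurable_freezeF K : measurable_fun setT (fun t => F (freeze c K t)).
Proof. by apply: measurableT_comp mF _; exact: measurable_freeze. Qed.

Let leb_a i : leb (a i) = (2 * s)%:E.
Proof.
have E (u v : R) : (u + v - (u - v) = 2 * v)%R by ring.
rewrite /a lebesgue_measure_itv/= lte_fin ifT; last by rewrite ltrD2l (lt_trans _ s0)// oppr_lt0.
by rewrite -EFinD E.
Qed.

(** Integrating over the box, the averages in the two real coordinates
    disappear; 32 = 8 * 2^2 absorbs the side lengths. *)
Lemma submean_integral_step (k : 'I_n) :
  \int[lebT]_(t in box a) F (freeze c k.+1 t) <= 32%:E * \int[lebT]_(t in box a) F (freeze c k t).
Proof.
have mb : measurable (box a) by exact: measurable_box.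
set l := lshift n k; set r := rshift n k.
pose H t := \int[leb]_(y in a r) F (freeze c k (upd t r y)).
have mu2 (j : 'I_(n + n)) (g : (n + n).-tuple RB -> \bar R) : measurable_fun setT g ->
    measurable_fun setT (fun z : (n + n).-tuple RB * RB => g (upd z.1 j z.2)).
  by move=> mg; apply: measurableT_comp mg _; exact: measurable_upd.
have mint (j : 'I_(n + n)) (g : (n + n).-tuple RB -> \bar R) : measurable_fun setT g -> (forall t, 0 <= g t) ->
    measurable_fun setT (fun t => \int[leb]_(y in a j) g (upd t j y)).
  move=> mg g0.
  exact: (@measurable_int2 _ _ ((n + n).-tuple RB) RB R leb (fun z => g (upd z.1 j z.2)) (a j) (ma j) (mu2 j g mg) (fun=> g0 _)).
have mH : measurable_fun setT H by exact: (mint r (fun t => F (freeze c k t)) (measurable_freezeF k)).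
have H0 t : 0 <= H t by exact: integral_ge0.
have mHH : measurable_fun setT (fun t => \int[leb]_(x in a l) H (upd t l x)) by exact: mint.
have E1 : \int[lebT]_(t in box a) ((s ^+ 2)%:E * F (freeze c k.+1 t)) <=
          \int[lebT]_(t in box a) (8%:E * \int[leb]_(x in a l) H (upd t l x)).
  apply: ge0_le_integral => //.
  - by move=> t _; rewrite mule_ge0// lee_fin sqr_ge0.
  - by apply: measurable_funTS; apply: measurable_funeM; exact: measurable_freezeF.
  - by apply: measurable_funTS; apply: measurable_funeM.
  - by move=> t tb; have := submean_step k tb; exact.
rewrite ge0_integralZl in E1; [|exact: mb|by apply: measurable_funTS; exact: measurable_freezeF|by move=> *; exact: F0|by rewrite lee_fin sqr_ge0].
rewrite ge0_integralZl in E1; [|exact: mb|exact: measurable_funTS|by move=> *; exact: integral_ge0|by rewrite lee_fin].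
rewrite integral_box_upd// in E1.
rewrite (integral_box_upd r ma (measurable_freezeF k) (fun=> F0 _)) !leb_a in E1.
have s20 : (0 < s ^+ 2)%R by rewrite exprn_gt0.
rewrite -(@lee_pmul2l _ (s ^+ 2)%:E)//.
have -> : (s ^+ 2)%:E * (32%:E * \int[lebT]_(t in box a) F (freeze c k t)) =
   8%:E * ((2 * s)%:E * ((2 * s)%:E * \int[lebT]_(t in box a) F (freeze c k t))).
  by rewrite !muleA -!EFinM; congr (_%:E * _); ring.
exact: E1.
Qed.

(** Mean value inequality for |f| on a cube, with a constant that depends on
    the dimension only: freeze the complex coordinates one after the other. *)
Lemma submean_box : F (freeze c n [tuple 0%R | i < n + n]) * ((2 * s) ^+ (n + n))%:E <=
  (32 ^+ n)%:E * \int[lebT]_(t in box a) F t.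
Proof.
have mb : measurable (box a) by exact: measurable_box.
have E K : (K <= n)%N -> \int[lebT]_(t in box a) F (freeze c K t) <=
    (32 ^+ K)%:E * \int[lebT]_(t in box a) F t.
  elim: K => [_|K IH Kn].
    by rewrite expr0 mul1e; apply: ge0_le_integral => // [||t _]; rewrite ?freeze0//;
      apply: measurable_funTS.
  have := submean_integral_step (Ordinal Kn) => /le_trans; apply.
  rewrite exprS EFinM -muleA; apply: lee_wpmul2l; first by rewrite lee_fin.
  exact: IH (ltnW Kn).
apply: le_trans (E n (leqnn n)).
rewrite (eq_integral (fun=> F (freeze c n [tuple 0%R | i < n + n]))); last first.
  move=> t _; congr (F _); apply: eq_from_tnth => i.
  by rewrite !tnth_freeze ltn_ord.
rewrite integral_cst//= /box lebesgue_tuple_box//.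
rewrite (eq_bigr (fun=> (2 * s)%:E)); last by move=> i _; exact: leb_a.
by rewrite prodEFin prodr_const card_ord.
Qed.

End fixed.
End Submean.

(** * Convexity of real powers *)

Section PowerInequalities.
Context {R : realType}.
Implicit Types (p q t s u x y M : R).

(** Young's inequality with exponents p and p/(p-1) applied to t and 1. *)
Lemma bernoulli_powR p t : 1 <= p -> 0 <= t -> 1 + p * (t - 1) <= t `^ p.
Proof.
rewrite le_eqVlt => /predU1P[<-|p1] t0; first by rewrite powRr1//; lra.
have p0 : 0 < p by lra.
have q0 : 0 < p / (p - 1) by rewrite divr_gt0//; lra.
have := @conjugate_powR R t 1 p (p / (p - 1)) t0 ler01 p0 q0.
have -> : p^-1 + (p / (p - 1))^-1 = 1 by field; lra.
move=> /(_ erefl); rewrite powR1 mulr1 -(ler_pM2l p0).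
have -> : p * (t `^ p / p + 1 / (p / (p - 1))) = t `^ p + (p - 1) by field; lra.
lra.
Qed.

(** Bernoulli's inequality at t/s, rescaled: the graph lies above its tangent
    at s. *)
Lemma powR_tangent p t s : 1 < p -> 0 <= t -> 0 < s ->
  s `^ p + p * s `^ (p - 1) * (t - s) <= t `^ p.
Proof.
move=> p1 t0 s0; have p0 : 0 < p by lra.
have ts : 0 <= t / s by rewrite divr_ge0// ltW.
have := bernoulli_powR (ltW p1) ts; rewrite -(ler_pM2l (powR_gt0 p s0)) -powRM ?(ltW s0)//.
rewrite mulrCA divff ?gt_eqF// mulr1; apply: le_trans.
rewrite -[s `^ p](mulr_powRB1 (ltW s0) p0) le_eqVlt; apply/orP; left; apply/eqP.
by field; rewrite gt_eqF.
Qed.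

Lemma bernoulli_concave q w : 0 < q <= 1 -> 0 <= w <= 1 -> (1 - w) `^ q <= 1 - q * w.
Proof.
move=> /andP[q0 q1] /andP[w0 w1].
have qw : q * w <= 1 by have := ler_pM (ltW q0) w0 q1 w1; lra.
have q1' : 1 <= q^-1 by rewrite invf_ge1.
have := @bernoulli_powR q^-1 (1 - q * w) q1' ltac:(lra).
have -> : 1 + q^-1 * (1 - q * w - 1) = 1 - w by field; rewrite gt_eqF.
move=> H.
have := @ge0_ler_powR _ q (ltW q0) (1 - w) ((1 - q * w) `^ q^-1).
rewrite !nnegrE powR_ge0 => /(_ ltac:(lra) isT H).
by rewrite -powRrM mulVf ?gt_eqF// powRr1//; lra.
Qed.

Lemma powR_pred p u : 0 < u -> u `^ (p - 1) = u * u `^ (p - 2).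
Proof.
move=> u0; have -> : p - 1 = 1 + (p - 2) by ring.
rewrite (@powRD _ u 1 (p - 2)); last by apply/implyP => _; rewrite gt_eqF.
by rewrite powRr1// ltW.
Qed.

(** Strong convexity for exponents at most 2 from first order information only.
    Going from the midpoint u to x in two steps of length e = (x - y)/4, and
    likewise to y, the four tangent inequalities telescope; the slopes at u - e
    and u differ by at least (p - 1) (e/u) u^(p-1), by concavity of the power p
    - 1. *)
Lemma powR_midpoint p x y : 1 < p <= 2 -> 0 <= y <= x -> 0 < x ->
  p * (p - 1) / 16 * ((x + y) / 2) `^ (p - 2) * (x - y) ^+ 2 <=
  x `^ p + y `^ p - 2 * ((x + y) / 2) `^ p.
Proof.
move=> /andP[p1 p2] /andP[y0 yx] x0.
set u := (x + y) / 2; set e := (x - y) / 4.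
have u0 : 0 < u by rewrite /u; lra.
have e0 : 0 <= e by rewrite /e; lra.
have ue : 2 * e <= u by rewrite /e /u; lra.
have ue0 : 0 < u - e by lra.
(* tangents at u + e and u for the half towards x, at u - e and u for the half
   towards y *)
have T1 := @powR_tangent p x (u + e) p1 (ltW x0) ltac:(lra).
have T2 := @powR_tangent p (u + e) u p1 ltac:(lra) u0.
have T3 := @powR_tangent p y (u - e) p1 y0 ue0.
have T4 := @powR_tangent p (u - e) u p1 (ltW ue0) u0.
have r01 : 0 < p - 1 <= 1 by lra.
have G1 : u `^ (p - 1) <= (u + e) `^ (p - 1).
  by apply: ge0_ler_powR; rewrite ?nnegrE; clear -r01 u0 e0; lra.
have weu : 0 <= e / u <= 1.
  by rewrite divr_ge0 ?(ltW u0)//= ler_pdivrMr//; clear -ue e0; lra.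
have G2 : (u - e) `^ (p - 1) <= u `^ (p - 1) * (1 - (p - 1) * (e / u)).
  have -> : u - e = u * (1 - e / u) by field; rewrite gt_eqF.
  rewrite powRM ?(ltW u0)//; last by rewrite subr_ge0; case/andP: weu.
  by rewrite ler_wpM2l ?powR_ge0//; exact: bernoulli_concave.
have pe0 : 0 <= p * e by rewrite mulr_ge0//; clear -p1; lra.
have := ler_wpM2l pe0 G1; have := ler_wpM2l pe0 G2.
have E : p * e * (u `^ (p - 1) * (1 - (p - 1) * (e / u))) =
   p * e * u `^ (p - 1) - p * (p - 1) / 16 * u `^ (p - 2) * (x - y) ^+ 2.
  rewrite (powR_pred _ u0).
  have -> : x - y = 4 * e by rewrite /e; field.
  by field; rewrite gt_eqF.
rewrite E.
have xE : x - (u + e) = e by rewrite /u /e; field.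
have yE : y - (u - e) = - e by rewrite /u /e; field.
have vE : u + e - u = e by ring.
have wE : u - e - u = - e by ring.
rewrite xE in T1; rewrite yE in T3; rewrite vE in T2; rewrite wE in T4.
clear -T1 T2 T3 T4.
move: T1 T2 T3 T4.
move: (x `^ p) (y `^ p) (u `^ p) ((u + e) `^ p) ((u - e) `^ p) => X Y U UP UM.
move: (u `^ (p - 1)) ((u + e) `^ (p - 1)) ((u - e) `^ (p - 1)) (_ * (x - y) ^+ 2) => g gp gm D.
lra.
Qed.

(** The derivative of t^p is p t^(p-2)/2 times that of t^2, and t^(p-2)
    decreases for p <= 2. The tangent at the midpoint w of [s, t], together
    with s^p <= w^p, replaces integration at the cost of a factor 2. *)
Lemma powR_sqr_growth p s t M : 1 < p <= 2 -> 0 <= s <= t -> t <= M -> 0 < M ->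
  p / 4 * M `^ (p - 2) * (t ^+ 2 - s ^+ 2) <= t `^ p - s `^ p.
Proof.
move=> /andP[p1 p2] /andP[s0 st] tM M0.
have p0 : 0 < p by lra.
have [t0|t0] := leP t 0.
  have -> : t = 0 by lra.
  have -> : s = 0 by lra.
  by rewrite expr0n subrr mulr0 subrr.
set w := (s + t) / 2; have w0 : 0 < w by rewrite /w; lra.
have T := @powR_tangent p t w p1 (ltW t0) w0.
have S : s `^ p <= w `^ p by apply: ge0_ler_powR; rewrite ?nnegrE /w; lra.
have MW : M `^ (p - 2) <= w `^ (p - 2).
  have -> : p - 2 = - (2 - p) by ring.
  rewrite !powRN lef_pV2 ?posrE ?powR_gt0//.
  by apply: ge0_ler_powR; rewrite ?nnegrE /w; lra.
have E := powR_pred p w0.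
have st2 : 0 <= t ^+ 2 - s ^+ 2.
  by rewrite subr_sqr mulr_ge0//; lra.
apply: (@le_trans _ _ (p / 4 * w `^ (p - 2) * (t ^+ 2 - s ^+ 2))).
  by rewrite ler_wpM2r// ler_wpM2l//; lra.
have -> : p / 4 * w `^ (p - 2) * (t ^+ 2 - s ^+ 2) = p * w `^ (p - 1) * (t - w).
  by rewrite E /w; field.
lra.
Qed.

(** Comparison of (x + y)^(q-1) with x^(q-1) and y^(q-1) in x (x + y)^(q-1) + y
    (x + y)^(q-1). *)
Lemma powR_superadd q x y : 1 <= q -> 0 <= x -> 0 <= y -> x `^ q + y `^ q <= (x + y) `^ q.
Proof.
move=> q1 x0 y0; have q0 : 0 < q by lra.
rewrite -[(x + y) `^ q]mulr_powRB1 ?addr_ge0// -(mulr_powRB1 x0 q0) -(mulr_powRB1 y0 q0).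
rewrite mulrDl; apply: lerD; rewrite ler_wpM2l//; apply: ge0_ler_powR; rewrite ?nnegrE; lra.
Qed.

(** The tangent at the midpoint lies below both values, and its slope cancels
    in the sum. *)
Lemma powR_mean q x y : 1 <= q -> 0 <= x -> 0 <= y ->
  2 * ((x + y) / 2) `^ q <= x `^ q + y `^ q.
Proof.
rewrite le_eqVlt => /predU1P[<-|q1] x0 y0; first by rewrite !powRr1//; lra.
have [u0|u0] := leP ((x + y) / 2) 0.
  have -> : (x + y) / 2 = 0 by lra.
  by rewrite powR0 ?mulr0 ?addr_ge0 ?powR_ge0//; lra.
have := powR_tangent q1 x0 u0; have := powR_tangent q1 y0 u0.
set g := q * _; have : g * (y - (x + y) / 2) + g * (x - (x + y) / 2) = 0 by field.
lra.
Qed.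

End PowerInequalities.

(** * The convexity defect of the p-th power of the modulus *)

Section Defect.
Context {R : realType}.
Local Open Scope complex_scope.
Implicit Types (p M : R) (a b : R[i]).
Import Normc.

(** How far the function |.|^p is from being affine between a and b: the
    integral of this quantity measures the loss in the norm of a midpoint. *)
Definition defect p a b : R := normc a `^ p + normc b `^ p - 2 * (normc (a + b) / 2) `^ p.

Lemma normc_sqr a : normc a ^+ 2 = complex.Re a ^+ 2 + complex.Im a ^+ 2.
Proof. by case: a => x y; rewrite /= sqr_sqrtr// addr_ge0 ?sqr_ge0. Qed.

Lemma normc_parallelogram a b : normc (a + b) ^+ 2 + normc (a - b) ^+ 2 =
  2 * (normc a ^+ 2 + normc b ^+ 2).
Proof. rewrite !normc_sqr; case: a b => [x y] [x' y'] /=; ring. Qed.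

Lemma ler_powRl p x y : 0 <= p -> 0 <= x -> x <= y -> x `^ p <= y `^ p :> R.
Proof. by move=> p0 x0 xy; apply: ge0_ler_powR; rewrite ?nnegrE// (le_trans x0). Qed.

Lemma defect_ge0 p a b : 1 <= p -> 0 <= defect p a b.
Proof.
move=> p1; have := powR_mean p1 (ge0_normc a) (ge0_normc b); rewrite /defect.
have : (normc (a + b) / 2) `^ p <= ((normc a + normc b) / 2) `^ p.
  apply: ler_powRl; rewrite ?divr_ge0 ?ge0_normc//; first lra.
  by rewrite ler_wpM2r// normcD.
lra.
Qed.

(** The parallelogram law writes |a - b|^2 as the radial part (|a| - |b|)^2
    plus a part due to the angle between a and b. The first is controlled by
    midpoint convexity of t^p, the second by the growth of t^p between |a +
    b|/2 and (|a| + |b|)/2. *)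
Lemma defect_le2 p a b M : 1 < p <= 2 -> 0 < M -> normc a <= M -> normc b <= M ->
  p * (p - 1) / 16 * M `^ (p - 2) * normc (a - b) ^+ 2 <= defect p a b.
Proof.
move=> p12 M0; wlog ba : a b / normc b <= normc a.
  move=> H aM bM; have [/H|/ltW/H] := leP (normc b) (normc a); first exact.
  by rewrite distcC /defect [b + a]addrC [normc b `^ p + _]addrC; apply.
move=> aM bM; have /andP[p1 p2] := p12.
have := normc_parallelogram a b.
have N0 := ge0_normc (a + b); have T := normcD a b; have b0 := ge0_normc b.
rewrite /defect.
move: (normc a) (normc b) (normc (a + b)) (normc (a - b)) ba aM bM N0 T b0 => x y m d yx xM yM m0 mxy y0 par.
have [x0|x0] := leP x 0.
  have yE : y = 0 by lra.
  have mE : m = 0 by lra.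
  have xE : x = 0 by lra.
  have dE : d ^+ 2 = 0 by move: par; rewrite xE yE mE expr0n/=; lra.
  have pn0 : p != 0 by rewrite gt_eqF//; lra.
  by rewrite dE xE yE mE mulr0 mul0r !powR0// mulr0 addr0 subrr.
have P := powR_midpoint p12 (_ : 0 <= y <= x) x0.
have {}P := P ltac:(lra).
have Q := @powR_sqr_growth R p (m / 2) ((x + y) / 2) M p12 ltac:(lra) ltac:(lra) M0.
have MU : M `^ (p - 2) <= ((x + y) / 2) `^ (p - 2).
  have -> : p - 2 = - (2 - p) by ring.
  rewrite !powRN lef_pV2 ?posrE ?powR_gt0//; last by clear -x0 y0; lra.
  by apply: ler_powRl; clear -p2 y0 yx x0 xM yM; lra.
have W0 : 0 < M `^ (p - 2) by exact: powR_gt0.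
have MU2 : p * (p - 1) / 16 * M `^ (p - 2) * (x - y) ^+ 2 <= p * (p - 1) / 16 * ((x + y) / 2) `^ (p - 2) * (x - y) ^+ 2.
  rewrite ler_wpM2r ?sqr_ge0// ler_wpM2l// divr_ge0// mulr_ge0//; clear -p1; lra.
have G0 : 0 <= ((x + y) / 2) ^+ 2 - (m / 2) ^+ 2.
  by rewrite subr_sqr mulr_ge0//; clear -m0 mxy yx y0 x0; lra.
have MU3 : p * (p - 1) / 16 * M `^ (p - 2) * (((x + y) / 2) ^+ 2 - (m / 2) ^+ 2) * 4 <=
   2 * (p / 4 * M `^ (p - 2) * (((x + y) / 2) ^+ 2 - (m / 2) ^+ 2)).
  set g := _ - (m / 2) ^+ 2 in G0 *.
  have -> : p * (p - 1) / 16 * M `^ (p - 2) * g * 4 = (p - 1) / 2 * (2 * (p / 4 * M `^ (p - 2) * g)) by field.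
  rewrite ler_piMl//; last by clear -p2; lra.
  by rewrite !mulr_ge0 ?(ltW W0)//; clear -p1; lra.
have dE : d ^+ 2 = (x - y) ^+ 2 + (((x + y) / 2) ^+ 2 - (m / 2) ^+ 2) * 4.
  have -> : d ^+ 2 = 2 * (x ^+ 2 + y ^+ 2) - m ^+ 2 by rewrite -par; ring.
  by field.
rewrite dE; move: P Q MU2 MU3; clear.
move: ((m / 2) `^ p) (((x + y) / 2) `^ p) (x `^ p) (y `^ p) => E F G H.
move: (M `^ (p - 2)) (((x + y) / 2) `^ (p - 2)) ((x - y) ^+ 2) (((x + y) / 2) ^+ 2 - (m / 2) ^+ 2) => W U X Y.
lra.
Qed.

Lemma sqr_powR p c : 0 <= c -> (c ^+ 2) `^ (p / 2) = c `^ p :> R.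
Proof. by move=> c0; rewrite -powR_mulrn// -powRrM; congr (_ `^ _); field. Qed.

(** For p >= 2, convexity of the power p/2 and the parallelogram law. *)
Lemma defect_ge2 p a b : 2 <= p ->
  2 * (((normc (a + b) / 2) ^+ 2 + (normc (a - b) / 2) ^+ 2) `^ (p / 2) - (normc (a + b) / 2) `^ p) <= defect p a b.
Proof.
move=> p2; have p21 : 1 <= p / 2 by lra.
have := @powR_mean R (p / 2) (normc a ^+ 2) (normc b ^+ 2) p21 (sqr_ge0 _) (sqr_ge0 _).
have -> : (normc a ^+ 2 + normc b ^+ 2) / 2 = (normc (a + b) / 2) ^+ 2 + (normc (a - b) / 2) ^+ 2.
  have := normc_parallelogram a b.
  move: (normc a) (normc b) (normc (a + b)) (normc (a - b)) => x y m d E.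
  by rewrite !exprMn exprVn; lra.
rewrite !sqr_powR ?ge0_normc//; rewrite /defect; lra.
Qed.

(** Uniform convexity on bounded sets. For p >= 2 the power |a - b|^p cannot be
    improved near the origin, whence the exponent max(2, p). *)
Lemma defect_uniform p M : 1 < p -> 0 < M -> exists2 c, 0 < c & forall a b,
  normc a <= M -> normc b <= M -> c * normc (a - b) `^ (Num.max 2 p) <= defect p a b.
Proof.
move=> p1 M0; have [p2|p2] := leP p 2.
  exists (p * (p - 1) / 16 * M `^ (p - 2)).
    by rewrite mulr_gt0 ?powR_gt0// divr_gt0// mulr_gt0//; lra.
  move=> a b aM bM; rewrite powR_mulrn ?ge0_normc//.
  by apply: defect_le2 => //; rewrite p1.
exists (2 * (2^-1 `^ p)); first by rewrite mulr_gt0 ?powR_gt0.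
move=> a b _ _; apply: le_trans (defect_ge2 a b (ltW p2)).
rewrite -mulrA -powRM ?ge0_normc// [2^-1 * _]mulrC ler_pM2l//.
have p21 : 1 <= p / 2 by lra.
have := @powR_superadd R (p / 2) ((normc (a + b) / 2) ^+ 2) ((normc (a - b) / 2) ^+ 2) p21 (sqr_ge0 _) (sqr_ge0 _).
rewrite !sqr_powR ?divr_ge0 ?ge0_normc//; lra.
Qed.

(** Near 1 the second derivative of |.|^p is bounded below, so the exponent
    2 is available for every p. This is what produces the Hoelder exponent
    1/2. *)
Lemma defect_near1 p : 1 < p -> exists2 c, 0 < c & forall a b,
  normc (a - 1) <= 4^-1 -> normc (b - 1) <= 4^-1 -> c * normc (a - b) ^+ 2 <= defect p a b.
Proof.
move=> p1; have near (z : R[i]) : normc (z - 1) <= 4^-1 -> normc z <= 2.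
  by move=> z1; have := normcD (z - 1) 1; rewrite subrK normc1; lra.
have [p2|p2] := leP p 2.
  exists (p * (p - 1) / 16 * 2 `^ (p - 2)).
    by rewrite mulr_gt0 ?powR_gt0// divr_gt0// mulr_gt0//; lra.
  by move=> a b /near a2 /near b2; apply: defect_le2 => //; rewrite p1.
exists (p * (3 / 4) `^ p / 16).
  by rewrite divr_gt0// mulr_gt0 ?powR_gt0//; lra.
move=> a b a1 b1; have a2 := near a a1; have b2 := near b b1.
apply: le_trans (defect_ge2 a b (ltW p2)).
have m34 : 3 / 4 <= normc (a + b) / 2.
  have := normcB (a - 1 + (b - 1)) (a + b); have := normcD (a - 1) (b - 1).
  have -> : a - 1 + (b - 1) - (a + b) = - (2%:C).
    by apply/eqP; rewrite eq_complex; case: (a) (b) => [? ?] [? ?] /=; apply/andP; split; apply/eqP; ring.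
  rewrite normc_opp normc_real ger0_norm//; lra.
have m2 : normc (a + b) / 2 <= 2 by have := normcD a b; lra.
move: (normc (a + b) / 2) (normc (a - b)) (ge0_normc (a - b)) m34 m2 => m d d0 m34 m2.
have m0 : 0 < m by lra.
have p21 : 1 <= p / 2 by lra.
have w0 : 0 <= 1 + (d / 2 / m) ^+ 2 by rewrite addr_ge0// sqr_ge0.
have B := bernoulli_powR p21 w0.
have E : (m ^+ 2 + (d / 2) ^+ 2) `^ (p / 2) = m `^ p * (1 + (d / 2 / m) ^+ 2) `^ (p / 2).
  rewrite -(sqr_powR p (ltW m0)) -powRM ?sqr_ge0 ?addr_ge0 ?sqr_ge0//.
  by congr (_ `^ _); field; rewrite gt_eqF.
have mp0 : 0 < m `^ p by exact: powR_gt0.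
rewrite E; apply: (@le_trans _ _ (p * m `^ p * (d / 2 / m) ^+ 2)); last first.
  have := ler_wpM2l (ltW mp0) B; clear.
  move: ((d / 2 / m) ^+ 2) => Y; move: ((1 + Y) `^ (p / 2)) (m `^ p) => X Z; lra.
have mm : (3 / 4) `^ p <= m `^ p by apply: ler_powRl; clear -p2 m34; lra.
have dm : d ^+ 2 / 16 <= (d / 2 / m) ^+ 2.
  have -> : d ^+ 2 / 16 = (d / 2 / 2) ^+ 2 by field.
  rewrite lerXn2r ?nnegrE ?divr_ge0 ?(ltW m0)//.
  by rewrite ler_wpM2l ?divr_ge0// lef_pV2 ?posrE.
have -> : p * (3 / 4) `^ p / 16 * d ^+ 2 = p * (3 / 4) `^ p * (d ^+ 2 / 16) by field.
apply: ler_pM => //; rewrite ?mulr_ge0 ?powR_ge0 ?sqr_ge0 ?invr_ge0//; try (clear -p2; lra).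
by rewrite ler_wpM2l//; clear -p2; lra.
Qed.

End Defect.

(** * The Bergman space and the defect integral *)

Section BergmanBasics.
Context {R : realType} {n : nat}.
Local Open Scope complex_scope.
Local Notation RB := (measurableTypeR R).
Local Notation lebT := (@lebesgue_tuple R (n + n)).
Local Notation Cn := 'rV[R[i]]_n.
Implicit Types (Omega : set Cn) (f g : Cn -> R[i]) (z w : Cn) (p q r : R).
Import Normc.

(** Holomorphic on Omega and extended by zero, the representatives used for
    elements of the Bergman space. *)
Definition holo0 Omega f := holomorphic Omega f /\ (forall z, ~ Omega z -> f z = 0).

Lemma bergman_holo0 p Omega f : bergman_space p Omega f -> holo0 Omega f.
Proof. by case. Qed.

Definition midp f g : Cn -> R[i] := fun z => 2^-1 * (f z + g z).

Lemma holo0D Omega f g : holo0 Omega f -> holo0 Omega g -> holo0 Omega (fun z => f z + g z).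
Proof.
move=> [hf f0] [hg g0]; split=> [z Oz|z Oz]; last by rewrite f0// g0// addr0.
by apply: differentiableD; [exact: hf|exact: hg].
Qed.

Lemma holo0Z Omega f (c : R[i]) : holo0 Omega f -> holo0 Omega (fun z => c * f z).
Proof.
move=> [hf f0]; split=> [z Oz|z Oz]; last by rewrite f0// mulr0.
by apply: (@differentiableZ _ _ _ f c z); exact: hf.
Qed.

Lemma holo0B Omega f g : holo0 Omega f -> holo0 Omega g -> holo0 Omega (fun z => f z - g z).
Proof.
move=> hf hg; have := holo0D hf (holo0Z (-1) hg).
by under eq_fun do rewrite mulN1r.
Qed.

Lemma holo0_midp Omega f g : holo0 Omega f -> holo0 Omega g -> holo0 Omega (midp f g).
Proof. by move=> hf hg; apply: holo0Z; exact: holo0D. Qed.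

Lemma normc_half (a : R[i]) : normc (2^-1 * a) = normc a / 2.
Proof.
rewrite normcM mulrC; congr (_ * _); rewrite normcV.
have -> : (2 : R[i]) = 2%:C by rewrite rmorph_nat.
by rewrite normc_real ger0_norm.
Qed.

Section measure.
Variables (Omega : set Cn) (oO : open Omega).
Local Open Scope ereal_scope.

Definition coordset : set ((n + n).-tuple RB) := cpt @^-1` Omega.

Lemma measurable_coordset : measurable coordset.
Proof. exact: measurable_cpt_open. Qed.

Lemma measurable_normcX f q : holo0 Omega f ->
  measurable_fun setT (fun t : (n + n).-tuple RB => (normc (f (cpt t)) `^ q)%:E).
Proof.
move=> [hf f0]; apply/measurable_EFinP.
apply: (@measurableT_comp _ _ _ _ _ _ (fun x : R => x `^ q)%R); first exact: measurable_powR.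
exact: (measurable_normc oO).
Qed.

Lemma integral_normpE p f : integral_normp p Omega f =
  \int[lebT]_(t in coordset) (normc (f (cpt t)) `^ p)%:E.
Proof. by []. Qed.

Lemma integral_normp_ge0 p f : 0 <= integral_normp p Omega f.
Proof. by apply: integral_ge0 => t _; rewrite lee_fin powR_ge0. Qed.

(** The p-th power of the norm, which is additive in the measure and therefore
    handier than the norm. *)
Definition pint p f : R := fine (integral_normp p Omega f).

Lemma pint_ge0 p f : (0 <= pint p f)%R.
Proof. by apply: fine_ge0; exact: integral_normp_ge0. Qed.

Lemma pintE p f : integral_normp p Omega f < +oo -> integral_normp p Omega f = (pint p f)%:E.
Proof. by move=> fin; rewrite /pint fineK// ge0_fin_numE// integral_normp_ge0. Qed.

Lemma integral_normpZ p f (c : R[i]) : holo0 Omega f ->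
  integral_normp p Omega (fun z => c * f z)%R = (normc c `^ p)%:E * integral_normp p Omega f.
Proof.
move=> hf; rewrite !integral_normpE -ge0_integralZl//.
- by apply: eq_integral => t _; rewrite normcM powRM ?ge0_normc// EFinM.
- exact: measurable_coordset.
- by apply: measurable_funTS; exact: measurable_normcX.
- by move=> t _; rewrite lee_fin powR_ge0.
- by rewrite lee_fin powR_ge0.
Qed.

Lemma bergmanZ p f (c : R[i]) : bergman_space p Omega f -> bergman_space p Omega (fun z => c * f z)%R.
Proof.
move=> bf; have hf := bergman_holo0 bf; have [h0 f0] := holo0Z c hf; split=> //.
by rewrite integral_normpZ// lte_mul_pinfty ?lee_fin ?powR_ge0//; case: bf.
Qed.

(** Linearity of the integral; that the midpoint has finite norm comes out of
    the same identity, as the defect is nonnegative. *)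
Lemma integral_defect p f g : (1 < p)%R -> bergman_space p Omega f -> bergman_space p Omega g ->
  bergman_space p Omega (midp f g) /\
  \int[lebT]_(t in coordset) (defect p (f (cpt t)) (g (cpt t)))%:E =
    (pint p f + pint p g - 2 * pint p (midp f g))%:E.
Proof.
move=> p1 bf bg; have hf := bergman_holo0 bf; have hg := bergman_holo0 bg.
have hm := holo0_midp hf hg.
have mC := measurable_coordset.
have mf := measurable_normcX p hf; have mg := measurable_normcX p hg; have mm := measurable_normcX p hm.
have mdef : measurable_fun setT (fun t : (n + n).-tuple RB => (defect p (f (cpt t)) (g (cpt t)))%:E).
  move/measurable_EFinP : mf => mf; move/measurable_EFinP : mg => mg; move/measurable_EFinP : mm => mm.
  apply/measurable_EFinP; rewrite /defect.
  under eq_fun do rewrite -normc_half.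
  apply: measurable_funB; first exact: measurable_funD.
  by apply: measurable_funM => //; exact: measurable_cst.
have E : \int[lebT]_(t in coordset) (defect p (f (cpt t)) (g (cpt t)))%:E +
     2%:E * integral_normp p Omega (midp f g) = integral_normp p Omega f + integral_normp p Omega g.
  rewrite !integral_normpE -ge0_integralZl//; last 2 first.
    - exact: measurable_funTS.
    - by move=> t _; rewrite lee_fin powR_ge0.
  rewrite -ge0_integralD//; last 4 first.
    - by move=> t _; rewrite lee_fin defect_ge0// ltW.
    - exact: measurable_funTS.
    - by move=> t _; rewrite mule_ge0// lee_fin powR_ge0.
    - by apply: measurable_funTS; exact: measurable_funeM.
  rewrite -ge0_integralD//; last 4 first.
    - by move=> t _; rewrite lee_fin powR_ge0.
    - exact: measurable_funTS.
    - by move=> t _; rewrite lee_fin powR_ge0.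
    - exact: measurable_funTS.
  apply: eq_integral => t _; rewrite -EFinM -!EFinD /midp normc_half /defect; congr (_%:E).
  by rewrite subrK.
have d0 : 0 <= \int[lebT]_(t in coordset) (defect p (f (cpt t)) (g (cpt t)))%:E.
  by apply: integral_ge0 => t _; rewrite lee_fin defect_ge0// ltW.
have [_ _ ff] := bf; have [_ _ fg] := bg.
rewrite (pintE ff) (pintE fg) in E.
have fm : integral_normp p Omega (midp f g) < +oo.
  have m0 := integral_normp_ge0 p (midp f g).
  move: E d0 m0; move: (\int[lebT]_(t in _) _) (integral_normp p Omega (midp f g)) => [x||] [y||]//=;
    by rewrite ?ltry// gt0_muley ?lte_fin.
rewrite (pintE fm) in E.
split; first by split; [exact: hm.1|exact: hm.2|exact: fm].
move: E d0; move: (\int[lebT]_(t in _) _) => [x||]//=.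
move: (pint p f) (pint p g) (pint p (midp f g)) => a b c.
by rewrite -EFinM -!EFinD => -[E] _; congr (_%:E); clear -E; lra.
Qed.

End measure.
End BergmanBasics.

(** * The minimum problem and local bounds *)

Section BergmanMin.
Context {R : realType} {n : nat}.
Local Open Scope complex_scope.
Local Notation RB := (measurableTypeR R).
Local Notation lebT := (@lebesgue_tuple R (n + n)).
Local Notation Cn := 'rV[R[i]]_n.
Implicit Types (f g : Cn -> R[i]) (z w : Cn) (q r : R).
Import Normc.
Variables (Omega : set Cn) (p : R).
Hypotheses (oO : open Omega) (bO : bounded_set Omega) (p1 : 1 < p).

Let p0 : 0 < p. Proof. exact: lt_trans ltr01 p1. Qed.

Lemma bounded_nrm : exists2 B : R, 0 < B & forall z, Omega z -> nrm z <= B.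
Proof.
have [M [Mr HM]] := bO.
have ME : M = (complex.Re M)%:C by rewrite RRe_real.
exists (`|complex.Re M| + 1) => [|z Oz]; first by rewrite ltr_wpDl.
have := HM ((`|complex.Re M| + 1)%:C) _ z Oz; rewrite /= nrmE lecR; apply.
by rewrite [X in X < _]ME ltcR; apply: le_lt_trans (ler_norm _) _; rewrite ltrDl.
Qed.

Lemma coordset_finite : (lebT (coordset Omega) < +oo)%E.
Proof.
have [B B0 HB] := bounded_nrm.
pose a (i : 'I_(n + n)) : set RB := `[(- B), B]%classic.
have sub : coordset Omega `<=` box a.
  move=> t /HB tB i; rewrite /a /= in_itv/= -ler_norml; apply: le_trans tB.
  case: (split_ordP i) => k ->; apply: le_trans (nrm_rV_ge (cpt t) k); rewrite cptE.
    exact: (normc_Re (tnth t (lshift n k) +i* tnth t (rshift n k))).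
  exact: (normc_Im (tnth t (lshift n k) +i* tnth t (rshift n k))).
apply: (@le_lt_trans _ _ (lebT (box a))).
  by apply: le_measure => //; rewrite inE; [exact: measurable_coordset|apply: measurable_box => i; exact: measurable_itv].
rewrite /box lebesgue_tuple_box; last by move=> i; exact: measurable_itv.
rewrite (eq_bigr (fun=> (B + B)%:E)).
  by rewrite prodEFin ltry.
move=> i _; rewrite /a /= lebesgue_measure_itv/= lte_fin gt0_cp// -EFinD; congr (_%:E).
by rewrite opprK.
Qed.

Definition vol : R := fine (lebT (coordset Omega)).

Lemma volE : lebT (coordset Omega) = vol%:E.
Proof. by rewrite fineK// ge0_fin_numE// coordset_finite. Qed.

(** The constant function 1 is admissible at every point because Omega is
    bounded; it shows that the minimum problem has competitors and bounds its
    value. *)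
Definition one_on : Cn -> R[i] := fun z => if asbool (Omega z) then 1 else 0.

Lemma one_on1 z : Omega z -> one_on z = 1.
Proof. by move=> Oz; rewrite /one_on asboolT. Qed.

Lemma holo0_one : holo0 Omega one_on.
Proof.
split=> [z Oz|z Oz]; last by rewrite /one_on asboolF.
have [d d0 H] := open_nrmP oO Oz.
apply: (@nrm_differentiable _ _ one_on z (\0 : {linear Cn -> R[i]}) 0 _ _).1.
  by move=> h; rewrite mul0r le_eqVlt; apply/orP; left; apply/eqP; exact: normc0.
move=> e e0; exists d => // h hd; rewrite !one_on1//; last by apply: H; rewrite addrAC subrr add0r.
rewrite subrr sub0r normc_opp (_ : normc _ = 0); last exact: normc0.
by rewrite mulr_ge0 ?nrm_ge0// ltW.
Qed.

Lemma integral_one : integral_normp p Omega one_on = vol%:E.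
Proof.
rewrite integral_normpE (eq_integral (fun=> 1%:E)); last first.
  by move=> t; rewrite inE => Ot; rewrite one_on1// normc1 powR1.
by rewrite integral_cst ?mul1e -?volE//; exact: measurable_coordset.
Qed.

Lemma bergman_one z : Omega z -> bergman_admissible p Omega z one_on.
Proof.
move=> Oz; split; last exact: one_on1.
by have [h0 f0] := holo0_one; split=> //; rewrite integral_one ltry.
Qed.

(** The p-th power m_p(z)^p of the minimum, so that the kernel is its
    inverse. *)
Definition minp z : R := bergman_min p Omega z `^ p.

Lemma Lp_norm_ge0 f : 0 <= Lp_norm p Omega f.
Proof. exact: powR_ge0. Qed.

Lemma Lp_normX f : Lp_norm p Omega f `^ p = pint Omega p f.
Proof.
by rewrite /Lp_norm -powRrM mulVf ?gt_eqF// powRr1//; exact: pint_ge0.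
Qed.

Lemma bergman_min_le z f : bergman_admissible p Omega z f -> bergman_min p Omega z <= Lp_norm p Omega f.
Proof.
move=> af; apply: ge_inf; last by exists f.
by exists 0 => _ [g _ <-]; exact: Lp_norm_ge0.
Qed.

Lemma bergman_min_ge0 z : Omega z -> 0 <= bergman_min p Omega z.
Proof.
move=> Oz; apply: lb_le_inf => [|_ [g _ <-]]; last exact: Lp_norm_ge0.
by exists (Lp_norm p Omega one_on); exists one_on => //; exact: bergman_one.
Qed.

Lemma minp_le z f : Omega z -> bergman_admissible p Omega z f -> minp z <= pint Omega p f.
Proof.
move=> Oz af; rewrite -Lp_normX; apply: ler_powRl; [exact: ltW|exact: bergman_min_ge0|].
exact: bergman_min_le.
Qed.

(** Minimizing sequences exist. *)
Lemma minp_approx z e : Omega z -> 0 < e ->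
  exists2 f, bergman_admissible p Omega z f & pint Omega p f < minp z + e.
Proof.
move=> Oz e0; set m := bergman_min p Omega z.
have m0 : 0 <= m by exact: bergman_min_ge0.
pose tau := (m `^ p + e) `^ p^-1.
have tau0 : 0 <= tau by exact: powR_ge0.
have tauX : tau `^ p = m `^ p + e.
  by rewrite /tau -powRrM mulVf ?gt_eqF// powRr1// addr_ge0 ?powR_ge0// ltW.
have mtau : m < tau.
  rewrite ltNge; apply/negP => /(ler_powRl (ltW p0) tau0); rewrite tauX; lra.
have hi : has_inf [set Lp_norm p Omega f | f in bergman_admissible p Omega z].
  split; first by exists (Lp_norm p Omega one_on); exists one_on => //; exact: bergman_one.
  by exists 0 => _ [g _ <-]; exact: Lp_norm_ge0.
have tm : 0 < tau - m by rewrite subr_gt0.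
have [_ [f af <-]] := inf_adherent tm hi.
rewrite -/(bergman_min p Omega z) -/m subrKC => ftau; exists f => //.
rewrite -Lp_normX /minp -/m -tauX; apply: gt0_ltr_powR; rewrite ?nnegrE//; exact: Lp_norm_ge0.
Qed.

Lemma pintZ f (c : R[i]) : bergman_space p Omega f ->
  pint Omega p (fun z => c * f z) = normc c `^ p * pint Omega p f.
Proof.
move=> bf; rewrite {1}/pint (integral_normpZ oO)//; last exact: bergman_holo0 bf.
by rewrite (pintE (let: And3 _ _ h := bf in h)) -EFinM.
Qed.

(** Rescaling a function to the value 1 at z makes it admissible. This is the
    extremal characterization of the kernel: |f(z)|^p <= K(z) times the
    integral of |f|^p. *)
Lemma point_le f z : Omega z -> bergman_space p Omega f -> normc (f z) `^ p * minp z <= pint Omega p f.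
Proof.
move=> Oz bf; have [fz|fz] := eqVneq (f z) 0.
  by rewrite fz normc0 powR0 ?gt_eqF// mul0r; exact: pint_ge0.
have af : bergman_admissible p Omega z (fun w => (f z)^-1 * f w).
  by split; [exact: (bergmanZ oO)|rewrite mulVf].
have := minp_le Oz af; rewrite pintZ// normcV.
have N0 : 0 < normc (f z) by rewrite normc_gt0.
have -> : (normc (f z))^-1 `^ p = (normc (f z) `^ p)^-1.
  apply: (mulfI (lt0r_neq0 (powR_gt0 p N0))).
  rewrite -powRM ?invr_ge0 ?(ltW N0)// mulfV ?gt_eqF// powR1 mulfV// gt_eqF//.
  exact: powR_gt0.
by rewrite ler_pdivlMl ?powR_gt0.
Qed.

Lemma bergman_kernelE z : bergman_kernel p Omega z = (minp z)^-1.
Proof. by rewrite /bergman_kernel powRN. Qed.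

(** The point z has distance at least r to the complement of Omega, in the norm
    nrm. All constants below depend on r and not on z. *)
Definition deep r z := forall w, nrm (w - z) <= r -> Omega w.

Lemma deep_in r z : 0 <= r -> deep r z -> Omega z.
Proof. by move=> r0; apply; rewrite subrr nrm0. Qed.

Lemma deep_sub r s z w : nrm (w - z) <= r -> deep (r + s) z -> deep s w.
Proof.
move=> wz dz u uw; apply: dz; have -> : u - z = (w - z) + (u - w) by rewrite [RHS]addrC subrKA.
by apply: le_trans (nrmD _ _) _; exact: lerD.
Qed.

Lemma deep_le r s z : r <= s -> deep s z -> deep r z.
Proof. by move=> rs ds w wz; apply: ds; apply: le_trans rs. Qed.

(** The cube with centre z and side r, as a set of real coordinate vectors. *)
Definition qbox r z : set ((n + n).-tuple RB) :=
  box (fun i => `[real_coords z ord0 i - r / 2, real_coords z ord0 i + r / 2]%classic : set RB).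

Lemma measurable_qbox r z : measurable (qbox r z).
Proof. by apply: measurable_box => i; exact: measurable_itv. Qed.

Lemma qbox_near r z t : 0 <= r -> qbox r z t -> nrm (cpt t - z) <= r.
Proof.
move=> r0 tz; apply: nrm_rV_le => // k.
have -> : (cpt t - z) ord0 k = cpt t ord0 k - z ord0 k by rewrite !mxE.
rewrite cptE.
have := tz (lshift n k); have := tz (rshift n k); rewrite /= !in_itv/= row_mxEl row_mxEr !mxE.
move=> A B; apply: le_trans (normc_le _) _.
have : `|complex.Re (tnth t (lshift n k) +i* tnth t (rshift n k) - z ord0 k)| <= r / 2.
  by case: (z ord0 k) A B => x y /= A B; rewrite ler_norml; lra.
have : `|complex.Im (tnth t (lshift n k) +i* tnth t (rshift n k) - z ord0 k)| <= r / 2.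
  by case: (z ord0 k) A B => x y /= A B; rewrite ler_norml; lra.
lra.
Qed.

Lemma qbox_vol r z : 0 < r -> lebT (qbox r z) = (r ^+ (n + n))%:E.
Proof.
move=> r0; pose A i : set RB := `[real_coords z ord0 i - r / 2, real_coords z ord0 i + r / 2]%classic.
have mA i : measurable (A i) by exact: measurable_itv.
rewrite [LHS](lebesgue_tuple_box mA) (eq_bigr (fun=> r%:E)); first by rewrite prodEFin prodr_const card_ord.
move=> i _; rewrite /A lebesgue_measure_itv/=; move: (real_coords z ord0 i) => c.
have E : c + r / 2 - (c - r / 2) = r by field.
have L : c - r / 2 < c + r / 2 by lra.
by rewrite lte_fin L -EFinD E.
Qed.

(** A substitute for Hoelder's inequality: it turns a bound for the integral of
    |f|^q into one for the integral of |f|, and choosing d balances the two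
    terms. *)
Lemma young_split q d x : 1 <= q -> 0 < d -> 0 <= x -> x <= d + d `^ (1 - q) * x `^ q.
Proof.
move=> q1 d0 x0; have [xd|dx] := leP x d.
  by have := mulr_ge0 (powR_ge0 d (1 - q)) (powR_ge0 x q); lra.
have x0' : 0 < x by lra.
have -> : x `^ q = x * x `^ (q - 1) by rewrite mulr_powRB1//; lra.
have : 1 <= d `^ (1 - q) * x `^ (q - 1).
  have -> : 1 - q = - (q - 1) by ring.
  rewrite powRN mulrC ler_pdivlMr ?powR_gt0// mul1r.
  by apply: ler_powRl; lra.
move=> H; have := ler_wpM2l x0 H; rewrite mulr1 mulrCA; lra.
Qed.

(** The mean value inequality on a cube, with |f| replaced by d + d^(1-q)
    |f|^q. *)
Lemma submean_q r : 0 < r -> exists2 C, 0 < C & forall f z q (d E : R),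
  holo0 Omega f -> deep r z -> 1 <= q -> 0 < d ->
  (\int[lebT]_(t in qbox r z) (normc (f (cpt t)) `^ q)%:E <= E%:E)%E ->
  normc (f z) <= C * (d + d `^ (1 - q) * E).
Proof.
move=> r0; have rn0 : 0 < r ^+ (n + n) by rewrite exprn_gt0.
exists (32 ^+ n * (1 + (r ^+ (n + n))^-1)).
  by rewrite mulr_gt0 ?exprn_gt0// addr_gt0 ?invr_gt0.
move=> f z q d E hf dz q1 d0 fE.
have E0 : 0 <= E.
  by rewrite -lee_fin; apply: le_trans fE; apply: integral_ge0 => t _; rewrite lee_fin powR_ge0.
have sm := @submean_box R n Omega f (fun i => real_coords z ord0 i) (r / 2) oO hf.1 hf.2 ltac:(lra).
have {sm} := sm (fun t tz => dz _ (qbox_near (ltW r0) tz)).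
rewrite cpt_freeze_all -EFinM.
have -> : 2 * (r / 2) = r by field.
have : (\int[lebT]_(t in qbox r z) (normc (f (cpt t)))%:E <= (d * r ^+ (n + n) + d `^ (1 - q) * E)%:E)%E.
  apply: (@le_trans _ _ (\int[lebT]_(t in qbox r z) (d%:E + (d `^ (1 - q))%:E * (normc (f (cpt t)) `^ q)%:E))%E).
    apply: ge0_le_integral => //.
    - exact: measurable_qbox.
    - by move=> t _; rewrite lee_fin ge0_normc.
    - by apply: measurable_funTS; apply/measurable_EFinP; exact: (measurable_normc oO hf.1 hf.2).
    - apply: measurable_funTS; apply: emeasurable_funD => //; apply: measurable_funeM.
      exact: (measurable_normcX oO).
    - by move=> t _; rewrite -EFinM -EFinD lee_fin young_split// ge0_normc.
  rewrite ge0_integralD//; last 4 first.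
  - exact: measurable_qbox.
  - by move=> t _; rewrite lee_fin ltW.
  - by move=> t _; rewrite -EFinM lee_fin mulr_ge0 ?powR_ge0.
  - by apply: measurable_funTS; apply: measurable_funeM; exact: (measurable_normcX oO).
  rewrite integral_cst; last exact: measurable_qbox.
  rewrite [X in (d%:E * X)%E](qbox_vol z r0) ge0_integralZl//; last 4 first.
  - exact: measurable_qbox.
  - by apply: measurable_funTS; exact: (measurable_normcX oO).
  - by move=> t _; rewrite lee_fin powR_ge0.
  - by rewrite lee_fin powR_ge0.
  by rewrite EFinD EFinM leeD2l// EFinM lee_wpmul2l// lee_fin powR_ge0.
move=> H1 H2; have := le_trans H2 (lee_wpmul2l _ H1).
rewrite lee_fin => /(_ ltac:(by rewrite exprn_ge0)); rewrite -EFinM lee_fin.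
rewrite -ler_pdivlMr// => /le_trans; apply.
have -> : 32 ^+ n * (d * r ^+ (n + n) + d `^ (1 - q) * E) / r ^+ (n + n) =
  32 ^+ n * (d + (r ^+ (n + n))^-1 * (d `^ (1 - q) * E)) by field; rewrite gt_eqF.
rewrite -mulrA ler_wpM2l ?exprn_ge0//.
have : 0 <= (r ^+ (n + n))^-1 * d by rewrite mulr_ge0 ?invr_ge0 ?ltW.
have : 0 <= d `^ (1 - q) * E by rewrite mulr_ge0 ?powR_ge0.
move: (d `^ (1 - q) * E) (r ^+ (n + n))^-1 => X Y; lra.
Qed.

End BergmanMin.

(** * Cauchy estimates on balls *)

Section BallEstimates.
Context {R : realType} {V : normedModType R[i]}.
Local Open Scope complex_scope.
Implicit Types (f : V -> R[i]) (v h e : V) (r M : R).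
Import Normc.

Definition holo_ball f v r M := forall w, nrm (w - v) <= r ->
  differentiable f w /\ normc (f w) <= M.

Lemma holo_ball_line f v r M h s : 0 <= s -> holo_ball f v r M -> 2 * s * nrm h = r ->
  forall z : R[i], csquare s z -> differentiable f (v + z *: h) /\ normc (f (v + z *: h)) <= M.
Proof.
move=> s0 H sr z [z1 z2]; apply: H; rewrite addrAC subrr add0r nrmZ -sr.
by rewrite ler_wpM2r ?nrm_ge0//; apply: le_trans (normc_le _) _; lra.
Qed.

Lemma ball_cauchy f v r M h : 0 < r -> holo_ball f v r M ->
  normc ('d f v h) <= 16 * M / r * nrm h.
Proof.
move=> r0 H; have [h0|h0] := eqVneq (nrm h) 0.
  by rewrite (nrm_eq0 h0) linear0 nrm0 mulr0 normc0.
have {}h0 : 0 < nrm h by rewrite lt_def h0 nrm_ge0.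
pose s := r / (2 * nrm h); have s0 : 0 < s by rewrite divr_gt0// mulr_gt0.
have sE : 2 * s * nrm h = r by rewrite /s; field; rewrite gt_eqF.
have L := holo_ball_line (ltW s0) H sE.
have := @cauchy_estimate R (fun w => f (v + w *: h)) 0 ('d f v h) s M s0.
have -> : 8 * M / s = 16 * M / r * nrm h by rewrite /s; field; rewrite !gt_eqF.
apply.
- move=> z; rewrite subr0 => /L[dz _]; exists ('d f (v + z *: h) h).
  exact: cdiff_line.
- have [|d0 _] := L 0; first by split; rewrite /= normr0 ltW.
  by have := cdiff_line d0; rewrite scale0r addr0.
- by move=> z; rewrite subr0 => /L[].
Qed.

(** The Cauchy estimate for the difference of two functions. It is stated with
    the two differentials kept apart, as the differential of a difference is
    then never formed. *)
Lemma ball_cauchyB f g v r M h : 0 < r ->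
  (forall w : V, nrm (w - v) <= r -> [/\ differentiable f w, differentiable g w & normc (f w - g w) <= M]) ->
  normc ('d f v h - 'd g v h) <= 16 * M / r * nrm h.
Proof.
move=> r0 H; have [h0|h0] := eqVneq (nrm h) 0.
  rewrite (nrm_eq0 h0) nrm0 mulr0.
  have zero (a b : R[i]) : a = 0 -> b = 0 -> normc (a - b) <= 0 by move=> -> ->; rewrite subrr normc0.
  by apply: zero; exact: linear0.
have {}h0 : 0 < nrm h by rewrite lt_def h0 nrm_ge0.
pose s := r / (2 * nrm h); have s0 : 0 < s by rewrite divr_gt0// mulr_gt0.
have sE : 2 * s * nrm h = r by rewrite /s; field; rewrite gt_eqF.
have L z : csquare s z -> [/\ differentiable f (v + z *: h), differentiable g (v + z *: h)
    & normc (f (v + z *: h) - g (v + z *: h)) <= M].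
  move=> [z1 z2]; apply: H; rewrite addrAC subrr add0r nrmZ -sE ler_wpM2r ?nrm_ge0//.
  by apply: le_trans (normc_le _) _; lra.
have := @cauchy_estimate R (fun w => f (v + w *: h) - g (v + w *: h)) 0 ('d f v h - 'd g v h) s M s0.
have -> : 8 * M / s = 16 * M / r * nrm h by rewrite /s; field; rewrite !gt_eqF.
apply.
- move=> z; rewrite subr0 => /L[d1 d2 _]; exists ('d f (v + z *: h) h - 'd g (v + z *: h) h).
  by apply: cdiffB; exact: cdiff_line.
- have [|d1 d2 _] := L 0; first by split; rewrite /= normr0 ltW.
  apply: cdiffB; first by have := cdiff_line d1; rewrite scale0r addr0.
  by have := cdiff_line d2; rewrite scale0r addr0.
- by move=> z; rewrite subr0 => /L[].
Qed.

Lemma ball_lipschitz f v r M h : 0 < r -> holo_ball f v r M -> 4 * nrm h <= r ->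
  normc (f (v + h) - f v) <= 64 * M / r * nrm h.
Proof.
move=> r0 H hr; have [h0|h0] := eqVneq (nrm h) 0.
  by rewrite (nrm_eq0 h0) addr0 subrr nrm0 mulr0 normc0.
have {}h0 : 0 < nrm h by rewrite lt_def h0 nrm_ge0.
pose s := r / (4 * nrm h); have s0 : 0 < s by rewrite divr_gt0// mulr_gt0.
have s1 : 1 <= s by rewrite /s ler_pdivlMr ?mulr_gt0// mul1r.
have sE : 2 * (2 * s) * nrm h = r by rewrite /s; field; rewrite gt_eqF.
have s20 : 0 <= 2 * s by lra.
have L := holo_ball_line s20 H sE.
have := @lipschitz_bound R (fun w => f (v + w *: h)) 0 s M 1 s0.
have -> : 16 * M / s * 1 = 64 * M / r * nrm h by rewrite /s; field; rewrite !gt_eqF.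
rewrite add0r scale0r addr0 scale1r; apply.
- by rewrite ler01.
- move=> z; rewrite subr0 => /L[dz _]; exists ('d f (v + z *: h) h).
  exact: cdiff_line.
- by move=> z; rewrite subr0 => /L[].
Qed.

Lemma ball_taylor f v r M h : 0 < r -> holo_ball f v r M -> 6 * nrm h <= r ->
  normc (f (v + h) - f v - 'd f v h) <= 96 ^+ 2 * M / r ^+ 2 * nrm h ^+ 2.
Proof.
move=> r0 H hr; have [h0|h0] := eqVneq (nrm h) 0.
  by rewrite (nrm_eq0 h0) linear0 addr0 subrr subr0 nrm0 expr0n mulr0 normc0.
have {}h0 : 0 < nrm h by rewrite lt_def h0 nrm_ge0.
pose s := r / (6 * nrm h); have s0 : 0 < s by rewrite divr_gt0// mulr_gt0.
have s1 : 1 <= s by rewrite /s ler_pdivlMr ?mulr_gt0// mul1r.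
have sE : 2 * (3 * s) * nrm h = r by rewrite /s; field; rewrite gt_eqF.
have s20 : 0 <= 3 * s by lra.
have L := holo_ball_line s20 H sE.
have := @taylor_bound R (fun w => f (v + w *: h)) 0 ('d f v h) s M 1 s0.
have -> : 256 * M / s ^+ 2 * 1 ^+ 2 = 96 ^+ 2 * M / r ^+ 2 * nrm h ^+ 2.
  by rewrite /s; field; rewrite !gt_eqF.
rewrite add0r scale0r addr0 scale1r mulr1; apply.
- by rewrite ler01.
- move=> z; rewrite subr0 => /L[dz _]; exists ('d f (v + z *: h) h).
  exact: cdiff_line.
- have [|d0 _] := L 0; first by split; rewrite /= normr0.
  by have := cdiff_line d0; rewrite scale0r addr0.
- by move=> z; rewrite subr0 => /L[].
Qed.

Lemma holo_ball_sub f v w r s M : nrm (w - v) <= r -> holo_ball f v (r + s) M -> holo_ball f w s M.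
Proof.
move=> wv H u uw; apply: H; have -> : u - v = (w - v) + (u - w) by rewrite [RHS]addrC subrKA.
by apply: le_trans (nrmD _ _) _; exact: lerD.
Qed.

(** Cauchy's estimate for w |-> f(w + h) - f(w), which is O(|h|) on the half
    ball. *)
Lemma ball_diff_lipschitz f v r M h e : 0 < r -> holo_ball f v r M -> 8 * nrm h <= r ->
  normc ('d f (v + h) e - 'd f v e) <= 64 ^+ 2 * M / r ^+ 2 * nrm h * nrm e.
Proof.
move=> r0 H hr; have [e0|e0] := eqVneq (nrm e) 0.
  have d0 x : 'd f x (0 : V) = 0 :> R[i] by exact: linear0.
  by rewrite (nrm_eq0 e0) !d0 subrr nrm0 mulr0 normc0.
have {}e0 : 0 < nrm e by rewrite lt_def e0 nrm_ge0.
have h0 := nrm_ge0 h.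
pose s := r / (4 * nrm e); have s0 : 0 < s by rewrite divr_gt0// mulr_gt0.
have sE : 2 * s * nrm e = r / 2 by rewrite /s; field; rewrite gt_eqF.
have r20 : 0 < r / 2 by lra.
have near z : csquare s z -> nrm (z *: e) <= r / 2.
  move=> [z1 z2]; rewrite nrmZ -sE ler_wpM2r// ?(ltW e0)//.
  by apply: le_trans (normc_le _) _; lra.
have rr : r / 2 + r / 2 = r by field.
have sub z : csquare s z -> holo_ball f (v + z *: e) (r / 2) M.
  move=> /near zr; apply: (@holo_ball_sub _ v _ (r / 2)); last by rewrite rr.
  by rewrite addrAC subrr add0r.
have dh z : csquare s z -> differentiable f (v + z *: e) /\ differentiable f (v + h + z *: e).
  move=> /sub zs; split.
    have := zs (v + z *: e); rewrite subrr nrm0 => /(_ (ltW r20))[].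
    by [].
  have [|] := zs (v + h + z *: e); last by []. rewrite [v + h + _]addrAC [X in nrm X]addrAC subrr add0r; lra.
pose phi z := f (v + h + z *: e) - f (v + z *: e).
have := @cauchy_estimate R phi 0 ('d f (v + h) e - 'd f v e) s (64 * M / (r / 2) * nrm h) s0.
have -> : 8 * (64 * M / (r / 2) * nrm h) / s = 64 ^+ 2 * M / r ^+ 2 * nrm h * nrm e.
  by rewrite /s; field; rewrite !gt_eqF.
apply.
- move=> z; rewrite subr0 => /dh[d1 d2]; exists ('d f (v + h + z *: e) e - 'd f (v + z *: e) e).
  by apply: cdiffB; exact: cdiff_line.
- have [|d1 d2] := dh 0; first by split; rewrite /= normr0 ltW.
  apply: cdiffB; first by have := cdiff_line d2; rewrite scale0r addr0.
  by have := cdiff_line d1; rewrite scale0r addr0.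
- move=> z; rewrite subr0 /phi [v + h + _]addrAC => /sub zs.
  by apply: ball_lipschitz => //; lra.
Qed.

End BallEstimates.

(** * Limits of complex sequences *)

Section Sequences.
Context {R : realType}.
Local Open Scope complex_scope.
Implicit Types (u v : nat -> R[i]) (e : R).
Import Normc.

Lemma real_cauchy (u : nat -> R) :
  (forall e, 0 < e -> exists K : nat, forall k l, (K <= k)%N -> (K <= l)%N -> `|u k - u l| <= e) ->
  exists l, forall e, 0 < e -> exists K : nat, forall k, (K <= k)%N -> `|u k - l| <= e.
Proof.
move=> H; have : cauchy (u @ \oo).
  apply: cauchy_exP => e e0; have [K HK] := H (e / 2) ltac:(lra).
  exists (u K); exists K => //= k Kk.
  by rewrite /ball/=; apply: le_lt_trans (HK _ _ (leqnn _) Kk) _; lra.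
move=> /cauchy_cvgP/cvg_ex[l /= ul]; exists l => e e0.
have /cvgrPdist_le/(_ e e0)[K _ HK] := ul.
by exists K => k Kk; rewrite distrC; exact: (HK k Kk).
Qed.

Definition clim u (l : R[i]) := forall e : R, 0 < e -> exists K : nat, forall k, (K <= k)%N -> normc (u k - l) <= e.

Lemma clim_cauchy u :
  (forall e : R, 0 < e -> exists K : nat, forall k l, (K <= k)%N -> (K <= l)%N -> normc (u k - u l) <= e) ->
  exists l, clim u l.
Proof.
move=> H.
have [e e0|a Ha] := @real_cauchy (fun k => complex.Re (u k)).
  have [K HK] := H e e0; exists K => k l Kk Kl; apply: le_trans (HK _ _ Kk Kl).
  by rewrite -raddfB; exact: normc_Re.
have [e e0|b Hb] := @real_cauchy (fun k => complex.Im (u k)).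
  have [K HK] := H e e0; exists K => k l Kk Kl; apply: le_trans (HK _ _ Kk Kl).
  by rewrite -raddfB; exact: normc_Im.
exists (a +i* b) => e e0.
have [K HK] := Ha (e / 2) ltac:(lra); have [K' HK'] := Hb (e / 2) ltac:(lra).
exists (maxn K K') => k; rewrite geq_max => /andP[/HK A /HK' B].
by apply: le_trans (normc_le _) _; case: (u k) A B => x y /=; lra.
Qed.

Lemma clim_le u (l : R[i]) (K : nat) (B : R) : clim u l -> (forall k, (K <= k)%N -> normc (u k) <= B) -> normc l <= B.
Proof.
move=> ul uB; apply/ler_addgt0Pr => e /ul[K' HK'].
have := HK' _ (leq_maxr K K'); have := uB _ (leq_maxl K K').
by have := normcD (u (maxn K K')) (l - u (maxn K K')); rewrite subrKC [X in _ + X]distcC; lra.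
Qed.

Lemma clim_cst (l : R[i]) : clim (fun=> l) l.
Proof. by move=> e e0; exists 0 => k _; rewrite subrr normc0 ltW. Qed.

Lemma climD u v (l k : R[i]) : clim u l -> clim v k -> clim (fun i => u i + v i) (l + k).
Proof.
move=> ul vk e e0; have e20 : 0 < e / 2 by lra.
have [K HK] := ul _ e20; have [K' HK'] := vk _ e20.
exists (maxn K K') => i; rewrite geq_max => /andP[/HK A /HK' B].
by rewrite opprD addrACA; apply: le_trans (normcD _ _) _; lra.
Qed.

Lemma climZ u (l c : R[i]) : clim u l -> clim (fun i => c * u i) (c * l).
Proof.
move=> ul e e0; have c0 := ge0_normc c.
have [K HK] := ul (e / (1 + normc c)) ltac:(by rewrite divr_gt0// ltr_pwDl).
exists K => k /HK; rewrite -mulrBr normcM ler_pdivlMr ?ltr_pwDl// mulrC => H; apply: le_trans H.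
by rewrite ler_wpM2r ?ge0_normc//; lra.
Qed.

Lemma climB u v (l k : R[i]) : clim u l -> clim v k -> clim (fun i => u i - v i) (l - k).
Proof.
move=> ul vk; have := climD ul (climZ (-1) vk).
by rewrite mulN1r; under eq_fun do rewrite mulN1r.
Qed.

Lemma clim_unique u (l k : R[i]) : clim u l -> clim u k -> l = k.
Proof.
move=> ul uk; apply/eqP; rewrite -subr_eq0 -normc_eq0 eq_le ge0_normc andbT.
by apply: (clim_le (K := 0) (climB ul uk)) => i _; rewrite subrr normc0.
Qed.

(** The derivative p t^(p-1) is at most p M^(p-1) on [0, M]. *)
Lemma powR_lipschitz (p M x y : R) : 1 < p -> 0 <= x <= M -> 0 <= y <= M ->
  `|x `^ p - y `^ p| <= p * M `^ (p - 1) * `|x - y|.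
Proof.
move=> p1; wlog yx : x y / y <= x.
  move=> H xM yM; have [/H|/ltW/H] := leP y x; first exact.
  by rewrite distrC [X in _ * X]distrC; apply.
move=> /andP[x0 xM] /andP[y0 yM].
have p0 : 0 < p by lra.
rewrite !ger0_norm ?subr_ge0//; last by apply: ler_powRl => //; lra.
have [x00|xn0] := eqVneq x 0.
  have -> : y = x by lra.
  by rewrite !subrr mulr0.
have xp : 0 < x by lra.
have := powR_tangent p1 y0 xp.
have : x `^ (p - 1) <= M `^ (p - 1) by apply: ler_powRl; lra.
move: (x `^ (p - 1)) (M `^ (p - 1)) (x `^ p) (y `^ p) => a b X Y ab H.
have : (p * (x - y)) * a <= (p * (x - y)) * b by rewrite ler_wpM2l// mulr_ge0//; lra.
lra.
Qed.

End Sequences.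

(** * Bounds uniform in the function *)

Section BergmanBounds.
Context {R : realType} {n : nat}.
Local Open Scope complex_scope.
Local Notation RB := (measurableTypeR R).
Local Notation lebT := (@lebesgue_tuple R (n + n)).
Local Notation Cn := 'rV[R[i]]_n.
Implicit Types (f g : Cn -> R[i]) (z w : Cn) (q r : R).
Import Normc.
Variables (Omega : set Cn) (p : R).
Hypotheses (oO : open Omega) (bO : bounded_set Omega) (p1 : 1 < p).
Local Notation deep := (deep Omega).
Local Notation qbox := (@qbox R n).

Let p0 : 0 < p. Proof. exact: lt_trans ltr01 p1. Qed.

Lemma qbox_coordset r z : 0 <= r -> deep r z -> qbox r z `<=` coordset Omega.
Proof. by move=> r0 dz t /(qbox_near r0)/dz. Qed.

Lemma integral_qbox_le r z f : 0 <= r -> deep r z -> bergman_space p Omega f ->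
  (\int[lebT]_(t in qbox r z) (normc (f (cpt t)) `^ p)%:E <= (pint Omega p f)%:E)%E.
Proof.
move=> r0 dz bf; have [_ _ ff] := bf; rewrite -(pintE ff).
apply: ge0_subset_integral.
- exact: measurable_qbox.
- exact: measurable_coordset.
- by apply: measurable_funTS; apply: (measurable_normcX oO); exact: bergman_holo0 bf.
- by move=> t _; rewrite lee_fin powR_ge0.
- exact: qbox_coordset.
Qed.

Lemma sup_bound r : 0 < r -> exists2 C, 0 < C & forall f z (N : R),
  bergman_space p Omega f -> deep r z -> pint Omega p f <= N -> normc (f z) <= C * (1 + N).
Proof.
move=> r0; have [C C0 H] := submean_q oO r0; exists C => // f z N bf dz fN.
have := H f z p 1 N (bergman_holo0 bf) dz (ltW p1) ltr01; rewrite powR1 mul1r; apply.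
apply: le_trans (integral_qbox_le (ltW r0) dz bf) _; by rewrite lee_fin.
Qed.

Lemma ball_bound r : 0 < r -> exists2 C, 0 < C & forall f z (N : R),
  bergman_space p Omega f -> deep (r + r) z -> pint Omega p f <= N -> holo_ball f z r (C * (1 + N)).
Proof.
move=> r0; have [C C0 H] := sup_bound r0; exists C => // f z N bf dz fN w wz.
have dw := deep_sub wz dz; split; last exact: H.
by have [hf _ _] := bf; apply: hf; exact: deep_in (ltW r0) dw.
Qed.

(** A function with value 1 at z cannot have a small integral near z, by the
    mean value inequality; d is chosen so that the term C d equals 1/2. *)
Lemma minp_lower r : 0 < r -> exists2 c, 0 < c & forall z, deep r z -> c <= minp Omega p z.
Proof.
move=> r0; have [C C0 H] := submean_q oO r0.
pose d := (2 * C)^-1; have d0 : 0 < d by rewrite invr_gt0 mulr_gt0.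
have D0 : 0 < d `^ (1 - p) by rewrite powR_gt0.
exists (2 * C * d `^ (1 - p))^-1; first by rewrite invr_gt0 !mulr_gt0.
move=> z dz; rewrite leNgt; apply/negP => ltc.
have Oz := deep_in (ltW r0) dz.
have [f [bf fz] fe] := @minp_approx R n Omega p oO bO p1 z ((2 * C * d `^ (1 - p))^-1 - minp Omega p z) Oz ltac:(by rewrite subr_gt0).
have {fe} : pint Omega p f < (2 * C * d `^ (1 - p))^-1 by rewrite subrKC in fe.
have := H f z p d _ (bergman_holo0 bf) dz (ltW p1) d0 (integral_qbox_le (ltW r0) dz bf).
have Cd : C * d = 2^-1 by rewrite /d; field; rewrite gt_eqF.
rewrite fz normc1 mulrDr Cd; move: (pint _ _ _) (d `^ (1 - p)) D0 => x D D0 A.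
have key : 1 <= x * (2 * C * D).
  have -> : x * (2 * C * D) = 2 * (C * (D * x)) by ring.
  by move: (C * _) A => y; lra.
by rewrite -div1r ltr_pdivlMr ?mulr_gt0// ltNge key.
Qed.

Lemma minp_vol z : Omega z -> minp Omega p z <= vol Omega.
Proof.
move=> Oz; have := minp_le oO bO p1 Oz (bergman_one p oO bO Oz).
by rewrite /pint (integral_one p oO bO).
Qed.

(** Wherever the pointwise defect controls |f - g|^q, its integral does as
    well; the latter is what a minimizer makes small. *)
Lemma integral_defect_le (A : set ((n + n).-tuple RB)) f g (c q : R) :
  bergman_space p Omega f -> bergman_space p Omega g -> measurable A -> A `<=` coordset Omega -> 0 < c ->
  (forall t, A t -> c * normc (f (cpt t) - g (cpt t)) `^ q <= defect p (f (cpt t)) (g (cpt t))) ->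
  (\int[lebT]_(t in A) (normc (f (cpt t) - g (cpt t)) `^ q)%:E <=
    ((pint Omega p f + pint Omega p g - 2 * pint Omega p (midp f g)) / c)%:E)%E.
Proof.
move=> bf bg mA AO c0 H; have [bm E] := integral_defect oO p1 bf bg.
have hf := bergman_holo0 bf; have hg := bergman_holo0 bg; have hm := bergman_holo0 bm.
have mdef : measurable_fun setT (fun t : (n + n).-tuple RB => (defect p (f (cpt t)) (g (cpt t)))%:E).
  have /measurable_EFinP mf := measurable_normcX oO p hf.
  have /measurable_EFinP mg := measurable_normcX oO p hg.
  have /measurable_EFinP mm := measurable_normcX oO p hm.
  apply/measurable_EFinP; rewrite /defect.
  under eq_fun do rewrite -normc_half.
  apply: measurable_funB; first exact: measurable_funD.
  by apply: measurable_funM => //; exact: measurable_cst.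
have mB := measurable_normcX oO q (holo0B hf hg).
have : (c%:E * \int[lebT]_(t in A) (normc (f (cpt t) - g (cpt t)) `^ q)%:E <=
   (pint Omega p f + pint Omega p g - 2 * pint Omega p (midp f g))%:E)%E.
  rewrite -E -ge0_integralZl//; last 3 first.
  - exact: measurable_funTS.
  - by move=> t _; rewrite lee_fin powR_ge0.
  - by rewrite lee_fin ltW.
  apply: (@le_trans _ _ (\int[lebT]_(t in A) (defect p (f (cpt t)) (g (cpt t)))%:E)%E).
    apply: ge0_le_integral => //.
    - by move=> t _; rewrite -EFinM lee_fin mulr_ge0 ?powR_ge0 ?ltW.
    - by apply: measurable_funTS; exact: measurable_funeM.
    - exact: measurable_funTS.
  apply: ge0_subset_integral => //.
  - exact: measurable_coordset.
  - exact: measurable_funTS.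
  - by move=> t _; rewrite lee_fin defect_ge0// ltW.
move: (_ - _) (\int[lebT]_(t in A) _)%E => y [x||].
- by rewrite -EFinM !lee_fin ler_pdivlMr// mulrC.
- by rewrite gt0_muley ?lte_fin.
- by rewrite leNye.
Qed.

End BergmanBounds.

(** * Existence of minimizers *)

Section Minimizer.
Context {R : realType} {n : nat}.
Local Open Scope complex_scope.
Local Notation RB := (measurableTypeR R).
Local Notation lebT := (@lebesgue_tuple R (n + n)).
Local Notation Cn := 'rV[R[i]]_n.
Implicit Types (f g : Cn -> R[i]) (z w : Cn) (q r e : R).
Import Normc.

Lemma deep_open (Omega : set Cn) z : open Omega -> Omega z -> exists2 r, 0 < r & deep Omega r z.
Proof. exact: open_nrmP. Qed.

Section Limit.
Variables (Omega : set Cn) (f : nat -> Cn -> R[i]) (g : Cn -> R[i]).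
Hypotheses (oO : open Omega) (hf : forall k, holo0 Omega (f k))
  (bf : forall r, 0 < r -> exists M, forall k z, deep Omega r z -> normc (f k z) <= M)
  (ug : forall r, 0 < r -> forall e, 0 < e -> exists K : nat, forall k z, (K <= k)%N -> deep Omega r z -> normc (f k z - g z) <= e).

(** Differentials of the f_k converge by Cauchy's estimate, and the second
    order Taylor bound, being uniform in k, passes to the limit: it exhibits
    the limit of the differentials as the differential of the limit. *)
Lemma holomorphic_limit : holomorphic Omega g.
Proof.
move=> v Ov; have [R0 R00 dR] := deep_open oO Ov.
pose r := R0 / 2; have r0 : 0 < r by rewrite divr_gt0.
have rr : r + r = R0 by rewrite /r; field.
have dv : deep Omega (r + r) v by rewrite rr.
have [M HM] := bf r0.
have cg w : deep Omega r w -> clim (fun k => f k w) (g w).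
  by move=> dw e e0; have [K HK] := ug r0 e0; exists K => k Kk; exact: HK.
have M0 : 0 <= M.
  by apply: le_trans (HM 0%N v (deep_sub _ dv)); rewrite ?ge0_normc// subrr nrm0 ltW.
have ball k : holo_ball (f k) v r M.
  move=> w wv; have dw := deep_sub wv dv; split; last exact: HM.
  by apply: (hf k).1; exact: deep_in (ltW r0) dw.
have /choice[L HL] : forall h, exists l, clim (fun k => 'd (f k) v h : R[i]) l.
  move=> h; apply: clim_cauchy => e e0; have h0 := nrm_ge0 h.
  pose e' := e * r / (16 * (1 + nrm h)).
  have h1 : 0 < 16 * (1 + nrm h) by rewrite mulr_gt0// ltr_pwDl.
  have e'0 : 0 < e' by rewrite divr_gt0// mulr_gt0.
  have [K HK] := ug r0 (divr_gt0 e'0 (ltr0n R 2)); exists K => k l Kk Kl.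
  have B w : nrm (w - v) <= r -> [/\ differentiable (f k) w, differentiable (f l) w & normc (f k w - f l w) <= e'].
    move=> wv; have [dk _] := ball k w wv; have [dl _] := ball l w wv; have dw := deep_sub wv dv.
    split=> //.
    have := HK k w Kk dw; have := HK l w Kl dw.
    have -> : f k w - f l w = (f k w - g w) - (f l w - g w) by rewrite opprB addrA subrK.
    by have := normcB (f k w - g w) (f l w - g w); lra.
  apply: le_trans (ball_cauchyB h r0 B) _.
  have -> : 16 * e' / r * nrm h = e * (nrm h / (1 + nrm h)) by rewrite /e'; field; rewrite !gt_eqF// ltr_pwDl.
  by rewrite ger_pMr// ler_pdivrMr ?mul1r ?lerDr// ltr_pwDl.
have Llin : linear (L : Cn -> R[i]).
  move=> a x y; apply: clim_unique (HL _) _.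
  have := climD (climZ a (HL x)) (HL y).
  by under eq_fun do rewrite -[_ * _]/(a *: ('d (f _) v x : R[i])) -linearP.
pose L' : {linear Cn -> R[i]} := HB.pack (L : Cn -> R[i]) (GRing.isLinear.Build _ _ _ _ _ Llin).
apply: (@nrm_differentiable _ _ g v L' (16 * M / r) _ _).1.
  by move=> h; apply: (clim_le (K := 0) (HL h)) => k _; exact: ball_cauchy.
have [A A0 HA] : exists2 A, 0 <= A & forall k h, 6 * nrm h <= r ->
    normc (f k (v + h) - f k v - 'd (f k) v h) <= A * nrm h ^+ 2.
  exists (96 ^+ 2 * M / r ^+ 2) => [|k h hr]; first exact: divr_ge0 (mulr_ge0 (sqr_ge0 (96 : R)) M0) (exprn_ge0 2 (ltW r0)).
  exact: (ball_taylor r0 (ball k) hr).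
move=> e e0.
pose d := Num.min (r / 6) (e / (1 + A)).
have d0 : 0 < d by rewrite lt_min !divr_gt0// ltr_pwDl.
exists d => // h; rewrite le_min => /andP[hr he].
have hr6 : 6 * nrm h <= r by rewrite mulrC -ler_pdivlMr.
have T : normc (g (v + h) - g v - L h) <= A * nrm h ^+ 2.
  have dh : deep Omega r (v + h).
    by apply: deep_sub dv; rewrite addrAC subrr add0r; have := nrm_ge0 h; lra.
  have dv' : deep Omega r v by apply: deep_le dv; lra.
  apply: (clim_le (K := 0) (climB (climB (cg _ dh) (cg _ dv')) (HL h))) => k _.
  exact: HA.
apply: le_trans T _; rewrite expr2 mulrA ler_wpM2r ?nrm_ge0//.
have : nrm h * (1 + A) <= e by rewrite -ler_pdivlMr// ltr_pwDl.
have := nrm_ge0 h; rewrite mulrDr mulr1 mulrC; lra.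
Qed.

End Limit.

Variables (Omega : set Cn) (p : R).
Hypotheses (oO : open Omega) (bO : bounded_set Omega) (p1 : 1 < p).
Local Notation deep := (deep Omega).

Let p0 : 0 < p. Proof. exact: lt_trans ltr01 p1. Qed.

(** Two almost minimizers have a small defect integral, because their midpoint
    is admissible and cannot go below the minimum. Uniform convexity makes them
    close in L^q on cubes, and the mean value inequality makes them close
    uniformly. *)
Lemma minimizing_cauchy z (N : R) r : Omega z -> 0 < r -> 0 <= N ->
  forall e, 0 < e -> exists2 d, 0 < d & forall f g w,
    bergman_admissible p Omega z f -> bergman_admissible p Omega z g ->
    pint Omega p f <= N -> pint Omega p g <= N ->
    pint Omega p f <= minp Omega p z + d -> pint Omega p g <= minp Omega p z + d ->
    deep r w -> normc (f w - g w) <= e.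
Proof.
have key (u v y m d : R) : u <= m + d -> v <= m + d -> m <= y -> u + v - 2 * y <= 2 * d by lra.
move=> Oz r0 N0 e e0; pose s := r / 2; have s0 : 0 < s by rewrite divr_gt0.
have ss : s + s = r by rewrite /s; field.
have [C C0 HC] := sup_bound oO p1 s0.
have M0 : 0 < C * (1 + N) by rewrite mulr_gt0// ltr_pwDl.
have [c c0 Hc] := defect_uniform p1 M0.
have [C' C'0 HC'] := submean_q oO s0.
pose q := Num.max 2 p; have q1 : 1 <= q by rewrite le_max ler1n.
(* with this x the first term of submean_q is e/2, and the bound d on the
   excess over the minimum makes the second e/2 as well *)
pose x := e / (2 * C'); have x0 : 0 < x by rewrite divr_gt0// mulr_gt0.
have X0 : 0 < x `^ (1 - q) by rewrite powR_gt0.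
exists (x * c / (2 * x `^ (1 - q))); first by apply: divr_gt0; apply: mulr_gt0.
set d := x * c / _ => f g w [bf fz] [bg gz] fN gN fd gd dw.
have hf := bergman_holo0 bf; have hg := bergman_holo0 bg.
have dw' : deep (s + s) w by rewrite ss.
have dws : deep s w by apply: deep_le dw; rewrite -ss lerDl ltW.
have near t : qbox s w t -> deep s (cpt t) by move=> /(qbox_near (ltW s0)) tw; exact: deep_sub dw'.
have [bm _] := integral_defect oO p1 bf bg.
have am : bergman_admissible p Omega z (midp f g).
  by split=> //; rewrite /midp fz gz -[1 + 1]/(2%:R) mulVf// pnatr_eq0.
have mm := minp_le oO bO p1 Oz am.
have E : (pint Omega p f + pint Omega p g - 2 * pint Omega p (midp f g)) / c <= 2 * d / c.
  rewrite ler_pM2r ?invr_gt0//; exact: key fd gd mm.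
have I : (\int[lebT]_(t in qbox s w) (normc (f (cpt t) - g (cpt t)) `^ q)%:E <= (2 * d / c)%:E)%E.
  apply: (@le_trans _ _ ((pint Omega p f + pint Omega p g - 2 * pint Omega p (midp f g)) / c)%:E); last by rewrite lee_fin.
  apply: (@integral_defect_le R n Omega p oO p1) => //.
  - exact: measurable_qbox.
  - exact: qbox_coordset (ltW s0) dws.
  - by move=> t /near dt; apply: Hc; [exact: HC bf dt fN|exact: HC bg dt gN].
have := HC' (fun w => f w - g w) w q x _ (holo0B hf hg) dws q1 x0 I.
have -> : C' * (x + x `^ (1 - q) * (2 * d / c)) = e; last by [].
by rewrite /d; move: (x `^ (1 - q)) X0 => X X0; rewrite /x; field; rewrite !gt_eqF.
Qed.

(** Fatou's lemma for |f_k|^p; the pointwise limits exist because f_k converges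
    at every point of Omega. *)
Lemma fatou_powR (f : nat -> Cn -> R[i]) g (m : R) :
  (forall k, bergman_space p Omega (f k)) ->
  (forall z, Omega z -> clim (fun k => f k z) (g z)) ->
  (forall k, m <= pint Omega p (f k) <= m + k.+1%:R^-1) ->
  (integral_normp p Omega g <= m%:E)%E.
Proof.
move=> bf cg fm.
pose F k (t : (n + n).-tuple RB) := (normc (f k (cpt t)) `^ p)%:E.
have mF k : measurable_fun (coordset Omega) (F k).
  by apply: measurable_funTS; apply: (measurable_normcX oO); exact: bergman_holo0 (bf k).
have F0 k t : coordset Omega t -> (0 <= F k t)%E by move=> _; rewrite lee_fin powR_ge0.
have := fatou lebT (measurable_coordset oO) mF F0.
have -> : limn_einf (fun k => \int[lebT]_(t in coordset Omega) F k t)%E = m%:E.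
  apply: (cvg_limn_einf_sup _).1.
  have -> : (fun k => \int[lebT]_(t in coordset Omega) F k t)%E = (fun k => (pint Omega p (f k))%:E).
    by apply/funext => k; rewrite -(pintE (let: And3 _ _ h := bf k in h)) integral_normpE.
  apply: cvg_EFin; first by near=> k.
  apply: (@squeeze_cvgr _ _ _ _ (fun=> m) (fun k => m + k.+1%:R^-1)); first by near=> k; exact: fm.
    exact: cvg_cst.
  rewrite -[X in _ --> X]addr0; apply: cvgD; first exact: cvg_cst.
  exact: cvg_harmonic.
rewrite integral_normpE (eq_integral (fun t => (normc (g (cpt t)) `^ p)%:E))// => t.
rewrite inE => /cg cgt; apply: (cvg_limn_einf_sup _).1.
apply: cvg_EFin; first by near=> k.
apply/cvgrPdist_le => e e0.
have [K1 HK1] := cgt 1 ltr01.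
pose M := normc (g (cpt t)) + 1; have g0 := ge0_normc (g (cpt t)).
pose A := p * M `^ (p - 1); have A0 : 0 <= A by rewrite mulr_ge0 ?powR_ge0// ltW.
have [K2 HK2] := cgt (e / (1 + A)) ltac:(by rewrite divr_gt0// ltr_pwDl).
exists (maxn K1 K2) => // k /=; rewrite geq_max => /andP[/HK1 H1 /HK2 H2].
have D : `|normc (g (cpt t)) - normc (f k (cpt t))| <= normc (f k (cpt t) - g (cpt t)).
  have := normcD (f k (cpt t) - g (cpt t)) (g (cpt t)); rewrite subrK.
  have := normcD (g (cpt t) - f k (cpt t)) (f k (cpt t)); rewrite subrK [normc (g _ - _)]distcC.
  by rewrite ler_norml; lra.
have f0 := ge0_normc (f k (cpt t)).
have fM : normc (f k (cpt t)) <= M by move: D H1; rewrite /M ler_norml; lra.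
apply: (le_trans (@powR_lipschitz _ p M _ _ p1 _ _)).
- by rewrite g0 /M lerDl ler01.
- by rewrite f0.
rewrite -/A; apply: (@le_trans _ _ (A * (e / (1 + A)))); first by rewrite ler_wpM2l// (le_trans D).
by rewrite mulrCA ger_pMr// ler_pdivrMr ?mul1r ?lerDr// ltr_pwDl.
Unshelve. all: by end_near.
Qed.

(** Direct method: a minimizing sequence converges locally uniformly, its limit
    is holomorphic and admissible, and Fatou's lemma bounds its integral. *)
Lemma minimizer_exists z : Omega z ->
  exists2 g, bergman_admissible p Omega z g & pint Omega p g = minp Omega p z.
Proof.
move=> Oz.
have /choice[f Hf] : forall k : nat, exists f, bergman_admissible p Omega z f /\ pint Omega p f <= minp Omega p z + k.+1%:R^-1.
  move=> k; have [f af fk] := minp_approx oO bO p1 Oz (e := k.+1%:R^-1) ltac:(by rewrite invr_gt0 ltr0n).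
  by exists f; split => //; exact: ltW.
have af k := (Hf k).1; have bfk k : bergman_space p Omega (f k) := (af k).1.
have fk k := (Hf k).2.
have m0 : 0 <= minp Omega p z by exact: powR_ge0.
pose N := minp Omega p z + 1; have N0 : 0 <= N by rewrite addr_ge0.
have fN k : pint Omega p (f k) <= N.
  by apply: le_trans (fk k) _; rewrite lerD2l invf_le1 ?ler1n ?ltr0n.
have cau r : 0 < r -> forall e, 0 < e -> exists K : nat, forall k l w, (K <= k)%N -> (K <= l)%N -> deep r w ->
    normc (f k w - f l w) <= e.
  move=> r0 e e0; have [d d0 Hd] := minimizing_cauchy Oz r0 N0 e0.
  have [K HK] : exists K : nat, forall k, (K <= k)%N -> k.+1%:R^-1 <= d.
    exists (Num.bound d^-1) => k Kk; rewrite -[d]invrK lef_pV2 ?posrE ?invr_gt0//.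
    apply: ltW; apply: lt_le_trans (archi_boundP _) _; first by rewrite invr_ge0 ltW.
    by rewrite ler_nat; exact: leq_trans Kk _.
  exists K => k l w Kk Kl dw; apply: (Hd (f k) (f l)) => //.
    by apply: le_trans (fk k) _; rewrite lerD2l HK.
  by apply: le_trans (fk l) _; rewrite lerD2l HK.
have /choice[g Hg] : forall w, exists l, (Omega w -> clim (fun k => f k w) l) /\ (~ Omega w -> l = 0).
  move=> w; have [Ow|Ow] := pselect (Omega w); last by exists 0.
  have [r r0 dw] := deep_open oO Ow.
  have [l Hl] : exists l, clim (fun k => f k w) l.
    apply: clim_cauchy => e e0; have [K HK] := cau r r0 e e0.
    by exists K => k l Kk Kl; exact: HK.
  by exists l.
have cg w : Omega w -> clim (fun k => f k w) (g w) by exact: (Hg w).1.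
have hg : holomorphic Omega g.
  apply: (@holomorphic_limit Omega f g oO).
  - by move=> k; exact: bergman_holo0 (bfk k).
  - move=> r r0; have [C C0 HC] := sup_bound oO p1 r0; exists (C * (1 + N)) => k w dw.
    exact: HC (bfk k) dw (fN k).
  - move=> r r0 e e0; have [K HK] := cau r r0 e e0; exists K => k w Kk dw.
    apply: (clim_le (K := K) (climB (clim_cst (f k w)) (cg w (deep_in (ltW r0) dw)))) => l Kl.
    exact: HK.
have Ig := fatou_powR bfk cg (fun k => introT andP (conj (minp_le oO bO p1 Oz (af k)) (fk k))).
have ag : bergman_admissible p Omega z g.
  split; first by split => //; [move=> w; exact: (Hg w).2|exact: le_lt_trans Ig (ltry _)].
  apply: clim_unique (cg z Oz) _; rewrite (_ : (fun k => f k z) = fun=> 1); first exact: clim_cst.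
  by apply/funext => k; exact: (af k).2.
exists g => //; apply/eqP; rewrite eq_le (minp_le oO bO p1 Oz ag) andbT.
by rewrite -lee_fin -(pintE (le_lt_trans Ig (ltry _))).
Qed.

(** The chosen function is a minimizer, since one exists. *)
Lemma bergman_minimizerP z : Omega z ->
  bergman_admissible p Omega z (bergman_minimizer p Omega z) /\
  pint Omega p (bergman_minimizer p Omega z) = minp Omega p z.
Proof.
move=> Oz; set S := [set f | bergman_admissible p Omega z f /\ Lp_norm p Omega f = bergman_min p Omega z].
have : S (xget (fun=> 0) S).
  apply: xgetPex; have [g ag gm] := minimizer_exists Oz; exists g; split => //.
  apply: (powR_injective p0); rewrite ?nnegrE.
  - exact: Lp_norm_ge0.
  - exact: bergman_min_ge0.
  by rewrite (Lp_normX _ p1) gm.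
by move=> [ag gm]; split=> //; rewrite -(Lp_normX _ p1) gm.
Qed.

End Minimizer.

(** * First order expansion of the kernel *)

Section RealFacts.
Context {R : realType}.
Implicit Types x y u v a b c d e E G H p s L : R.

Lemma taylor_arith x y u v : - u <= x - 1 - y -> x <= v -> y - u <= v - 1.
Proof. by lra. Qed.

Lemma lower_arith a b c d p L s E : a * c <= b -> a * (1 + p * (d - L * s)) <= a * c ->
  a * (p * (L * s)) <= E -> p * a * d - E <= b - a.
Proof. by lra. Qed.

Lemma upper_arith a b G E : - G - E <= a - b -> b - a <= G + E.
Proof. by lra. Qed.

Lemma lipschitz_arith a b G H E s c : E <= s -> - c <= G <= c -> - c <= H <= c ->
  b - a <= G + E -> H - E <= b - a -> - (c + s) <= b - a <= c + s.
Proof. by lra. Qed.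

Lemma inv_lipschitz a b L c : 0 < a <= L -> 0 < b <= L -> `|b^-1 - a^-1| <= c ->
  b - a <= L ^+ 2 * c.
Proof.
move=> /andP[a0 aL] /andP[b0 bL] H; have c0 : 0 <= c by apply: le_trans H.
have -> : b - a = b * a * (a^-1 - b^-1) by field; rewrite !gt_eqF.
apply: (@le_trans _ _ (b * a * c)); last by rewrite ler_wpM2r// expr2 ler_pM// ltW.
by rewrite ler_wpM2l ?mulr_ge0 ?(ltW a0) ?(ltW b0)// (le_trans (ler_norm _))// distrC.
Qed.

End RealFacts.

Section KernelGradient.
Context {R : realType} {n : nat}.
Local Open Scope complex_scope.
Local Notation RB := (measurableTypeR R).
Local Notation lebT := (@lebesgue_tuple R (n + n)).
Local Notation Cn := 'rV[R[i]]_n.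
Implicit Types (f g : Cn -> R[i]) (z w h : Cn) (q r : R).
Import Normc.
Variables (Omega : set Cn) (p : R).
Hypotheses (oO : open Omega) (bO : bounded_set Omega) (p1 : 1 < p).
Local Notation deep := (deep Omega).
Local Notation m := (minp Omega p).
Local Notation g := (bergman_minimizer p Omega).

Let p0 : 0 < p. Proof. exact: lt_trans ltr01 p1. Qed.

(** The candidate for the real differential of the kernel at z in the direction
    h, read off from the minimizer at z. *)
Definition bgrad z h : R := p * (m z)^-1 * complex.Re ('d (g z) z h : R[i]).

(** Estimates for the minimizer at z, with one constant L for all points of a
    given depth. *)
Record minimizer_bounds r L z : Prop := MinimizerBounds {
  mb_gt0 : 0 < m z;
  mb_le : m z <= L;
  mb_inv : (m z)^-1 <= L;
  mb_lip : forall h, 16 * nrm h <= r -> normc (g z (z + h) - 1) <= L * nrm h;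
  mb_taylor : forall h, 16 * nrm h <= r -> normc (g z (z + h) - 1 - ('d (g z) z h : R[i])) <= L * nrm h ^+ 2;
  mb_diff : forall h, normc ('d (g z) z h : R[i]) <= L * nrm h;
  mb_diff_lip : forall h e, 16 * nrm h <= r ->
    normc (('d (g z) (z + h) e : R[i]) - 'd (g z) z e) <= L * nrm h * nrm e
}.

Lemma minimizer_bounds_exist r : 0 < r -> exists2 L, 0 < L & forall z, deep r z -> minimizer_bounds r L z.
Proof.
move=> r0; pose s := r / 2; have s0 : 0 < s by rewrite divr_gt0.
have ss : s + s = r by rewrite /s; field.
have [C C0 HC] := ball_bound oO p1 s0.
have [c c0 Hc] := minp_lower oO bO p1 r0.
have [M ME] : exists M, M = C * (1 + vol Omega) by eexists.
have [A1 A1E] : exists A, A = 64 * M / s by eexists.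
have [A2 A2E] : exists A, A = 96 ^+ 2 * M / s ^+ 2 by eexists.
have [A3 A3E] : exists A, A = 16 * M / s by eexists.
have [A4 A4E] : exists A, A = 64 ^+ 2 * M / s ^+ 2 by eexists.
pose L := `|A1| + `|A2| + `|A3| + `|A4| + c^-1 + `|vol Omega|.
have [H1 H2 H3 H4] : [/\ A1 <= L, A2 <= L, A3 <= L & A4 <= L].
  have i0 : 0 <= c^-1 by rewrite invr_ge0 ltW.
  have := ler_norm A1; have := ler_norm A2; have := ler_norm A3; have := ler_norm A4.
  have := normr_ge0 A1; have := normr_ge0 A2; have := normr_ge0 A3; have := normr_ge0 A4.
  have := normr_ge0 (vol Omega).
  rewrite /L; move: `|A1| `|A2| `|A3| `|A4| c^-1 i0 `|vol Omega| => a1 a2 a3 a4 k k0 v.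
  by clear -k0; move=> *; split; lra.
have Lc : c^-1 <= L by rewrite /L -addrA [X in _ <= X]addrCA lerDl !addr_ge0.
have Lv : vol Omega <= L.
  by apply: le_trans (ler_norm _) _; rewrite /L lerDr !addr_ge0// invr_ge0 ltW.
exists L => [|z dz]; first by apply: lt_le_trans Lc; rewrite invr_gt0.
have Oz := deep_in (ltW r0) dz.
have [[bg g1] gm] := bergman_minimizerP oO bO p1 Oz.
have mv : m z <= vol Omega by exact: minp_vol.
have B : holo_ball (g z) z s M by rewrite ME; apply: HC => //; rewrite ?ss// gm.
have mc := Hc z dz; have mz : 0 < m z by exact: lt_le_trans mc.
have hs (k : R) h : 16 * nrm h <= r -> k <= 8 -> k * nrm h <= s.
  move=> hr k8; apply: (@le_trans _ _ (8 * nrm h)); first by rewrite ler_wpM2r ?nrm_ge0.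
  rewrite /s ler_pdivlMr//; apply: le_trans hr; rewrite mulrAC.
  by rewrite -natrM.
split=> //.
- exact: le_trans Lv.
- by apply: le_trans Lc; rewrite lef_pV2.
- move=> h hr; have := ball_lipschitz s0 B (hs 4 h hr ltac:(by rewrite ler_nat)).
  rewrite g1 -A1E => H; apply: le_trans H _; by rewrite ler_wpM2r ?nrm_ge0.
- move=> h hr; have := ball_taylor s0 B (hs 6 h hr ltac:(by rewrite ler_nat)).
  rewrite g1 -A2E => H; apply: le_trans H _; by rewrite ler_wpM2r ?exprn_ge0 ?nrm_ge0.
- move=> h; have := ball_cauchy h s0 B; rewrite -A3E => H; apply: le_trans H _.
  by rewrite ler_wpM2r ?nrm_ge0.
- move=> h e hr; have := ball_diff_lipschitz e s0 B (hs 8 h hr (lexx _)).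
  rewrite -A4E => H; apply: le_trans H _.
  by rewrite -!mulrA ler_wpM2r ?mulr_ge0 ?nrm_ge0.
Qed.

Section Fixed.
Variables (r L : R).
Hypotheses (r0 : 0 < r) (L0 : 0 < L) (HL : forall z, deep r z -> minimizer_bounds r L z).

Let Om z : deep r z -> Omega z. Proof. exact: deep_in (ltW r0). Qed.

Lemma bgrad_le z h : deep r z -> `|bgrad z h| <= p * L ^+ 2 * nrm h.
Proof.
move=> /HL B; rewrite /bgrad normrM (ger0_norm (mulr_ge0 (ltW p0) _)); last by rewrite invr_ge0 ltW// (mb_gt0 B).
rewrite expr2 !mulrA -[X in _ <= X]mulrA; apply: ler_pM.
- by rewrite mulr_ge0 ?invr_ge0 ?ltW// (mb_gt0 B).
- exact: normr_ge0.
- by rewrite ler_pM2l// (mb_inv B).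
- exact: le_trans (normc_Re _) (mb_diff B h).
Qed.

Lemma bgradN z h : bgrad z (- h) = - bgrad z h.
Proof. by rewrite /bgrad linearN raddfN mulrN. Qed.

(** The minimizer at z is a competitor at z + h after rescaling, so K(z + h) >=
    K(z) |g_z(z + h)|^p. Bernoulli's inequality makes the right side linear in
    Re g_z(z + h), and Taylor's bound makes it linear in h. *)
Lemma kernel_lower z h : deep r z -> Omega (z + h) -> 0 < m (z + h) -> 16 * nrm h <= r ->
  bgrad z h - p * L ^+ 2 * nrm h ^+ 2 <= (m (z + h))^-1 - (m z)^-1.
Proof.
move=> dz Ow mw hr; have B := HL dz; have mz := mb_gt0 B.
have [[bg g1] gm] := bergman_minimizerP oO bO p1 (Om dz).
have := point_le oO bO p1 Ow bg; rewrite gm.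
set a := g z (z + h); set D : R[i] := 'd (g z) z h.
have T : normc (a - 1 - D) <= L * nrm h ^+ 2 := mb_taylor B hr.
have H0 := bernoulli_powR (ltW p1) (ge0_normc a).
have Re1 : complex.Re D - L * nrm h ^+ 2 <= normc a - 1.
  have := le_trans (normc_Re _) T; rewrite !raddfB /= ler_norml => /andP[X _].
  exact: taylor_arith X (le_trans (ler_norm _) (normc_Re a)).
move=> H.
have K1 : (m z)^-1 * normc a `^ p <= (m (z + h))^-1.
  by rewrite (ler_pdivrMl _ _ mz) (ler_pdivlMr _ _ mw).
have i0 : 0 <= (m z)^-1 by rewrite invr_ge0 ltW.
have K2 : (m z)^-1 * (1 + p * (complex.Re D - L * nrm h ^+ 2)) <= (m z)^-1 * normc a `^ p.
  by rewrite ler_wpM2l//; apply: le_trans H0; rewrite lerD2l ler_pM2l.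
have K3 : (m z)^-1 * (p * (L * nrm h ^+ 2)) <= p * L ^+ 2 * nrm h ^+ 2.
  have -> : p * L ^+ 2 * nrm h ^+ 2 = L * (p * (L * nrm h ^+ 2)) by ring.
  by rewrite ler_wpM2r ?(mb_inv B)// !mulr_ge0 ?exprn_ge0 ?nrm_ge0 ?ltW.
by rewrite /bgrad -/D; exact: lower_arith K1 K2 K3.
Qed.

(** The lower bound with the two points exchanged. The differential that
    appears is the one at z + h, whence the need to compare it with the one at
    z. *)
Lemma kernel_upper z h : deep r (z + h) -> Omega z -> 0 < m z -> 16 * nrm h <= r ->
  (m (z + h))^-1 - (m z)^-1 <= bgrad (z + h) h + p * L ^+ 2 * nrm h ^+ 2.
Proof.
move=> dw Oz mz hr; have := @kernel_lower (z + h) (- h) dw; rewrite addrK bgradN nrmN => /(_ Oz mz hr).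
exact: upper_arith.
Qed.

Lemma kernel_lipschitz z h : deep r z -> deep r (z + h) -> 16 * nrm h <= r ->
  `|(m (z + h))^-1 - (m z)^-1| <= p * L ^+ 2 * (1 + r) * nrm h.
Proof.
move=> dz dw hr; have Bz := HL dz; have Bw := HL dw.
have lo := kernel_lower dz (Om dw) (mb_gt0 Bw) hr; have up := kernel_upper dw (Om dz) (mb_gt0 Bz) hr.
have gz : - (p * L ^+ 2 * nrm h) <= bgrad z h <= p * L ^+ 2 * nrm h by rewrite -ler_norml; exact: bgrad_le.
have gw : - (p * L ^+ 2 * nrm h) <= bgrad (z + h) h <= p * L ^+ 2 * nrm h by rewrite -ler_norml; exact: bgrad_le.
have h0 := nrm_ge0 h.
have hh : p * L ^+ 2 * nrm h ^+ 2 <= p * L ^+ 2 * r * nrm h.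
  have hh0 : nrm h ^+ 2 <= r * nrm h.
    by rewrite expr2 ler_wpM2r//; apply: le_trans hr; rewrite ler_peMl// ler1n.
  by rewrite -[leRHS]mulrA; apply: ler_wpM2l hh0; rewrite mulr_ge0 ?exprn_ge0// ltW.
rewrite [p * _ * (1 + r)]mulrDr mulr1 [(_ + _) * nrm h]mulrDl ler_norml.
exact: lipschitz_arith hh gw gz up lo.
Qed.

Lemma minp_lipschitz z h : deep r z -> deep r (z + h) -> 16 * nrm h <= r ->
  m (z + h) - m z <= L ^+ 2 * (p * L ^+ 2 * (1 + r)) * nrm h.
Proof.
move=> dz dw hr; have Bz := HL dz; have Bw := HL dw.
rewrite -mulrA; apply: inv_lipschitz; last exact: kernel_lipschitz.
- by rewrite (mb_gt0 Bz) (mb_le Bz).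
- by rewrite (mb_gt0 Bw) (mb_le Bw).
Qed.

End Fixed.
End KernelGradient.

(** * Hoelder dependence of the minimizers *)

Section RealFacts2.
Context {R : realType}.
Implicit Types x y a b c d k s L p : R.

Lemma energy_arith a b x k c p L : 2 * (a * (1 + p * (- (k / 2)))) <= 2 * x -> b - a <= c ->
  a * (p * k) <= L -> a + b - 2 * x <= c + L.
Proof. by lra. Qed.

Lemma prod_diff_le k k' a a' d d' x y : 0 <= k' -> 0 <= y ->
  k' <= x -> `|a| <= y -> `|a' - a| <= d -> `|k' - k| <= d' -> 0 <= d -> 
  `|k' * a' - k * a| <= x * d + d' * y.
Proof.
move=> k0 y0 kx ay ad kd d0; have -> : k' * a' - k * a = k' * (a' - a) + (k' - k) * a by ring.
apply: le_trans (ler_normD _ _) _; rewrite !normrM; apply: lerD; apply: ler_pM => //.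
by rewrite ger0_norm.
Qed.

Lemma sandwich_arith a b G H c d : G - c <= b - a -> b - a <= H + c -> `|H - G| <= d -> 0 <= d ->
  `|b - a - G| <= d + c.
Proof. by move=> h1 h2; rewrite !ler_norml => h3 d0; lra. Qed.

Lemma normc_chain (u v w : R[i]) a b : Normc.normc (u - v) <= a -> Normc.normc (u - w) <= b ->
  Normc.normc (v - w) <= a + b.
Proof.
rewrite distcC => ua ub; have -> : v - w = (v - u) + (u - w) by rewrite subrKA.
by apply: le_trans (normcD _ _) _; exact: lerD.
Qed.

End RealFacts2.

Section KernelHolder.
Context {R : realType} {n : nat}.
Local Open Scope complex_scope.
Local Notation RB := (measurableTypeR R).
Local Notation lebT := (@lebesgue_tuple R (n + n)).
Local Notation Cn := 'rV[R[i]]_n.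
Implicit Types (f g : Cn -> R[i]) (z w h : Cn) (q r : R).
Import Normc.
Variables (Omega : set Cn) (p : R).
Hypotheses (oO : open Omega) (bO : bounded_set Omega) (p1 : 1 < p).
Local Notation deep := (deep Omega).
Local Notation m := (minp Omega p).
Local Notation g := (bergman_minimizer p Omega).
Local Notation bgrad := (bgrad Omega p).

Let p0 : 0 < p. Proof. exact: lt_trans ltr01 p1. Qed.

Section Fixed.
Variables (r L rho : R).
Hypotheses (r0 : 0 < r) (L0 : 0 < L) (HL : forall z, deep r z -> minimizer_bounds Omega p r L z).
Hypotheses (rho0 : 0 < rho) (rho1 : rho <= 1) (rhor : 32 * rho <= r) (rhoL : 8 * (L * rho) <= 1).

Let Om z : deep r z -> Omega z. Proof. exact: deep_in (ltW r0). Qed.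

Let small (k x : R) : x <= k * rho -> 0 <= k <= 2 -> 16 * x <= r.
Proof.
move=> xk /andP[k0 k2]; apply: le_trans rhor; have -> : 32 * rho = 16 * (2 * rho) by ring.
rewrite ler_wpM2l//; apply: le_trans xk _; by rewrite ler_wpM2r// ltW.
Qed.

(** Both minimizers take the value 1 close to z, so both stay in the region
    where the defect is quadratically convex. *)
Lemma minimizer_near1 z t : deep r z -> nrm (t - z) <= 2 * rho -> normc (g z t - 1) <= 4^-1.
Proof.
move=> /HL B tz; have := mb_lip B (small tz _); rewrite subrKC => /(_ ltac:(by rewrite ler0n lexx)) H.
apply: le_trans H _; apply: (@le_trans _ _ (L * (2 * rho))); first by rewrite ler_pM2l.
have -> : L * (2 * rho) = 8 * (L * rho) / 4 by field.
by rewrite ler_pdivrMr// mulVf.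
Qed.

(** The midpoint of the minimizers at z and z + h takes at z a value within
    O(|h|) of 1, so its integral is at least m(z) - O(|h|); and m is
    Lipschitz. *)
Lemma pint_midp_energy z h : deep r z -> deep r (z + h) -> nrm h <= rho ->
  m z + m (z + h) - 2 * pint Omega p (midp (g z) (g (z + h))) <=
  (L ^+ 2 * (p * L ^+ 2 * (1 + r)) + p * L ^+ 2) * nrm h.
Proof.
move=> dz dw hr; have Bz := HL dz; have Bw := HL dw.
have hr16 : 16 * nrm h <= r by apply: (@small 1); rewrite ?mul1r// ler01 ler1n.
have [[bg g1] _] := bergman_minimizerP oO bO p1 (Om dz).
have [[bw w1] _] := bergman_minimizerP oO bO p1 (Om dw).
have [bm _] := integral_defect oO p1 bg bw.
have k0 : 0 <= L * nrm h by rewrite mulr_ge0 ?nrm_ge0// ltW.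
have D : 1 - L * nrm h / 2 <= normc (midp (g z) (g (z + h)) z).
  have E : midp (g z) (g (z + h)) z - 1 = 2^-1 * (g (z + h) z - 1).
    by rewrite /midp g1; field.
  have N : normc (g (z + h) z - 1) <= L * nrm h.
    by have := mb_lip Bw (h := - h); rewrite addrK nrmN => /(_ hr16).
  have : normc (midp (g z) (g (z + h)) z - 1) <= L * nrm h / 2 by rewrite E normc_half ler_pM2r.
  have := normcD (midp (g z) (g (z + h)) z) (1 - midp (g z) (g (z + h)) z).
  rewrite subrKC normc1 [X in _ + X]distcC; move: (normc (_ - 1)) (normc _) (L * nrm h) => x y k.
  by rewrite lerBlDr => ? ?; apply: le_trans (lerD (lexx _) _); [eassumption|].
have I := point_le oO bO p1 (Om dz) bm.
have mz := mb_gt0 Bz.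
rewrite [leRHS]mulrDl; apply: (@energy_arith R _ _ _ (L * nrm h) _ p).
- rewrite ler_pM2l//; apply: le_trans I; rewrite [leRHS]mulrC ler_pM2l//.
  apply: le_trans (bernoulli_powR (ltW p1) (ge0_normc _)); rewrite lerD2l ler_pM2l//.
  by rewrite lerBrDr addrC.
- exact: (minp_lipschitz oO bO p1 r0 L0 HL dz dw hr16).
- have -> : p * L ^+ 2 * nrm h = L * (p * (L * nrm h)) by ring.
  by rewrite ler_wpM2r ?(mb_le Bz)// mulr_ge0// ltW.
Qed.

(** The defect integral is O(|h|) and controls the L^2 norm of the difference
    of the minimizers on a cube. The mean value inequality with d = |h|^(1/2)
    makes both terms d and |h|/d equal to |h|^(1/2). *)
Lemma minimizers_close : exists2 C, 0 < C & forall z h u, deep r z -> deep r (z + h) -> nrm h <= rho ->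
  nrm (u - z) <= rho / 2 -> normc (g (z + h) u - g z u) <= C * Num.sqrt (nrm h).
Proof.
pose s := rho / 2; have s0 : 0 < s by rewrite divr_gt0.
have ss : s + s = rho by rewrite /s; field.
have [C C0 HC] := submean_q oO s0.
have [c c0 Hc] := defect_near1 p1.
have [A AE] : exists A, A = L ^+ 2 * (p * L ^+ 2 * (1 + r)) + p * L ^+ 2 by eexists.
have A0 : 0 < A by rewrite AE addr_gt0 ?mulr_gt0 ?exprn_gt0 ?addr_gt0.
exists (C * (1 + A / c)); first by rewrite mulr_gt0// addr_gt0// divr_gt0.
move=> z h u dz dw hr uz; have [h0|h0] := eqVneq (nrm h) 0.
  by rewrite (nrm_eq0 h0) addr0 subrr normc0 mulr_ge0 ?sqrtr_ge0// mulr_ge0 ?addr_ge0 ?divr_ge0 ?ltW.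
have {}h0 : 0 < nrm h by rewrite lt_def h0 nrm_ge0.
have [[bz z1] Ez] := bergman_minimizerP oO bO p1 (Om dz).
have [[bw w1] Ew] := bergman_minimizerP oO bO p1 (Om dw).
have rr : rho <= r by apply: le_trans rhor; rewrite ler_peMl ?ler1n// ltW.
have drho : deep rho z by apply: deep_le dz.
have du : deep s u by apply: deep_sub uz _; rewrite -/s ss.
have near t : qbox s u t -> nrm (cpt t - z) <= rho.
  move=> /(qbox_near (ltW s0)) tu; have -> : cpt t - z = (cpt t - u) + (u - z) by rewrite subrKA.
  by apply: le_trans (nrmD _ _) _; rewrite -ss lerD.
have nearw t : qbox s u t -> nrm (cpt t - (z + h)) <= 2 * rho.
  move=> /near tz; rewrite opprD addrA; apply: le_trans (nrmD _ _) _; rewrite nrmN mulr_natl mulr2n.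
  exact: lerD.
have I := @integral_defect_le R n Omega p oO p1 (qbox s u) (g (z + h)) (g z) c 2 bw bz
  (measurable_qbox _ _) (qbox_coordset (ltW s0) du) c0.
have {}I := I _.
set d := Num.sqrt (nrm h); have d0 : 0 < d by rewrite sqrtr_gt0.
have dd : d ^+ 2 = nrm h by rewrite sqr_sqrtr// ltW.
have := HC (fun v => g (z + h) v - g z v) u 2 d (A * nrm h / c)
  (holo0B (bergman_holo0 bw) (bergman_holo0 bz)) du ltac:(by rewrite ler1n) d0.
have -> : C * (d + d `^ (1 - 2) * (A * nrm h / c)) = C * (1 + A / c) * d.
  have -> : (1 - 2 : R) = -1 by ring.
  rewrite powR_inv1 ?(ltW d0)// -dd; field; by rewrite !gt_eqF.
apply; apply: le_trans (I _) _.
  move=> t ut; rewrite powR_mulrn ?ge0_normc//; apply: Hc.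
    exact: minimizer_near1 dw (nearw t ut).
  apply: minimizer_near1 dz _; apply: le_trans (near t ut) _.
  by rewrite ler_peMl ?ler1n// ltW.
rewrite lee_fin ler_pM2r ?invr_gt0// Ez Ew AE /midp.
under eq_fun do rewrite addrC.
by rewrite [m (z + h) + _]addrC; exact: pint_midp_energy.
Qed.

(** Cauchy's estimate turns the uniform bound for g_(z+h) - g_z into one for
    the differentials at z; moving the base point from z to z + h costs
    O(|h|). *)
Lemma bgrad_holder : exists2 C, 0 < C & forall z h e, deep r z -> deep r (z + h) -> nrm h <= rho / 2 ->
  `|bgrad (z + h) e - bgrad z e| <= C * Num.sqrt (nrm h) * nrm e.
Proof.
have [C C0 HC] := minimizers_close.
pose B := L + 16 * C / (rho / 2).
have B0 : 0 < B by rewrite addr_gt0// divr_gt0 ?mulr_gt0 ?divr_gt0.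
have [A AE] : exists A, A = p * L ^+ 2 * (1 + r) by eexists.
have A0 : 0 < A by rewrite AE mulr_gt0 ?addr_gt0// mulr_gt0// exprn_gt0.
exists (p * (L * B + A * L)); first by rewrite mulr_gt0// addr_gt0// mulr_gt0.
move=> z h e dz dw hr2.
have hr : nrm h <= rho by apply: le_trans hr2 _; rewrite ler_pdivrMr// ler_peMr ?ler1n// ltW.
have hr16 : 16 * nrm h <= r by apply: (@small 1); rewrite ?mul1r// ler01 ler1n.
have Bz := HL dz; have Bw := HL dw.
have [[bz z1] Ez] := bergman_minimizerP oO bO p1 (Om dz).
have [[bw w1] Ew] := bergman_minimizerP oO bO p1 (Om dw).
have rr : rho / 2 <= r.
  apply: le_trans rhor; rewrite ler_pdivrMr// mulrAC ler_peMl ?(ltW rho0)//.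
  by rewrite -natrM ler1n.
set d := Num.sqrt (nrm h); have d0 : 0 <= d by exact: sqrtr_ge0.
have hd : nrm h <= d.
  rewrite -{1}[nrm h]sqr_sqrtr ?nrm_ge0// -/d expr2 ler_piMr//.
  by rewrite -sqrtr1 ler_sqrt// (le_trans hr).
have e0 := nrm_ge0 e.
have D1 : normc ('d (g (z + h)) z e - 'd (g z) z e : R[i]) <= 16 * C / (rho / 2) * d * nrm e.
  have := @ball_cauchyB R _ (g (z + h)) (g z) z (rho / 2) (C * d) e ltac:(by rewrite divr_gt0).
  have -> : 16 * (C * d) / (rho / 2) * nrm e = 16 * C / (rho / 2) * d * nrm e by rewrite !mulrA [_ * _ * d * _]mulrAC.
  apply=> u uz; have Ou : Omega u by apply: dz; exact: le_trans rr.
  split; [by case: bw => H _ _; exact: H|by case: bz => H _ _; exact: H|exact: HC].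
have D2 : normc ('d (g (z + h)) z e - 'd (g (z + h)) (z + h) e : R[i]) <= L * d * nrm e.
  have := mb_diff_lip Bw e (h := - h); rewrite addrK nrmN => /(_ hr16) H; apply: le_trans H _.
  by rewrite ler_wpM2r// ler_pM2l.
have D : normc ('d (g (z + h)) (z + h) e - 'd (g z) z e : R[i]) <= B * (d * nrm e).
  by rewrite /B mulrDl !mulrA; exact: (normc_chain D2 D1).
rewrite /bgrad -!mulrA -mulrBr normrM (ger0_norm (ltW p0)) ler_pM2l//.
have := kernel_lipschitz oO bO p1 r0 L0 HL dz dw hr16; rewrite -AE => KK.
have -> : (L * B + A * L) * (d * nrm e) = L * (B * (d * nrm e)) + A * d * (L * nrm e) by ring.
apply: prod_diff_le.
- by rewrite invr_ge0 ltW// (mb_gt0 Bw).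
- by rewrite mulr_ge0// ltW.
- exact: mb_inv Bw.
- exact: le_trans (normc_Re _) (mb_diff Bz e).
- by rewrite -raddfB; exact: le_trans (normc_Re _) D.
- by apply: le_trans KK _; rewrite ler_pM2l.
- by rewrite mulr_ge0 ?mulr_ge0// ltW.
Qed.

(** Lower and upper expansion differ by the Hoelder bound for the candidate
    differential. *)
Lemma kernel_taylor : exists2 C, 0 < C & forall z h, deep r z -> deep r (z + h) -> nrm h <= rho / 2 ->
  `|(m (z + h))^-1 - (m z)^-1 - bgrad z h| <= C * Num.sqrt (nrm h) * nrm h.
Proof.
have [C C0 HC] := bgrad_holder.
pose A := p * L ^+ 2; have A0 : 0 < A by rewrite mulr_gt0// exprn_gt0.
exists (C + A); first by rewrite addr_gt0.
move=> z h dz dw hr2.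
have hr : nrm h <= rho by apply: le_trans hr2 _; rewrite ler_pdivrMr// ler_peMr ?ler1n// ltW.
have hr16 : 16 * nrm h <= r by apply: (@small 1); rewrite ?mul1r// ler01 ler1n.
have Bz := HL dz; have Bw := HL dw.
have H := HC z h h dz dw hr2.
set d := Num.sqrt (nrm h) in H *; have d0 : 0 <= d by exact: sqrtr_ge0.
have hd : nrm h <= d.
  rewrite -{1}[nrm h]sqr_sqrtr ?nrm_ge0// -/d expr2 ler_piMr//.
  by rewrite -sqrtr1 ler_sqrt// (le_trans hr).
have lo := kernel_lower oO bO p1 r0 L0 HL dz (Om dw) (mb_gt0 Bw) hr16.
have up := kernel_upper oO bO p1 r0 L0 HL dw (Om dz) (mb_gt0 Bz) hr16.
rewrite -/A in lo up.
apply: (le_trans (sandwich_arith lo up H _)).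
  by rewrite !mulr_ge0 ?nrm_ge0// ltW.
by rewrite mulrDl mulrDl lerD2l expr2 -mulrA ler_pM2l// ler_wpM2r// nrm_ge0.
Qed.

End Fixed.

(** Differentiability of the kernel with remainder |h|^(3/2) and Hoelder
    continuity of its differential, with constants uniform at depth r. *)
Lemma kernel_gradient r : 0 < r -> exists2 rho, 0 < rho & exists2 C, 0 < C &
  forall z h, deep r z -> deep r (z + h) -> nrm h <= rho ->
  `|(m (z + h))^-1 - (m z)^-1 - bgrad z h| <= C * Num.sqrt (nrm h) * nrm h /\
  forall e, `|bgrad (z + h) e - bgrad z e| <= C * Num.sqrt (nrm h) * nrm e.
Proof.
move=> r0; have [L L0 HL] := minimizer_bounds_exist oO bO p1 r0.
pose rho := Num.min 1 (Num.min (r / 32) (8 * L)^-1).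
have rho0 : 0 < rho by rewrite !lt_min ltr01 divr_gt0//= invr_gt0 mulr_gt0.
have rho1 : rho <= 1 by rewrite ge_min lexx.
have rhor : 32 * rho <= r by rewrite mulrC -ler_pdivlMr// !ge_min lexx orbT.
have rhoL : 8 * (L * rho) <= 1.
  by rewrite mulrA mulrC -ler_pdivlMr ?mulr_gt0// div1r !ge_min lexx !orbT.
have [C C0 HC] := bgrad_holder r0 L0 HL rho0 rho1 rhor rhoL.
have [C' C'0 HC'] := kernel_taylor r0 L0 HL rho0 rho1 rhor rhoL.
exists (rho / 2); first by rewrite divr_gt0.
exists (C + C'); first by rewrite addr_gt0.
move=> z h dz dw hr; split=> [|e].
  apply: le_trans (HC' z h dz dw hr) _.
  by rewrite !ler_wpM2r ?sqrtr_ge0 ?nrm_ge0// lerDr ltW.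
apply: le_trans (HC z h e dz dw hr) _.
by rewrite !ler_wpM2r ?sqrtr_ge0 ?nrm_ge0// lerDl ltW.
Qed.

End KernelHolder.

(** * Partial derivatives *)

Section PartialDerivatives.
Context {R : realType} {n : nat}.
Local Open Scope complex_scope.
Local Notation Cn := 'rV[R[i]]_n.
Implicit Types (u : Cn -> R) (z w h : Cn) (j : 'I_(n + n)) (r e : R).
Import Normc.

(** The direction of the j-th real coordinate axis: a coordinate vector or i
    times one. *)
Definition unit_dir j : Cn := complex_of_coords ((delta_mx ord0 j : 'rV[R]_(n + n)) ord0).

Lemma complex_of_coords_line z j (t : R) :
  complex_of_coords ((t *: delta_mx ord0 j + real_coords z : 'rV[R]_(n + n)) ord0) =
  z + t%:C *: unit_dir j.
Proof.
rewrite -[in RHS](real_coordsK z); apply/rowP => k; rewrite !mxE.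
apply/eqP; rewrite eq_complex /= !mul0r subr0 addr0.
by apply/andP; split; apply/eqP; rewrite addrC.
Qed.

Lemma pderivP u j z (l : R) :
  (forall e, 0 < e -> exists2 d, 0 < d & forall t : R, `|t| <= d ->
    `|u (z + t%:C *: unit_dir j) - u z - l * t| <= e * `|t|) ->
  pderivable j u z /\ pderiv j u z = l.
Proof.
move=> H; pose F (x : 'rV[R]_(n + n)) := u (complex_of_coords (x ord0)).
suff C : (t^-1 *: ((F \o shift (real_coords z)) (t *: delta_mx ord0 j) - F (real_coords z)) @[t --> 0^'] --> l).
  by split; [apply/cvg_ex; exists l|exact: cvg_lim].
apply/cvgrPdist_le => e e0; have [d d0 Hd] := H e e0.
near=> t; have t0 : t != 0 by near: t; exact: nbhs_dnbhs_neq.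
have td : `|t| <= d.
  by rewrite -[t]subr0 distrC; near: t; apply: cvgr_dist_le => //; exact: nbhs_dnbhs.
have tp : 0 < `|t| by rewrite normr_gt0.
have := Hd t td; rewrite /F /= complex_of_coords_line real_coordsK.
move: (u _) (u z) => a b Hab.
have -> : l - t^-1 *: (a - b) = - (t^-1 * (a - b - l * t)).
  by rewrite /GRing.scale /=; field.
by rewrite normrN normrM normfV ler_pdivrMl// [leRHS]mulrC.
Unshelve. all: by end_near.
Qed.

Lemma sqrt_small (A e : R) : 0 <= A -> 0 < e -> exists2 d, 0 < d & forall x, x <= d -> A * Num.sqrt x <= e.
Proof.
move=> A0 e0; have A1 : 0 < 1 + A by rewrite ltr_pwDl.
exists ((e / (1 + A)) ^+ 2) => [|x xd]; first by rewrite exprn_gt0// divr_gt0.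
have : Num.sqrt x <= e / (1 + A).
  have h0 : 0 <= e / (1 + A) by rewrite divr_ge0// ltW.
  by rewrite -[leRHS](ger0_norm h0) -sqrtr_sqr ler_wsqrtr.
rewrite ler_pdivlMr// mulrDr mulr1 mulrC; apply: le_trans.
by rewrite lerDr sqrtr_ge0.
Qed.

(** The norm of a row vector is the maximum norm, so Hoelder bounds in it imply
    Euclidean ones. *)
Lemma nrm_euclidean z w : nrm (z - w) <= euclidean_dist z w.
Proof.
apply: nrm_rV_le; first exact: sqrtr_ge0.
move=> k; rewrite mxE [X in _ + X]mxE -[leLHS]ger0_norm ?ge0_normc// -sqrtr_sqr ler_wsqrtr//.
by rewrite (bigD1 k)//= lerDl sumr_ge0// => i _; rewrite sqr_ge0.
Qed.

(** A compact subset of an open set has a positive distance to the complement;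
    in covering form, depth is bounded below near each point. *)
Lemma compact_deep (Omega A : set Cn) : open Omega -> compact A -> A `<=` Omega ->
  exists2 r, 0 < r & forall z, A z -> deep Omega r z.
Proof.
move=> oO /compact_near_coveringP cA AO.
have : \forall r \near (0 : R)^'+, A `<=` deep Omega r.
  apply: cA => z /AO Oz; have [d d0 dz] := deep_open oO Oz.
  exists ([set w | nrm (w - z) <= d / 2], [set r : R | r <= d / 2]) => /=.
    split; last by apply: nbhs_right_le; rewrite divr_gt0.
    by apply/nbhs_nrmP; exists (d / 2); rewrite ?divr_gt0.
  move=> [w r] /= [wz rd] v vw; apply: dz.
  have -> : v - z = (v - w) + (w - z) by rewrite subrKA.
  by apply: le_trans (nrmD _ _) _; rewrite [d]splitr lerD// (le_trans vw).
move=> H; have [r [Hr r0]] : exists r : R, A `<=` deep Omega r /\ 0 < r.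
  apply: (@filter_ex _ (0^'+ : set_system R)).
  by near=> r; split; [near: r; exact: H|near: r; exact: nbhs_right_gt].
by exists r.
Unshelve. all: by end_near.
Qed.

End PartialDerivatives.

Lemma nrm_continuous {R : realType} {V : normedModType R[i]} (f : V -> R) (v : V) :
  (forall e : R, 0 < e -> exists2 d, 0 < d & forall w, nrm (w - v) <= d -> `|f v - f w| <= e) ->
  {for v, continuous f}.
Proof.
move=> H; apply/cvgrPdist_le => e e0; have [d d0 Hd] := H e e0.
by apply/nbhs_nrmP; exists d.
Qed.

(** * The kernel is C^{1,1/2} *)

Section Main.
Context {R : realType} {n : nat}.
Local Open Scope complex_scope.
Local Notation Cn := 'rV[R[i]]_n.
Implicit Types (z w h : Cn) (j : 'I_(n + n)) (r e : R).
Import Normc.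
Variables (Omega : set Cn) (p : R).
Hypotheses (oO : open Omega) (bO : bounded_set Omega) (p1 : 1 < p).
Local Notation g := (bergman_minimizer p Omega).
Local Notation bgrad := (bgrad Omega p).

Lemma bgradZ z (t : R) h : bgrad z (t%:C *: h) = bgrad z h * t.
Proof.
rewrite /bgrad linearZ /= -[X in complex.Re X]/(t%:C * ('d (g z) z h : R[i])).
by case: ('d _ _ _ : R[i]) => a b /=; ring.
Qed.

Lemma pderiv_kernel j z : Omega z ->
  pderivable j (bergman_kernel p Omega) z /\ pderiv j (bergman_kernel p Omega) z = bgrad z (unit_dir j).
Proof.
move=> Oz; apply: pderivP => e e0; have [s s0 dz] := deep_open oO Oz.
pose r := s / 2; have r0 : 0 < r by rewrite divr_gt0.
have rr : r + r = s by rewrite /r; field.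
have [rho rho0 [C C0 H]] := kernel_gradient oO bO p1 r0.
set N := nrm (unit_dir j : Cn); have N0 : 0 <= N by exact: nrm_ge0.
have N1 : 0 < 1 + N by rewrite ltr_pwDl.
have [d d0 Hd] := sqrt_small (mulr_ge0 (ltW C0) N0) e0.
exists (Num.min d (Num.min rho r) / (1 + N)); first by rewrite divr_gt0// !lt_min d0 rho0 r0.
move=> t; rewrite ler_pdivlMr// => tN.
have hE : nrm (t%:C *: unit_dir j : Cn) = `|t| * N by rewrite nrmZ normc_real.
have hm : nrm (t%:C *: unit_dir j : Cn) <= Num.min d (Num.min rho r).
  by apply: le_trans tN; rewrite hE ler_wpM2l// lerDr.
move: hm; rewrite !le_min => /and3P[hd hrho hr].
have dr : deep Omega r z by apply: deep_le dz; rewrite -rr lerDl ltW.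
have dw : deep Omega r (z + t%:C *: unit_dir j).
  by apply: (deep_sub (r := r) (z := z)); rewrite ?rr// addrAC subrr add0r.
have [T _] := H _ _ dr dw hrho.
rewrite !bergman_kernelE -bgradZ; apply: le_trans T _; rewrite {2}hE.
move: (Hd _ hd); move: (Num.sqrt _) => S HS.
have -> : C * S * (`|t| * N) = C * N * S * `|t| by ring.
by rewrite ler_wpM2r.
Qed.

(** Only the real part of the differential of the minimizer at the diagonal
    point enters, as the factor K(z) is a real constant in w. *)
Lemma pderiv_kernel_off j z : Omega z ->
  complex.Re (pderivC j (fun w => bergman_kernel_off p Omega w z) z) =
  (minp Omega p z)^-1 * complex.Re ('d (g z) z (unit_dir j) : R[i]).
Proof.
move=> Oz; rewrite /pderivC /=; apply: (pderivP _).2 => e e0.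
have [[bg g1] _] := bergman_minimizerP oO bO p1 Oz.
have dg : differentiable (g z) z by case: bg => hg _ _; exact: hg.
set k := (minp Omega p z)^-1; have k0 : 0 <= k by rewrite invr_ge0 powR_ge0.
set N := nrm (unit_dir j : Cn); have N0 : 0 <= N by exact: nrm_ge0.
have c0 : 0 < 1 + k * N by rewrite ltr_pwDl// mulr_ge0.
have [d d0 H] := differentiable_nrm dg (divr_gt0 e0 c0).
have N1 : 0 < 1 + N by rewrite ltr_pwDl.
exists (d / (1 + N)); first by rewrite divr_gt0.
move=> t; rewrite ler_pdivlMr// => tN.
have hE : nrm (t%:C *: unit_dir j : Cn) = `|t| * N by rewrite nrmZ normc_real.
have hd : nrm (t%:C *: unit_dir j : Cn) <= d.
  by apply: le_trans tN; rewrite hE ler_wpM2l// lerDr.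
have := H _ hd; set D : R[i] := 'd (g z) z (unit_dir j).
have -> : 'd (g z) z (t%:C *: unit_dir j) = t%:C * D by rewrite linearZ.
rewrite hE /bergman_kernel_off bergman_kernelE -/k.
move: (g z _) (g z z) D => a b D T.
have -> : complex.Re (a * k%:C) - complex.Re (b * k%:C) - k * complex.Re D * t = k * complex.Re (a - b - t%:C * D).
  by case: a b D {T} => a1 a2 [b1 b2] [D1 D2] /=; ring.
rewrite normrM (ger0_norm k0).
apply: (@le_trans _ _ (k * (e / (1 + k * N) * (`|t| * N)))).
  by rewrite ler_wpM2l// (le_trans (normc_Re _)).
have -> : k * (e / (1 + k * N) * (`|t| * N)) = e * `|t| * (k * N / (1 + k * N)) by field; rewrite gt_eqF.
by rewrite ler_piMr ?mulr_ge0 ?(ltW e0)// ler_pdivrMr// mul1r lerDr.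
Qed.

(** Close points are covered by the local estimate; for points at distance at
    least rho a uniform bound for the differential suffices. *)
Lemma pderiv_kernel_holder j r : 0 < r -> exists2 C, 0 < C & forall z w, deep Omega r z -> deep Omega r w ->
  `|pderiv j (bergman_kernel p Omega) z - pderiv j (bergman_kernel p Omega) w| <= C * Num.sqrt (nrm (z - w)).
Proof.
move=> r0; have [rho rho0 [C C0 H]] := kernel_gradient oO bO p1 r0.
have [L L0 HL] := minimizer_bounds_exist oO bO p1 r0.
set N := nrm (unit_dir j : Cn); have N0 : 0 <= N by exact: nrm_ge0.
have N1 : 0 < 1 + N by rewrite ltr_pwDl.
pose A := p * L ^+ 2 * (1 + N); have A0 : 0 < A.
  by rewrite !mulr_gt0 ?exprn_gt0// (lt_trans ltr01).
have q0 : 0 < Num.sqrt rho by rewrite sqrtr_gt0.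
exists (C * (1 + N) + 2 * A / Num.sqrt rho); first by apply: addr_gt0; [exact: mulr_gt0|apply: divr_gt0 => //; exact: mulr_gt0].
move=> z w dz dw; have Oz := deep_in (ltW r0) dz; have Ow := deep_in (ltW r0) dw.
rewrite (pderiv_kernel j Oz).2 (pderiv_kernel j Ow).2 mulrDl.
have s0 := sqrtr_ge0 (nrm (z - w)).
have [near|far] := leP (nrm (z - w)) rho.
  have := (H w (z - w) dw); rewrite subrKC => /(_ dz near)[_ /(_ (unit_dir j))] K.
  apply: (le_trans K); apply: (@le_trans _ _ (C * (1 + N) * Num.sqrt (nrm (z - w)))).
    by rewrite mulrAC ler_wpM2r// ler_pM2l// lerDr.
  by rewrite lerDl; apply: mulr_ge0 => //; apply: divr_ge0; apply: ltW => //; exact: mulr_gt0.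
have bA v : deep Omega r v -> `|bgrad v (unit_dir j)| <= A.
  move=> dv; apply: le_trans (bgrad_le p1 HL (unit_dir j) dv) _.
  by rewrite ler_pM2l ?lerDr// mulr_gt0 ?exprn_gt0// (lt_trans ltr01).
apply: (@le_trans _ _ (2 * A)).
  by apply: le_trans (ler_normB _ _) _; rewrite mulr_natl mulr2n lerD// bA.
apply: (@le_trans _ _ (2 * A / Num.sqrt rho * Num.sqrt (nrm (z - w)))); last first.
  by rewrite lerDr; apply: mulr_ge0 => //; apply: mulr_ge0; exact: ltW.
have A2 : 0 < 2 * A by exact: mulr_gt0.
by rewrite mulrAC ler_pdivlMr// (ler_pM2l A2); apply: ler_wsqrtr; exact: ltW.
Qed.

Lemma kernel_C1_holder : C1_holder 2^-1 Omega (bergman_kernel p Omega).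
Proof.
split=> [j z Oz|j z Oz|D dD cD DO j].
- exact: (pderiv_kernel j Oz).1.
- have [s s0 dz] := deep_open oO Oz.
  pose r := s / 2; have r0 : 0 < r by rewrite divr_gt0.
  have rr : r + r = s by rewrite /r; field.
  have [C C0 H] := pderiv_kernel_holder j r0.
  apply: nrm_continuous => e e0; have [d d0 Hd] := sqrt_small (ltW C0) e0.
  exists (Num.min d r) => [|w]; first by rewrite lt_min d0.
  rewrite le_min => /andP[wd wr]; apply: le_trans (H z w _ _) _.
  + by apply: deep_le dz; rewrite -rr lerDl ltW.
  + by apply: (deep_sub (r := r) (z := z)); rewrite ?rr.
  by apply: Hd; rewrite nrm_distC.
- have [r r0 Hr] := compact_deep oO cD DO; have [C C0 H] := pderiv_kernel_holder j r0.
  exists C => z w Dz Dw.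
  apply: le_trans (H z w (Hr _ (subset_closure Dz)) (Hr _ (subset_closure Dw))) _.
  rewrite ler_pM2l// powR12_sqrt ?sqrtr_ge0// ler_wsqrtr//; exact: nrm_euclidean.
Qed.

End Main.

Theorem theorem1p1 (R : realType) (n : nat) (n_gt0 : (0 < n)%N)
    (Omega : set 'rV[R[i]%C]_n) (domOmega : domain Omega)
    (bndOmega : bounded_set Omega) (p : R) (p_gt1 : 1 < p) :
  C1_holder 2^-1 Omega (bergman_kernel p Omega) /\
  forall (j : 'I_(n + n)) (z : 'rV[R[i]%C]_n), Omega z ->
    pderiv j (bergman_kernel p Omega) z =
    p * complex.Re (pderivC j (fun w => bergman_kernel_off p Omega w z) z).
Proof.
have [_ oO _] := domOmega; split; first exact: kernel_C1_holder.
move=> j z Oz; rewrite (pderiv_kernel oO bndOmega p_gt1 j Oz).2.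
by rewrite (pderiv_kernel_off oO bndOmega p_gt1) // mulrA.
Qed.
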